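(* Let $s$ be the relative interior of a face of $\Delta$. Then $\mu_T^{-1}(s)$ is equal to a stratum $S$ of the orbit type stratification in $M$ of the $T$-action, and also equal to the preimage under $\varpi:M\to M^{\mathrm{toric}}$ of a $T_{\mathbb{C}}$-orbit in $M^{\mathrm{toric}}$. If $s=\{v\}$ for a vertex $v$, then $\mu_T^{-1}(s)=\{m_v\}$ for the unique fixed point $m_v$ in $M$ for the $T$-action such that $\mu_T(m_v)=v$. The mapping $s\mapsto\mu_T^{-1}(s)$ is a bijection from the set $\Sigma_\Delta$ of all relative interiors of faces of $\Delta$ onto the set $\Sigma$ of all strata of the orbit type stratification in $M$ for the action of $T$. If $s,s'\in\Sigma_\Delta$ then $s$ is contained in the closure of $s'$ in $\Delta$ if and only if $\mu_T^{-1}(s)$ is contained in the closure of $\mu_T^{-1}(s')$ in $M$. For each vertex $v$ of $\Delta$, the domain of definition $M_v$ of $\varphi_v$ in $M$ is equal to the union of the $S\in\Sigma$ such that $m_v$ belongs to the closure of $S$ in $M$. The domain of definition $M_v^{\mathrm{toric}}=\varpi(M_v)$ of $\Phi_v$ is equal to the union of the corresponding strata of the $T$-action in $M^{\mathrm{toric}}$, each of which is a $T_{\mathbb{C}}$-orbit in $M^{\mathrm{toric}}$. $M_v$ and $M_v^{\mathrm{toric}}$ are open cells in $M$ and $M^{\mathrm{toric}}$, respectively.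
   Context: For a finite set $B$ and a set $A$, $A^B$ is the set of functions $B\to A$; for $z\in A^B$ write $z_f=z(f)$. Let $T$ be an $n$-dimensional torus (compact, connected, commutative Lie group) with Lie algebra $\mathfrak{t}$, exponential map $\exp:\mathfrak{t}\to T$, and integral lattice $\mathfrak{t}_{\mathbb{Z}}:=\ker(\exp)$; the induced isomorphism $\mathfrak{t}/\mathfrak{t}_{\mathbb{Z}}\to T$ is also denoted $\exp$. Let $\Delta\subset\mathfrak{t}^*$ be an $n$-dimensional convex polytope, $F$ the set of its codimension one faces, $V$ the set of its vertices, and $F_v=\{f\in F\mid v\in f\}$ for $v\in V$. ''Faces'' are nonempty and include $\Delta$ itself. Assume $\Delta$ is a Delzant polytope: (i) for each $f\in F$ there are $X_f\in\mathfrak{t}$, $\lambda_f\in\mathbb{R}$ such that the hyperplane containing $f$ is $\{\xi\mid\langle X_f,\xi\rangle+\lambda_f=0\}$ and $\Delta\subset\{\xi\mid\langle X_f,\xi\rangle+\lambda_f\ge 0\}$ (with $X_f$ normalized to be primitive in $\mathfrak{t}_{\mathbb{Z}}$, which makes $X_f,\lambda_f$ unique); (ii) for every $v\in V$ the $X_f$, $f\in F_v$, form a $\mathbb{Z}$-basis of $\mathfrak{t}_{\mathbb{Z}}$. Reduced phase space: Let $\pi:\mathbb{R}^F\to\mathfrak{t}$, $\pi(t)=\sum_{f\in F}t_fX_f$, with induced surjection $\pi':\mathbb{R}^F/\mathbb{Z}^F\to\mathfrak{t}/\mathfrak{t}_{\mathbb{Z}}$; $\mathfrak{n}=\ker\pi$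 and $N=\ker(\exp\circ\pi')\subset\mathbb{R}^F/\mathbb{Z}^F$ (a torus with Lie algebra $\mathfrak n$). $\mathbb{R}^F/\mathbb{Z}^F$ acts on $\mathbb{C}^F$ by $(t\cdot z)_f=e^{2\pi i t_f}z_f$. Let $\mu(z)_f=|z_f|^2/2$, viewed as $\mu:\mathbb{C}^F\to(\mathbb{R}^F)^*$, $\lambda=(\lambda_f)_{f\in F}\in(\mathbb{R}^F)^*$, $\iota_{\mathfrak n}^*:(\mathbb{R}^F)^*\to\mathfrak{n}^*$ restriction, and $Z:=\{z\in\mathbb{C}^F\mid\iota_{\mathfrak n}^*(\mu(z))=\iota_{\mathfrak n}^*(\lambda)\}$, a compact smooth submanifold on which $N$ acts freely. $M:=Z/N$ with projection $p:Z\to M$ is a compact connected smooth $2n$-manifold; $T\simeq(\mathbb{R}^F/\mathbb{Z}^F)/N$ acts on $M$; $\mu_T:M\to\mathfrak{t}^*$ is determined by $\pi^*\circ\mu_T\circ p=(\mu-\lambda)|_Z$, and $\mu_T(M)=\Delta$. For $v\in V$: $\rho_v:\mathbb{C}^F\to\mathbb{C}^{F_v}$ is restriction to $F_v$; $U_v$ is the interior of $\rho_v(Z)$ in $\mathbb{C}^{F_v}$; $Z_v:=\rho_v^{-1}(U_v)\cap Z$; $M_v:=Z_v/N\subset M$ (open); $\mu_v:\mathbb{C}^{F_v}\to\mathfrak{t}^*$ is defined by $|z_f|^2/2-\lambda_f=\langle X_f,\mu_v(z)\rangle$ for $f\in F_v$; $r_f(\xi)=(2(\langle X_f,\xi\rangle+\lambda_f))^{1/2}$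 for $\xi\in\Delta$, $f\in F$; $s_v:U_v\to Z_v$ is $s_v(z)_f=z_f$ for $f\in F_v$, $s_v(z)_{f'}=r_{f'}(\mu_v(z))$ for $f'\in F\setminus F_v$; $\psi_v:=p\circ s_v$ is a diffeomorphism from $U_v$ onto $M_v$, and $\varphi_v:=\psi_v^{-1}:M_v\to U_v$. Toric variety: $(\mathbb{C}^\times)^F$ acts on $\mathbb{C}^F$ by coordinatewise multiplication. $N_{\mathbb{C}}\subset(\mathbb{C}^\times)^F$ is the complexification of $N$: the image of $\mathfrak{n}\oplus i\mathfrak{n}\subset\mathbb{C}^F$ under $t\mapsto(e^{2\pi i t_f})_{f\in F}$. $\mathbb{C}^F_v:=\{z\in\mathbb{C}^F\mid z_f\ne0\ \forall f\in F\setminus F_v\}$, $\mathbb{C}^F_\Delta:=\bigcup_{v\in V}\mathbb{C}^F_v$. $N_{\mathbb{C}}$ acts freely and properly on $\mathbb{C}^F_\Delta$, and $M^{\mathrm{toric}}:=\mathbb{C}^F_\Delta/N_{\mathbb{C}}$ is a complex $n$-dimensional complex manifold with an action of $T_{\mathbb{C}}:=(\mathbb{C}^\times)^F/N_{\mathbb{C}}$, the complexification of $T$. $M^{\mathrm{toric}}_v:=\mathbb{C}^F_v/N_{\mathbb{C}}$ is open in $M^{\mathrm{toric}}$. The map $\Psi_v:\mathbb{C}^{F_v}\to M^{\mathrm{toric}}_v$ sends $z$ to the $N_{\mathbb{C}}$-orbit of the element $S_v(z)\in\mathbb{C}^F_v$ with $S_v(z)_f=z_f$ for $f\in F_v$ and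 $S_v(z)_f=1$ for $f\in F\setminus F_v$; it is a complex analytic diffeomorphism, with inverse $\Phi_v:M_v^{\mathrm{toric}}\to\mathbb{C}^{F_v}$. The inclusion $Z\subset\mathbb{C}^F_\Delta$ followed by the projection $\mathbb{C}^F_\Delta\to M^{\mathrm{toric}}$ induces a $T$-equivariant diffeomorphism $\varpi:M\to M^{\mathrm{toric}}$. The strata of the orbit type stratification for an action of $T$ are the connected components of the sets of points having a given stabilizer subgroup. An open cell is an open subset diffeomorphic to $\mathbb{R}^{2n}$. *)

(* Defs.v *)
From HB Require Import structures.
From mathcomp Require Import all_boot all_order all_algebra.
From mathcomp Require Import complex ring.
From mathcomp Require Import all_classical all_reals all_analysis.

Set Implicit Arguments.
Unset Strict Implicit.
Unset Printing Implicit Defensive.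

Import Order.TTheory GRing.Theory Num.Theory.
Import numFieldNormedType.Exports.

Local Open Scope classical_set_scope.
Local Open Scope ring_scope.
Local Open Scope quotient_scope.

(* The Lie algebra t is R^n as row vectors, its dual t^* is R^n as column
   vectors. *)
Section Convex.
Context {R : realType} {n : nat}.
Implicit Types (X : 'rV[R]_n) (xi : 'cV[R]_n) (P s : set 'cV[R]_n).

Definition pairing X xi : R := (X *m xi) 0 0.

Definition convex_polytope P : Prop :=
  [/\ P !=set0, bounded_set P &
      exists m (Y : 'I_m -> 'rV[R]_n) (c : 'I_m -> R),
        P = [set xi | forall i, 0 <= pairing (Y i) xi + c i]].

(* A face is the nonempty set of points of P at which some linear functional
   is minimal; the zero functional gives P itself. *)
Definition face P s : Prop :=
  s !=set0 /\ exists X,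
    s = [set xi | P xi /\ forall eta, P eta -> pairing X xi <= pairing X eta].

Definition vertex P v : Prop := face P [set v].

Definition affine_hull P : set 'cV[R]_n :=
  [set xi | forall a (W : {vspace 'cV[R]_n}),
    (forall eta, P eta -> eta - a \in W) -> xi - a \in W].

Definition affine_dim P (k : nat) : Prop :=
  exists a (W : {vspace 'cV[R]_n}),
    \dim W = k /\ affine_hull P = [set xi | xi - a \in W].

Definition relint P : set 'cV[R]_n :=
  [set xi | P xi /\ \forall eta \near xi, affine_hull P eta -> P eta].

Definition facet_of P s : Prop :=
  face P s /\ exists2 k, affine_dim s k & k.+1 = n.

Definition full_lattice (L : set 'rV[R]_n) : Prop :=
  exists2 B : 'M[R]_n, B \in unitmx &
    L = [set X | exists k : 'rV[int]_n, X = map_mx intr k *m B].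

Definition primitive (L : set 'rV[R]_n) X : Prop :=
  L X /\ forall (k : nat) Y, L Y -> X = Y *+ k -> k = 1%N.

Definition Zbasis (L : set 'rV[R]_n) (d : nat) (X : 'I_d -> 'rV[R]_n)
    (A : {set 'I_d}) : Prop :=
  (forall f, f \in A -> L (X f)) /\
  forall Y, L Y -> exists! k : {ffun 'I_d -> int},
    (forall f, f \notin A -> k f = 0) /\ Y = \sum_(f in A) X f *~ k f.

End Convex.

(* The torus T is given by its exponential map: a surjective homomorphism
   R^n -> T of abelian groups whose kernel is a lattice of rank n.  The
   facets are indexed without repetition by 'I_nfacets. *)
Record delzant (R : realType) (n : nat) (T : zmodType) := Delzant {
  texp : {additive 'rV[R]_n -> T} ;
  texp_surj : forall g, exists X, texp X = g ;
  texp_ker : full_lattice [set X | texp X = 0] ;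
  polytope : set 'cV[R]_n ;
  polytopeP : convex_polytope polytope ;
  polytope_dim : affine_dim polytope n ;
  nfacets : nat ;
  facet : 'I_nfacets -> set 'cV[R]_n ;
  facetP : set_bij [set: 'I_nfacets] (facet_of polytope) facet ;
  normal : 'I_nfacets -> 'rV[R]_n ;
  offset : 'I_nfacets -> R ;
  normal_primitive : forall f, primitive [set X | texp X = 0] (normal f) ;
  facet_hyperplane : forall f,
    affine_hull (facet f) = [set xi | pairing (normal f) xi + offset f = 0] ;
  facet_halfspace : forall f xi,
    polytope xi -> 0 <= pairing (normal f) xi + offset f ;
  vertex_Zbasis : forall v, vertex polytope v ->
    Zbasis [set X | texp X = 0] normal [set f | `[< facet f v >]]%SET
}.

(* C^d as a real normed space: the pair of the vectors of real and of
   imaginary parts. *)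
Section ComplexSpace.
Context {R : realType}.

Definition Cn (d : nat) : Type := ('rV[R]_d * 'rV[R]_d)%type.
HB.instance Definition _ d := NormedModule.on (Cn d).

Definition coo d (z : Cn d) (f : 'I_d) : R[i] := (z.1 0 f +i* z.2 0 f)%C.

Definition ofcoo d (w : 'I_d -> R[i]) : Cn d :=
  (\row_f complex.Re (w f), \row_f complex.Im (w f)).

Definition sqnorm (w : R[i]) : R := complex.Re w ^+ 2 + complex.Im w ^+ 2.

Definition cexp (w : R[i]) : R[i] :=
  let: (a +i* b)%C := w in (expR a * cos b +i* (expR a * sin b))%C.

Definition expi2pi (t : R[i]) : R[i] := cexp ((2 * pi) *i%C * t).

Definition cscale d (w : 'I_d -> R[i]) (z : Cn d) : Cn d :=
  ofcoo (fun f => w f * coo z f).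

Definition rotate d (t : 'rV[R]_d) : Cn d -> Cn d :=
  cscale (fun f => expi2pi (t 0 f)%:C%C).

Lemma coo_ofcoo d (w : 'I_d -> R[i]) f : coo (ofcoo w) f = w f.
Proof. by rewrite /coo /ofcoo /= !mxE; case: (w f). Qed.

Lemma coo_inj d (z z' : Cn d) : coo z =1 coo z' -> z = z'.
Proof.
case: z z' => [x y] [x' y'] E; congr pair; apply/rowP => f.
  by have [] := E f.
by have [] := E f.
Qed.

Lemma cexpD (v w : R[i]) : cexp (v + w) = cexp v * cexp w.
Proof.
case: v w => [a b] [c e]; rewrite /cexp /= expRD cosD sinD.
by apply/eqP; rewrite eq_complex /=; apply/andP; split; apply/eqP; ring.
Qed.

Lemma cexp0 : cexp 0 = 1.
Proof. by rewrite /cexp /= expR0 cos0 sin0 mulr1 mulr0. Qed.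

Lemma expi2piD s t : expi2pi (s + t) = expi2pi s * expi2pi t.
Proof. by rewrite /expi2pi mulrDr cexpD. Qed.

Lemma expi2pi0 : expi2pi 0 = 1.
Proof. by rewrite /expi2pi mulr0 cexp0. Qed.

Lemma cscale_comp d (v w : 'I_d -> R[i]) z :
  cscale v (cscale w z) = cscale (fun f => v f * w f) z.
Proof. by apply: coo_inj => f; rewrite !coo_ofcoo mulrA. Qed.

Lemma cscale1 d (w : 'I_d -> R[i]) z : (forall f, w f = 1) -> cscale w z = z.
Proof. by move=> w1; apply: coo_inj => f; rewrite coo_ofcoo w1 mul1r. Qed.

Lemma eq_cscale d (v w : 'I_d -> R[i]) z : v =1 w -> cscale v z = cscale w z.
Proof. by move=> vw; apply: coo_inj => f; rewrite !coo_ofcoo vw. Qed.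

Lemma rotateD d (s t : 'rV[R]_d) z : rotate (s + t) z = rotate s (rotate t z).
Proof.
rewrite /rotate cscale_comp; apply: eq_cscale => f.
by rewrite mxE rmorphD expi2piD.
Qed.

Lemma rotate0 d (z : Cn d) : rotate 0 z = z.
Proof. by apply: cscale1 => f; rewrite mxE expi2pi0. Qed.

Lemma sqnormM (v w : R[i]) : sqnorm (v * w) = sqnorm v * sqnorm w.
Proof. by case: v w => [a b] [c e]; rewrite /sqnorm /=; ring. Qed.

Lemma sqnorm_expi2pi (t : R) : sqnorm (expi2pi t%:C%C) = 1.
Proof.
rewrite /expi2pi /cexp /sqnorm /= mul0r mulr0 subr0 expR0 !mul1r.
by rewrite cos2Dsin2.
Qed.

Lemma sqnorm_rotate d (t : 'rV[R]_d) z f :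
  sqnorm (coo (rotate t z) f) = sqnorm (coo z f).
Proof. by rewrite coo_ofcoo sqnormM sqnorm_expi2pi mul1r. Qed.

End ComplexSpace.
Arguments Cn : clear implicits.

(* C^k by iterating directional derivatives in all directions; this is the
   usual notion when E is finite-dimensional and O is open. *)
Fixpoint Cdiff (R : realType) (E : normedModType R) (k : nat) (O : set E)
    (g : E -> R) : Prop :=
  (forall x, O x -> {for x, continuous g}) /\
  if k is k'.+1 then
    forall v, (forall x, O x -> derivable g x v) /\ Cdiff k' O ('D_v g)
  else True.

Definition smooth (R : realType) (E : normedModType R) (O : set E)
    (g : E -> R) : Prop := forall k, Cdiff k O g.

(* [smoothQ W g] says that g is smooth on the open set W of the manifold Q.
   A homeomorphism is a diffeomorphism iff it identifies the smooth functions
   on all open sets. *)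
Definition open_cell (R : realType) (m : nat) (Q : topologicalType)
    (smoothQ : set Q -> (Q -> R) -> Prop) (O : set Q) : Prop :=
  open O /\ exists h : 'rV[R]_m -> Q,
    [/\ set_bij setT O h, continuous h,
        (forall A, open A -> open (h @` A)) &
        forall W, open W -> W `<=` O -> forall g,
          smoothQ W g <-> smooth (h @^-1` W) (g \o h)].

Definition stabilizer (T Q : Type) (act : T -> Q -> Q) (q : Q) : set T :=
  [set g | act g q = q].

Definition strata (T : Type) (Q : topologicalType) (act : T -> Q -> Q)
    (A : set Q) : set (set Q) :=
  [set S | exists2 q, A q & S = connected_component
    [set q' | A q' /\ stabilizer act q' = stabilizer act q] q].

Section Spaces.
Context {R : realType} {n : nat} {T : zmodType} (D : delzant R n T).

Notation d := (nfacets D).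
Notation CF := (Cn R d).

Definition facets_at (v : 'cV[R]_n) : {set 'I_d} :=
  [set f | `[< facet f v >]]%SET.

Definition relints : set (set 'cV[R]_n) := relint @` face (polytope D).

Definition projT (t : 'rV[R]_d) : 'rV[R]_n := \sum_f t 0 f *: normal f.

Lemma projTD s t : projT (s + t) = projT s + projT t.
Proof.
by rewrite -big_split; apply: eq_bigr => f _; rewrite mxE scalerDl.
Qed.

Lemma projTN t : projT (- t) = - projT t.
Proof.
by rewrite /projT -sumrN; apply: eq_bigr => f _; rewrite mxE scaleNr.
Qed.

Lemma projT0 : projT 0 = 0.
Proof. by rewrite /projT big1 // => f _; rewrite mxE scale0r. Qed.

(* Elements of R^F/Z^F are represented by elements of R^F: Z^F acts trivially
   on C^F. *)
Definition inN (t : 'rV[R]_d) : Prop := texp D (projT t) = 0.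

Definition Zlevel : set CF :=
  [set z | forall t : 'rV[R]_d, projT t = 0 ->
    \sum_f t 0 f * (sqnorm (coo z f) / 2) = \sum_f t 0 f * offset f].

Lemma Zlevel_rotate t z : Zlevel z -> Zlevel (rotate t z).
Proof.
move=> Zz s /Zz <-; apply: eq_bigr => f _.
by rewrite sqnorm_rotate.
Qed.

Definition rotateZ (t : 'rV[R]_d) (z : Zlevel) : Zlevel :=
  SigSub (mem_set (Zlevel_rotate t (set_valP z))).

Definition Nrel (z z' : Zlevel) : bool :=
  `[< exists2 t, inN t & z' = rotateZ t z >].

Lemma rotateZD s t z : rotateZ (s + t) z = rotateZ s (rotateZ t z).
Proof. by apply: val_inj; rewrite /= rotateD. Qed.

Lemma rotateZ0 z : rotateZ 0 z = z.
Proof. by apply: val_inj; rewrite /= rotate0. Qed.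

Lemma inN0 : inN 0.
Proof. by rewrite /inN projT0 raddf0. Qed.

Lemma inND s t : inN s -> inN t -> inN (s + t).
Proof. by rewrite /inN projTD raddfD => -> ->; rewrite addr0. Qed.

Lemma inNN t : inN t -> inN (- t).
Proof. by rewrite /inN projTN raddfN => ->; rewrite oppr0. Qed.

Lemma Nrel_equiv : equiv_class_of Nrel.
Proof.
split.
- by move=> z; apply/asboolP; exists 0; [exact: inN0|rewrite rotateZ0].
- have sym z z' : Nrel z z' -> Nrel z' z.
    move=> /asboolP[t tN ->]; apply/asboolP; exists (- t); first exact: inNN.
    by rewrite -rotateZD addNr rotateZ0.
  by move=> z z'; apply/idP/idP; exact: sym.
- move=> y x z /asboolP[t tN ->] /asboolP[s sN ->]; apply/asboolP.
  by exists (s + t); [exact: inND|rewrite rotateZD].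
Qed.

Canonical Nrel_equiv_rel := EquivRelPack Nrel_equiv.

Definition Mred : Type := quotient_topology {eq_quot Nrel}.
HB.instance Definition _ := Topological.on Mred.
HB.instance Definition _ := Quotient.on Mred.

(* A representative in R^F of the element of (R^F/Z^F)/N corresponding to g. *)
Definition torus_lift (g : T) : 'rV[R]_d :=
  xget 0 [set t | texp D (projT t) = g].

Definition actM (g : T) (m : Mred) : Mred :=
  \pi_Mred (rotateZ (torus_lift g) (repr m)).

Lemma actME t (z : Zlevel) :
  actM (texp D (projT t)) (\pi_Mred z) = \pi_Mred (rotateZ t z).
Proof.
rewrite /actM /torus_lift; case: xgetP => [s _ /= sE|/(_ t)/(_ erefl)] //.
have /eqmodP/asboolP[r rN ->] : z = repr (\pi_Mred z) %[mod {eq_quot Nrel}].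
  by rewrite reprK.
apply/eqmodP/asboolP; exists (t - r - s).
  by rewrite /inN !(projTD, projTN) !(raddfD, raddfN) /= sE rN subr0 subrr.
by rewrite -!rotateZD !subrK.
Qed.

(* pi^* o mu_T o p = (mu - lambda)|_Z, evaluated on the unit vectors. *)
Definition muT (m : Mred) : 'cV[R]_n :=
  xget 0 [set xi | forall f : 'I_d, pairing (normal f) xi =
    sqnorm (coo (set_val (repr m)) f) / 2 - offset f].

Definition restrict_at v (z : CF) : Cn R #|facets_at v| :=
  ofcoo (fun j => coo z (enum_val j)).

Definition Uat v : set (Cn R #|facets_at v|) :=
  interior (restrict_at v @` Zlevel).

Definition Mat v : set Mred :=
  [set m | exists2 z : Zlevel,
    Uat (restrict_at v (set_val z)) & m = \pi_Mred z].

(* Z is an embedded submanifold of C^F, so its smooth functions are locally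
   the restrictions of smooth functions on C^F; g is smooth on W iff its
   pullback to Z is. *)
Definition smoothM (W : set Mred) (g : Mred -> R) : Prop :=
  forall z : Zlevel, W (\pi_Mred z) ->
    exists (O : set CF) (G : CF -> R),
      [/\ open O, O (set_val z), smooth O G &
          forall z' : Zlevel, O (set_val z') -> W (\pi_Mred z') ->
            G (set_val z') = g (\pi_Mred z')].

Definition strataM : set (set Mred) := strata actM setT.

Definition fixedM (m : Mred) : Prop := forall g, actM g m = m.

Definition NCrel (z z' : CF) : bool :=
  `[< exists a b, [/\ projT a = 0, projT b = 0 &
      z' = cscale (fun f => expi2pi (a 0 f +i* b 0 f)%C) z] >].

Lemma NCrel_equiv : equiv_class_of NCrel.
Proof.
split.
- move=> z; apply/asboolP; exists 0, 0; rewrite projT0; split => //.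
  by rewrite cscale1 // => f; rewrite !mxE expi2pi0.
- have sym z z' : NCrel z z' -> NCrel z' z.
    move=> /asboolP[a [b [a0 b0 ->]]]; apply/asboolP; exists (- a), (- b).
    rewrite !projTN a0 b0 oppr0; split => //.
    rewrite cscale_comp cscale1 // => f; rewrite -expi2piD !mxE.
    by rewrite -[X in expi2pi X]/(complex.Complex _ _) !addNr expi2pi0.
  by move=> z z'; apply/idP/idP; exact: sym.
- move=> y x z /asboolP[a [b [a0 b0 ->]]] /asboolP[a' [b' [a0' b0' ->]]].
  apply/asboolP; exists (a' + a), (b' + b).
  rewrite !projTD a0 b0 a0' b0' addr0; split => //.
  rewrite cscale_comp; apply: eq_cscale => f; rewrite -expi2piD !mxE.
  by [].
Qed.

Canonical NCrel_equiv_rel := EquivRelPack NCrel_equiv.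

(* M^toric is realised as a subset of the quotient of all of C^F by N_C.
   Since C^F_Delta is open and N_C-invariant, the subspace topology on M^toric
   is the quotient topology of C^F_Delta / N_C, and M^toric is open. *)
Definition CFmodNC : Type := quotient_topology {eq_quot NCrel}.
HB.instance Definition _ := Topological.on CFmodNC.
HB.instance Definition _ := Quotient.on CFmodNC.

Definition CFat (v : 'cV[R]_n) : set CF :=
  [set z | forall f, f \notin facets_at v -> coo z f != 0].

Definition CFDelta : set CF := \bigcup_(v in vertex (polytope D)) CFat v.

Definition Mtoric : set CFmodNC := \pi_CFmodNC @` CFDelta.

Definition Mtoric_at v : set CFmodNC := \pi_CFmodNC @` CFat v.

Definition actToric (g : T) (q : CFmodNC) : CFmodNC :=
  \pi_CFmodNC (rotate (torus_lift g) (repr q)).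

Definition strataToric : set (set CFmodNC) := strata actToric Mtoric.

(* T_C = (C^x)^F / N_C acts through representatives in (C^x)^F. *)
Definition TCorbit (q : CFmodNC) : set CFmodNC :=
  [set q' | exists (z : CF) (w : 'I_d -> R[i]),
    [/\ q = \pi_CFmodNC z, (forall f, w f != 0) & q' = \pi_CFmodNC (cscale w z)]].

Definition TCorbits : set (set CFmodNC) := TCorbit @` Mtoric.

Definition smoothToric (W : set CFmodNC) (g : CFmodNC -> R) : Prop :=
  smooth (\pi_CFmodNC @^-1` W) (g \o \pi_CFmodNC).

Definition varpi (m : Mred) : CFmodNC := \pi_CFmodNC (set_val (repr m)).

End Spaces.

Arguments muT {R n T} D m.
Arguments Mat {R n T} D v.
Arguments smoothM {R n T} D W g.
Arguments Mtoric_at {R n T} D v.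
Arguments smoothToric {R n T} D W g.
Arguments varpi {R n T} D m.
Arguments relints {R n T} D _.
Arguments strataM {R n T} D _.
Arguments strataToric {R n T} D _.
Arguments TCorbits {R n T} D _.

(* Main.v *)
Require Import Defs.
From mathcomp Require Import all_boot all_order all_algebra.
From mathcomp Require Import complex ring lra zify.
From mathcomp Require Import all_classical all_reals all_analysis.
(* [cscale] is to denote the action on C^F, not the scaling of charges. *)
Import Defs.

(** The theorem reads off everything from one datum: the set of facets on
    which a point vanishes.

    On the polytope side, P is the intersection of the half-spaces of its
    facets ([polytopeE]), and writing [active xi] for the set of facets through
    xi, the relative interiors of the faces are exactly the nonempty sets
    { xi in P | active xi = I } ([relintsE]); such a set lies in the closure of
    the one for J iff J is contained in I ([open_face_closure]).  Every
    [active xi] is contained in some [active v] with v a vertex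
    ([vertex_above]), and conversely every subset of [active v] occurs
    ([open_face_below]).  At a vertex the normals have a dual basis that is
    integral on the lattice ([exists_dual_basis]).

    On M, the moment map satisfies l_f(mu_T [z]) = |z_f|^2/2 ([muT_pi]), so that
    [active (muT m)] is the set of vanishing coordinates of m.  The fibres of
    mu_T are T-orbits, and the stabilizer of m is the subtorus generated by the
    normals of the vanishing coordinates ([stabilizerM]).  Distinct faces can
    have equal stabilizers, but nested ones cannot ([subtorus_inj]); as the
    vanishing set is upper semicontinuous, it is locally constant on the set of
    points with a given stabilizer.  Together with the connectedness of the sets
    over relatively open faces ([connected_stratum]), which are images of
    convex sets times a torus, this identifies the strata ([strataME]); the
    closure relations follow by moving along segments of P ([closure_stratum]).

    On the toric variety the same analysis applies once one knows that every
    N_C-orbit in C^F_Delta meets Z ([kempf_ness]).  This is a convex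
    minimization: on ker pi the function
    sum_f |z_f|^2/(8 pi) exp(-4 pi b_f) + lambda_f b_f is coercive modulo
    directions that the dual basis at a vertex controls, and a critical point b
    is exactly an element with exp(-2 pi b) z in Z.

    It remains to show that M_v and M_v^toric are cells.  Laurent monomials with
    the integral exponents given by the dual basis divide out N and N_C.  For
    M_v^toric this already gives the chart onto C^n ([toric_cell]).  For M_v it
    gives the star-shaped domain U_v = { w | l_f(mu_v w) > 0, f not in F_v },
    which is mapped diffeomorphically onto R^2n by the radial dilation
    w |-> w (1 + sum_f l_f(v)/l_f(mu_v w))^(1/2).  The inverse dilation is given
    by a scalar equation ([is_radius]), whose solution is smooth by a direct
    computation ([smooth_radius]).  Smoothness being defined by iterated
    directional derivatives, the chain rule is proved first
    ([Cdiff_frame]). *)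

Set Implicit Arguments.
Unset Strict Implicit.
Unset Printing Implicit Defensive.

Import Order.TTheory GRing.Theory Num.Theory.
Import numFieldNormedType.Exports.

Local Open Scope classical_set_scope.
Local Open Scope ring_scope.

(** * Iterated directional derivatives and the chain rule *)

Section Calculus.
Context {R : realType}.
Implicit Types E F : normedModType R.

Lemma Cdiff_continuous E k (O : set E) (g : E -> R) :
  Cdiff k O g -> forall x, O x -> {for x, continuous g}.
Proof. by case: k => [|k] []. Qed.

Lemma Cdiff_subset E k (O O' : set E) (g : E -> R) :
  O' `<=` O -> Cdiff k O g -> Cdiff k O' g.
Proof.
move=> sO; elim: k g => [|k IH] g /= [cg dg]; split => //.
- by move=> x /sO /cg.
- by move=> x /sO /cg.
move=> v; have [dv Dv] := dg v; split; last exact: IH.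
by move=> x /sO; exact: dv.
Qed.

Lemma CdiffW E k (O : set E) (g : E -> R) : Cdiff k.+1 O g -> Cdiff k O g.
Proof.
elim: k g => [|k IH] g [cg dg]; split => // v.
by have [dv /IH Dv] := dg v.
Qed.

Lemma open_near E (O : set E) x : open O -> O x -> \forall y \near x, O y.
Proof. by move=> oO Ox; apply: open_nbhs_nbhs. Qed.

Lemma near_eq_continuous E (g g' : E -> R) x :
  (\forall y \near x, g y = g' y) -> {for x, continuous g} ->
  {for x, continuous g'}.
Proof.
move=> gg' cg; rewrite /prop_for /continuous_at -(nbhs_singleton gg').
by apply: cvg_trans cg; exact: near_eq_cvg.
Qed.

Lemma Cdiff_ext E k (O : set E) (g g' : E -> R) : open O ->
  (forall x, O x -> g x = g' x) -> Cdiff k O g -> Cdiff k O g'.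
Proof.
move=> oO; elim: k g g' => [|k IH] g g' gg' [cg dg].
  split=> // x Ox; apply: near_eq_continuous (cg _ Ox).
  by apply: filterS (open_near oO Ox).
have nE x : O x -> \forall y \near x, g y = g' y.
  by move=> Ox; have := open_near oO Ox; apply: filterS.
split=> [x Ox|v]; first exact: near_eq_continuous (nE _ Ox) (cg _ Ox).
have [dv Dv] := dg v; split.
  by move=> x Ox; apply: near_eq_derivable (dv _ Ox); exact: nE.
by apply: IH Dv => x Ox; apply: near_eq_derive; exact: nE.
Qed.

(** Used with neighbourhoods that depend on the point, for functions known only
    locally to be restrictions of smooth ones. *)
Lemma Cdiff_local E k (O : set E) (g : E -> R) :
  (forall x, O x -> exists2 U : set E, U x & Cdiff k U g) -> Cdiff k O g.
Proof.
elim: k g => [|k IH] g loc.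
  by split=> // x /loc [U Ux [cg _]]; exact: cg.
split=> [x /loc [U Ux [cg _]]|v]; first exact: cg.
split=> [x /loc [U Ux [_ /(_ v)[dv _]]]|]; first exact: dv.
by apply: IH => x /loc [U Ux [_ /(_ v)[_ Dv]]]; exists U.
Qed.

Lemma Cdiff_cst E k (O : set E) (c : R) : Cdiff k O (fun=> c).
Proof.
elim: k c => [|k IH] c; split=> //.
- by move=> x _; exact: cst_continuous.
- by move=> x _; exact: cst_continuous.
- move=> v; split=> [x _|]; first exact: derivable_cst.
  rewrite (_ : 'D_v _ = fun=> 0); first exact: IH.
  by apply/funext => x; rewrite derive_cst.
Qed.

(** Only the values on O of the candidate derivatives [dg] matter, which is what
    makes inductions on the order of differentiability go through: the explicit
    formula for a derivative is again a combination of C^k functions. *)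
Lemma CdiffS E k (O : set E) (g : E -> R) (dg : E -> E -> R) : open O ->
  (forall x, O x -> {for x, continuous g}) ->
  (forall x v, O x -> is_derive x v g (dg v x)) ->
  (forall v, Cdiff k O (dg v)) -> Cdiff k.+1 O g.
Proof.
move=> oO cg hd Dg; split=> // v; split=> [x Ox|].
  by have [] := hd x v Ox.
by apply: Cdiff_ext (Dg v) => // x Ox; have [_ ->] := hd x v Ox.
Qed.

Lemma is_derive_linear E (c : E -> R) (x v : E) :
  linear c -> is_derive x v c (c v).
Proof.
move=> lc; have D h : h != 0 -> h^-1 *: (c (h *: v + x) - c x) = c v.
  by move=> h0; rewrite (lc h v x) addrK scalerA mulVf ?scale1r.
have C : h^-1 *: (c (h *: v + x) - c x) @[h --> 0^'] --> c v.
  apply: cvg_near_cst.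
  by near=> h; rewrite D //; near: h; exact: nbhs_dnbhs_neq.
split; first exact: (cvgP (c v) C).
exact/cvg_lim.
Unshelve. all: by end_near. Qed.

Lemma Cdiff_linear E k (O : set E) (c : E -> R) : open O ->
  continuous c -> linear c -> Cdiff k O c.
Proof.
move=> oO cc lc; case: k => [|k]; first by split=> // x _; exact: cc.
apply: (CdiffS (dg := fun v _ => c v)) => // [x _|x v _|v].
- exact: cc.
- exact: is_derive_linear.
- exact: Cdiff_cst.
Qed.

Lemma CdiffP E k (O : set E) (g : E -> R) : Cdiff k.+1 O g ->
  forall x v, O x -> is_derive x v g ('D_v g x).
Proof. by case=> _ dg x v Ox; apply: derivableP; have [dv _] := dg v; exact: dv. Qed.

Lemma Cdiff_D E k (O : set E) (g : E -> R) : Cdiff k.+1 O g ->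
  forall v, Cdiff k O ('D_v g).
Proof. by case=> _ dg v; have [] := dg v. Qed.

Lemma CdiffD E k (O : set E) (f g : E -> R) : open O ->
  Cdiff k O f -> Cdiff k O g -> Cdiff k O (fun x => f x + g x).
Proof.
move=> oO; elim: k f g => [|k IH] f g Hf Hg.
  by split=> // x Ox; apply: cvgD; [exact: Hf.1|exact: Hg.1].
apply: (CdiffS (dg := fun v x => 'D_v f x + 'D_v g x)) => // [x Ox|x v Ox|v].
- by apply: cvgD; [exact: Hf.1|exact: Hg.1].
- by apply: is_deriveD; [exact: CdiffP Hf _ _ _|exact: CdiffP Hg _ _ _].
- by apply: IH; exact: Cdiff_D.
Qed.

Lemma CdiffM E k (O : set E) (f g : E -> R) : open O ->
  Cdiff k O f -> Cdiff k O g -> Cdiff k O (fun x => f x * g x).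
Proof.
move=> oO; elim: k f g => [|k IH] f g Hf Hg.
  by split=> // x Ox; apply: cvgM; [exact: Hf.1|exact: Hg.1].
apply: (CdiffS (dg := fun v x => f x * 'D_v g x + g x * 'D_v f x)) => // [x Ox|x v Ox|v].
- by apply: cvgM; [exact: Hf.1|exact: Hg.1].
- by apply: is_deriveM; [exact: CdiffP Hf _ _ _|exact: CdiffP Hg _ _ _].
- by apply: CdiffD => //; apply: IH; (exact: Cdiff_D||exact: CdiffW).
Qed.

Lemma CdiffV E k (O : set E) (f : E -> R) : open O ->
  (forall x, O x -> f x != 0) ->
  Cdiff k O f -> Cdiff k O (fun x => (f x)^-1).
Proof.
move=> oO f0; elim: k => [|k IH] Hf.
  by split=> // x Ox; apply: cvgV; [exact: f0|exact: Hf.1].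
apply: (CdiffS (dg := fun v x => (-1) * ((f x)^-1 * (f x)^-1) * 'D_v f x)) => // [x Ox|x v Ox|v].
- by apply: cvgV; [exact: f0|exact: Hf.1].
- have [dv E1] := CdiffP Hf v Ox.
  split; first exact: derivableV (f0 _ Ox) dv.
  by rewrite deriveV ?f0 //= -exprVn expr2 mulN1r.
- have IV := IH (CdiffW Hf).
  apply: CdiffM => //; last exact: Cdiff_D.
  by apply: CdiffM => //; [exact: Cdiff_cst|exact: CdiffM].
Qed.

Lemma is_derive1P E (f : E -> R) x v df :
  is_derive x v f df <-> is_derive (0 : R) 1 (fun h => f (h *: v + x)) df.
Proof.
have De : 'D_1 (fun h : R => f (h *: v + x)) 0 = 'D_v f x.
  rewrite /derive; set g1 := fun h => h^-1 *: _; set g2 := fun h => h^-1 *: _.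
  suff -> : g1 = g2 by [].
  by rewrite funeqE /g1 /g2 => h /=; rewrite addr0 scale0r add0r [_%:A]mulr1.
by split=> -[dv E1]; split; rewrite ?De -?E1 ?De //;
  [exact: (derivable1P f x v).1|exact: (derivable1P f x v).2].
Qed.

Lemma is_derive_sqrt E (f : E -> R) x v df : 0 < f x -> is_derive x v f df ->
  is_derive x v (fun y => Num.sqrt (f y)) ((2 * Num.sqrt (f x))^-1 * df).
Proof.
move=> f0 /is_derive1P hf; apply/is_derive1P.
have hs : is_derive (f (0 *: v + x)) 1 Num.sqrt (2 * Num.sqrt (f x))^-1.
  by rewrite scale0r add0r; exact: is_derive1_sqrt.
exact: (is_derive1_comp hs hf).
Qed.

Lemma Cdiff_sqrt E k (O : set E) (f : E -> R) : open O ->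
  (forall x, O x -> 0 < f x) ->
  Cdiff k O f -> Cdiff k O (fun x => Num.sqrt (f x)).
Proof.
move=> oO f0.
have cs x : O x -> {for x, continuous f} -> {for x, continuous (fun x => Num.sqrt (f x))}.
  by move=> Ox cf; apply: (continuous_comp cf); exact: sqrt_continuous.
elim: k => [|k IH] Hf.
  by split=> // x Ox; apply: cs => //; exact: Hf.1.
apply: (CdiffS (dg := fun v x => (2 * Num.sqrt (f x))^-1 * 'D_v f x)) => // [x Ox|x v Ox|v].
- by apply: cs => //; exact: Hf.1.
- by apply: is_derive_sqrt; [exact: f0|exact: CdiffP Hf _ _ _].
- apply: CdiffM => //; last exact: Cdiff_D.
  apply: CdiffV => // [x Ox|].
    by rewrite mulf_neq0 // gt_eqF // sqrtr_gt0 f0.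
  by apply: CdiffM => //; [exact: Cdiff_cst|exact: IH (CdiffW Hf)].
Qed.

(** The step d may be negative: in [increment_cvg] it is the increment of a
    coordinate, whose sign is unknown. *)
Lemma MVT_direction F (G : F -> R) (e a : F) (d : R) :
  (forall t, `|t| <= `|d| -> derivable G (a + t *: e) e) ->
  exists2 t, `|t| <= `|d| & G (a + d *: e) - G a = d * 'D_e G (a + t *: e).
Proof.
move=> dG; pose f (t : R) := G (a + t *: e); pose df (t : R) : R := 'D_e G (a + t *: e).
have fd (t : R) : `|t| <= `|d| -> is_derive t 1 f (df t).
  move=> /dG/derivableP/is_derive1P h; apply/is_derive1P; move: h.
  rewrite (_ : (fun h => G (h *: e + _)) = fun h => f (h%:A + t)) //.
  by apply/funext => h; rewrite /f [_%:A]mulr1 scalerDl addrCA.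
have mvt (b c : R) : b <= c -> `|b| <= `|d| -> `|c| <= `|d| ->
    exists2 t, `|t| <= `|d| & f c - f b = df t * (c - b).
  move=> bc bd cd.
  have sub (t : R) : t \in `[b, c] -> `|t| <= `|d|.
    rewrite in_itv /= => /andP[bt tc]; rewrite ler_norml.
    move: bd cd; rewrite !ler_norml => /andP[h1 _] /andP[_ h2].
    by rewrite (le_trans h1 bt) (le_trans tc h2).
  have fc : {within `[b, c], continuous f}.
    apply: derivable_within_continuous => t /sub/fd ft; exact: ex_derive.
  have [t tbc E1] := MVT_segment bc (fun t h => fd t (sub t (subset_itv_oo_cc h))) fc.
  by exists t => //; exact: sub.
have f0 : f 0 = G a by rewrite /f scale0r addr0.
have n0 : `|0 : R| <= `|d| by rewrite normr0 normr_ge0.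
have [d0|/ltW d0] := leP 0 d.
  have [t td E1] := mvt 0 d d0 n0 (lexx _).
  by exists t => //; rewrite -f0 -/(f d) E1 subr0 mulrC.
have [t td E1] := mvt d 0 d0 (lexx _) n0.
by exists t => //; rewrite -f0 -/(f d) -opprB E1 sub0r mulrN opprK mulrC.
Qed.

(** The contribution of one coordinate to the chain rule.  The base point a(h)
    moves with h, so the derivative of G at P alone does not control the
    quotient; the mean value theorem turns the increment of G into delta(h)
    times a value of D_e G at a point close to P, and continuity of D_e G
    concludes. *)
Lemma increment_cvg F (G : F -> R) (e P : F) (a : R -> F) (delta : R -> R)
    (d' : R) (O : set F) :
  open O -> O P -> (forall y, O y -> derivable G y e) ->
  {for P, continuous ('D_e G)} ->
  a h @[h --> 0^'] --> P -> delta h @[h --> 0^'] --> (0 : R) ->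
  h^-1 * delta h @[h --> 0^'] --> d' ->
  h^-1 * (G (a h + delta h *: e) - G (a h)) @[h --> 0^'] --> 'D_e G P * d'.
Proof.
move=> oO OP dG cG ca cd cd'.
(* The value at delta h = 0 is the one that makes [psi] continuous. *)
pose psi h : R := if delta h == 0 then 'D_e G P
                  else (G (a h + delta h *: e) - G (a h)) / delta h.
have psiE h : h^-1 * (G (a h + delta h *: e) - G (a h)) = psi h * (h^-1 * delta h).
  rewrite /psi; case: eqP => [->|/eqP d0]; first by rewrite scale0r addr0 subrr !mulr0.
  by rewrite mulrCA divfK.
under eq_fun do rewrite psiE.
apply: cvgM cd'; apply/cvgrPdist_lt => eps eps0.
have : \forall y \near P, O y /\ `|'D_e G P - 'D_e G y| < eps.
  apply: filterI; first exact: open_near.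
  by have /cvgrPdist_lt /(_ _ eps0) := cG.
move=> /nbhs_ballP[r /= r0 br].
have r20 : 0 < r / 2 by rewrite divr_gt0.
have cde : delta h *: e @[h --> 0^'] --> (0 : F).
  by rewrite -(scale0r e); apply: cvgZr_tmp.
near=> h.
have hP : `|P - a h| < r / 2 by near: h; have /cvgrPdist_lt /(_ _ r20) := ca.
have hd : `|0 - delta h *: e| < r / 2 by near: h; have /cvgrPdist_lt /(_ _ r20) := cde.
have inb (t : R) : `|t| <= `|delta h| -> ball P r (a h + t *: e).
  move=> td; rewrite -ball_normE /= opprD addrA [r]splitr.
  apply: le_lt_trans (ler_normB _ _) _; apply: ltrD => //.
  apply: le_lt_trans hd; rewrite sub0r normrN !normrZ.
  by rewrite ler_wpM2r.
rewrite /psi; case: eqP => [_|/eqP d0]; first by rewrite subrr normr0.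
have [t /inb/br[_ tP] ->] := MVT_direction (fun t h => dG _ (br _ (inb t h)).1).
by rewrite mulrC mulKf.
Unshelve. all: by end_near. Qed.

Section Frame.
Context {E F : normedModType R} {J : Type}.

(** Induction on the list of directions: the coefficient of the first direction
    is frozen into the base point b, and its variation is handled by
    [increment_cvg]. *)
Lemma is_derive_frame (G : F -> R) (O : set F) (e : J -> F) (gam : J -> E -> R)
    (x v : E) (dgam : J -> R) (s : seq J) (b : F) :
  open O -> O (b + \sum_(j <- s) gam j x *: e j) ->
  (forall j y, O y -> derivable G y (e j)) ->
  (forall j y, O y -> {for y, continuous ('D_(e j) G)}) ->
  (forall j, {for x, continuous (gam j)}) ->
  (forall j, is_derive x v (gam j) (dgam j)) ->
  is_derive x v (fun y => G (b + \sum_(j <- s) gam j y *: e j))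
    (\sum_(j <- s) 'D_(e j) G (b + \sum_(j <- s) gam j x *: e j) * dgam j).
Proof.
move=> oO + dG cG cg hg; elim: s b => [|j s IH] b.
  rewrite !big_nil => _; rewrite (_ : (fun y => _) = cst (G (b + 0))).
    exact: is_derive_cst.
  by apply/funext => y; rewrite big_nil.
rewrite !big_cons addrA => OP.
pose A y := b + gam j x *: e j + \sum_(j <- s) gam j y *: e j.
pose D y := G (A y + (gam j y - gam j x) *: e j) - G (A y).
have AE y : A y + (gam j y - gam j x) *: e j =
    b + (gam j y *: e j + \sum_(j <- s) gam j y *: e j).
  rewrite /A addrAC -[b + _ + _]addrA -scalerDl (addrC (gam j x)) subrK.
  by rewrite addrA.
have fE : (fun y => G (b + \sum_(i <- j :: s) gam i y *: e i)) =
    (fun y => G (A y)) + D.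
  by apply/funext => y; rewrite big_cons -AE /GRing.add /= /D addrC subrK.
rewrite fE -addrA.
have Ax : b + (gam j x *: e j + \sum_(i <- s) gam i x *: e i) = A x.
  by rewrite /A addrA.
rewrite -addrA !Ax in OP *.
have hx : h *: v + x @[h --> (0 : R)^'] --> x.
  rewrite -[X in _ --> X]add0r -(scale0r v).
  apply: cvgD; last exact: cvg_cst.
  by apply: cvgZr_tmp; exact: nbhs_dnbhs.
have cA : {for x, continuous A}.
  apply: cvgD; first exact: cvg_cst.
  by apply: (cvg_big (op := +%R)) => [|i _]; [exact: add_continuous|]; apply: cvgZr_tmp; exact: cg.
have hD : is_derive x v D ('D_(e j) G (A x) * dgam j).
  have Dx : D x = 0 by rewrite /D subrr scale0r addr0 subrr.
  have C : h^-1 *: (D (h *: v + x) - D x) @[h --> 0^'] --> 'D_(e j) G (A x) * dgam j.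
    rewrite Dx; under eq_fun do rewrite subr0.
    apply: (increment_cvg (a := fun h => A (h *: v + x))
      (delta := fun h => gam j (h *: v + x) - gam j x) oO OP) => //.
    - exact: dG.
    - exact: cG.
    - by apply: (cvg_comp _ _ hx); exact: cA.
    - rewrite -[X in _ --> X](subrr (gam j x)); apply: cvgB; last exact: cvg_cst.
      by apply: (cvg_comp _ _ hx); exact: cg.
    - by have [dv <-] := hg j; exact: dv.
  by split; [exact: (cvgP _ C)|exact/cvg_lim].
have hA := IH (b + gam j x *: e j) OP.
by apply: is_derive_eq (is_deriveD hA hD) _; rewrite addrC.
Qed.

End Frame.

(** By the chain rule, D_v (G o phi) is the sum of the
    (D_(e j) G o phi) D_v (gam j), where D_(e j) G has one order less; the
    induction is therefore over all G at once. *)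
Lemma Cdiff_frame E F (J : finType) k (G : F -> R) (O' : set F) (O : set E)
    (e : J -> F) (gam : J -> E -> R) (phi : E -> F) :
  open O -> open O' -> (forall x, O x -> O' (phi x)) ->
  (forall x, phi x = \sum_j gam j x *: e j) ->
  (forall j, Cdiff k O (gam j)) ->
  Cdiff k O' G -> Cdiff k O (G \o phi).
Proof.
move=> oO oO' sO phiE.
have cphi x : O x -> (forall j, {for x, continuous (gam j)}) -> {for x, continuous phi}.
  move=> Ox cg; rewrite (_ : phi = fun x => \sum_j gam j x *: e j); last exact/funext.
  by apply: (cvg_big (op := +%R)) => [|j _]; [exact: add_continuous|]; apply: cvgZr_tmp; exact: cg.
elim: k G => [|k IH] G hg hG.
  split=> // x Ox; apply: continuous_comp; last by apply: hG.1; exact: sO.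
  by apply: cphi => // j; exact: (hg j).1.
apply: (CdiffS (dg := fun v x =>
  \sum_j ('D_(e j) G \o phi) x * 'D_v (gam j) x)) => // [x Ox|x v Ox|v].
- apply: continuous_comp; last by apply: hG.1; exact: sO.
  by apply: cphi => // j; exact: (hg j).1.
- rewrite (_ : G \o phi = fun y => G (0 + \sum_(j <- index_enum J) gam j y *: e j)); last first.
    by apply/funext => y; rewrite add0r /= phiE.
  apply: is_derive_eq.
    apply: (is_derive_frame (O := O') (dgam := fun j => 'D_v (gam j) x)) => //.
    + by rewrite add0r -phiE; exact: sO.
    + by move=> j y O'y; have [] := CdiffP hG (e j) O'y.
    + by move=> j y O'y; exact: (Cdiff_continuous (Cdiff_D hG (e j))).
    + by move=> j; exact: (hg j).1.
    + by move=> j; exact: CdiffP (hg j) _ _ _.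
  by rewrite add0r -phiE.
- have : forall s : seq J, Cdiff k O
      (fun x => \sum_(j <- s) ('D_(e j) G \o phi) x * 'D_v (gam j) x).
    elim=> [|j s IHs]; first by under eq_fun do rewrite big_nil; exact: Cdiff_cst.
    under eq_fun do rewrite big_cons.
    apply: CdiffD => //; apply: CdiffM => //; last exact: Cdiff_D.
    by apply: IH => [i|]; [exact: CdiffW|exact: Cdiff_D].
  by apply.
Qed.

End Calculus.

(** * The polytope as an intersection of facet half-spaces *)

Section Pairing.
Context {R : realType} {n : nat}.
Implicit Types (X : 'rV[R]_n) (xi eta : 'cV[R]_n).

Lemma pairingDr X xi eta : pairing X (xi + eta) = pairing X xi + pairing X eta.
Proof. by rewrite /pairing mulmxDr mxE. Qed.
Lemma pairingZl (a : R) X xi : pairing (a *: X) xi = a * pairing X xi.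
Proof. by rewrite /pairing -scalemxAl mxE. Qed.
Lemma pairingZr (a : R) X xi : pairing X (a *: xi) = a * pairing X xi.
Proof. by rewrite /pairing -scalemxAr mxE. Qed.
Lemma pairingNr X xi : pairing X (- xi) = - pairing X xi.
Proof. by rewrite /pairing mulmxN mxE. Qed.
Lemma pairingBr X xi eta : pairing X (xi - eta) = pairing X xi - pairing X eta.
Proof. by rewrite pairingDr pairingNr. Qed.
Lemma pairing0l xi : pairing 0 xi = 0.
Proof. by rewrite /pairing mul0mx mxE. Qed.
Lemma pairing0r X : pairing X 0 = 0.
Proof. by rewrite /pairing mulmx0 mxE. Qed.
Lemma pairing_suml (J : Type) (s : seq J) (P : pred J) (F : J -> 'rV[R]_n) xi :
  pairing (\sum_(j <- s | P j) F j) xi = \sum_(j <- s | P j) pairing (F j) xi.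
Proof. by rewrite /pairing mulmx_suml summxE. Qed.
Lemma pairing_sumr (J : Type) (s : seq J) (P : pred J) X (F : J -> 'cV[R]_n) :
  pairing X (\sum_(j <- s | P j) F j) = \sum_(j <- s | P j) pairing X (F j).
Proof. by rewrite /pairing mulmx_sumr summxE. Qed.

Lemma pairing_eq0 X : (forall xi, pairing X xi = 0) -> X = 0.
Proof.
move=> X0; apply/rowP => i; have := X0 (delta_mx i 0).
rewrite /pairing !mxE (bigD1 i) //= big1 ?addr0 => [|j ji].
  by rewrite !mxE !eqxx mulr1.
by rewrite !mxE (negbTE ji) mulr0.
Qed.

Lemma pairing_continuous X : continuous (pairing X).
Proof.
rewrite (_ : pairing X = fun x : 'cV[R]_n => \sum_i X 0 i * x i 0); last first.
  by apply/funext => x; rewrite /pairing mxE.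
apply: (@continuous_big _ _ +%R) => [|i _]; first exact: add_continuous.
by move=> x; apply: continuousM; [exact: cst_continuous|exact: coord_continuous].
Qed.

Definition affine X (c : R) xi : R := pairing X xi + c.

Lemma affine_line X c xi eta (t : R) :
  affine X c (xi + t *: (eta - xi)) = (1 - t) * affine X c xi + t * affine X c eta.
Proof. by rewrite /affine pairingDr pairingZr pairingBr; ring. Qed.

Lemma affine_continuous X c : continuous (affine X c).
Proof.
by move=> xi; apply: continuousD; [exact: pairing_continuous|exact: cst_continuous].
Qed.

Definition kernel_of X : {vspace 'cV[R]_n} :=
  lker (linfun (mulmx X : 'cV[R]_n -> 'M[R]_1)).

Lemma kernel_ofP X xi : (xi \in kernel_of X) = (pairing X xi == 0).
Proof.
rewrite memv_ker lfunE /= /pairing; apply/eqP/eqP => [->|h]; first by rewrite mxE.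
by apply/matrixP => i j; rewrite !ord1 h mxE.
Qed.

Lemma dim_kernel_of X : X != 0 -> (\dim (kernel_of X)).+1 = n.
Proof.
move=> X0; have := limg_ker_dim (linfun (mulmx X : 'cV[R]_n -> 'M[R]_1)) fullv.
rewrite capfv -/(kernel_of X) !dimvf /dim /= muln1.
suff -> : (linfun (mulmx X : 'cV[R]_n -> 'M[R]_1) @: fullv)%VS = fullv.
  by rewrite dimvf /dim /= addn1.
apply/eqP; rewrite eqEdim subvf dimvf /dim /= lt0n dimv_eq0.
apply: contra X0 => /eqP h; apply/eqP/pairing_eq0 => xi.
have := memv_img (linfun (mulmx X : 'cV[R]_n -> 'M[R]_1)) (memvf xi).
by rewrite h memv0 lfunE /= /pairing => /eqP ->; rewrite mxE.
Qed.

Lemma affine_hull_affine X c (s : set 'cV[R]_n) : s !=set0 ->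
  (forall eta, s eta -> affine X c eta = 0) ->
  forall xi, affine_hull s xi -> affine X c xi = 0.
Proof.
move=> [a sa] s0 xi /(_ a (kernel_of X)) h.
have : xi - a \in kernel_of X.
  apply: h => eta seta; rewrite kernel_ofP pairingBr.
  by have := s0 _ seta; have := s0 _ sa; rewrite /affine => h1 h2; apply/eqP; lra.
rewrite kernel_ofP pairingBr => /eqP; have := s0 _ sa; rewrite /affine; lra.
Qed.

Lemma affine_hull_pairing X (s : set 'cV[R]_n) a : s a ->
  (forall eta, s eta -> pairing X eta = pairing X a) ->
  forall xi, affine_hull s xi -> pairing X xi = pairing X a.
Proof.
move=> sa h xi /(affine_hull_affine (X := X) (c := - pairing X a)) => /(_ _ _)/eqP.
rewrite /affine subr_eq0 => h'; apply/eqP/h'; first by exists a.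
by move=> eta /h ->; rewrite subrr.
Qed.

(** A subspace containing the difference of a and of a point of the line through
    a contains the direction of that line. *)
Lemma affine_hull_line (s : set 'cV[R]_n) a (e : R) xi : s a -> e != 0 ->
  s (a + e *: (xi - a)) -> affine_hull s xi.
Proof.
move=> sa e0 sx b W h; have := memvB (h _ sx) (h _ sa).
rewrite opprB addrA subrK addrAC subrr add0r => hW.
have : e^-1 *: (e *: (xi - a)) \in W by exact: memvZ.
rewrite scalerA mulVf // scale1r => xa.
by have := memvD xa (h _ sa); rewrite addrA subrK.
Qed.

Lemma subset_affine_hull (s : set 'cV[R]_n) : s `<=` affine_hull s.
Proof. by move=> x sx a W; apply. Qed.

End Pairing.

Section Generic.
Context {R : realType}.

(** The sum of the ratios |b_j|/a_j bounds each of them, which gives an explicit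
    step. *)
Lemma small_step (J : finType) (P : pred J) (a b : J -> R) :
  (forall j, P j -> 0 < a j) ->
  exists e : R, [/\ 0 < e, e <= 1 & forall j, P j -> 0 < a j + e * b j].
Proof.
move=> a0; pose S := \sum_(j | P j) `|b j| / a j.
have S0 : 0 <= S by apply: sumr_ge0 => j Pj; rewrite divr_ge0 // ltW // a0.
have S1 : 0 < 1 + S by rewrite ltr_wpDr.
exists (1 + S)^-1; split; first by rewrite invr_gt0.
  by rewrite invf_le1 // lerDl.
move=> j Pj; have aj := a0 _ Pj.
have bS : `|b j| / a j <= S.
  rewrite /S (bigD1 j) //= lerDl; apply: sumr_ge0 => i /andP[Pi _].
  by rewrite divr_ge0 // ltW // a0.
have : `|b j| < (1 + S) * a j.
  rewrite ler_pdivrMr // in bS; apply: le_lt_trans bS _.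
  by rewrite ltr_pM2r // ltrDr.
have := ler_norm (- b j); rewrite normrN => h1 h2.
rewrite -(@pmulr_rgt0 _ (1 + S)) // mulrDr mulrA mulfV ?gt_eqF // mul1r.
lra.
Qed.

(** Choose xi on as few of the hyperplanes as possible.  The midpoint of xi and
    eta lies only on the hyperplanes common to both, so by minimality eta lies on
    all those through xi. *)
Lemma generic_point n (J : finType) (Y : J -> 'rV[R]_n) (c : J -> R)
    (C : set 'cV[R]_n) : C !=set0 ->
  (forall xi eta, C xi -> C eta -> C (xi + 2^-1 *: (eta - xi))) ->
  (forall xi j, C xi -> 0 <= affine (Y j) (c j) xi) ->
  exists2 xi, C xi & forall eta j, C eta ->
    affine (Y j) (c j) xi = 0 -> affine (Y j) (c j) eta = 0.
Proof.
move=> [x0 Cx0] mid pos.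
pose act xi : {set J} := [set j | affine (Y j) (c j) xi == 0]%SET.
pose S (A : {set J}) := `[< exists2 xi, C xi & A = act xi >].
have S0 : S (act x0) by apply/asboolP; exists x0.
case: (arg_minnP (fun A : {set J} => #|A|) S0) => A /asboolP[xi Cxi AE] Amin.
exists xi => // eta j Ceta h.
pose zeta := xi + 2^-1 *: (eta - xi).
have Cz : C zeta by exact: mid.
have zE i : affine (Y i) (c i) zeta = (affine (Y i) (c i) xi + affine (Y i) (c i) eta) / 2.
  by rewrite affine_line; field.
have zsub i : i \in act zeta -> i \in A /\ affine (Y i) (c i) eta = 0.
  rewrite inE zE AE inE; have := pos xi i Cxi; have := pos eta i Ceta => h1 h2 /eqP h3.
  by split; [apply/eqP; lra|lra].
have sA : act zeta \subset A by apply/fintype.subsetP => i /zsub[].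
have : act zeta == A.
  by rewrite eqEcard sA Amin //; apply/asboolP; exists zeta.
move=> /eqP zA; have : j \in act zeta by rewrite zA AE inE h.
by case/zsub.
Qed.

End Generic.

Section Polytope.
Context {R : realType} {n : nat} {T : zmodType} (D : delzant R n T).
Notation P := (polytope D).
Notation d := (nfacets D).

Definition slack (f : 'I_d) (xi : 'cV[R]_n) : R := affine (normal f) (offset f) xi.

Lemma polytope_convex xi eta (t : R) : P xi -> P eta -> 0 <= t <= 1 ->
  P (xi + t *: (eta - xi)).
Proof.
have [_ _ [m [Y [c ->]]]] := polytopeP D => /= h1 h2 /andP[t0 t1] i.
rewrite -/(affine _ _ _) affine_line addr_ge0 // mulr_ge0 ?subr_ge0 //; [exact: h1|exact: h2].
Qed.

Lemma half01 : 0 <= (2^-1 : R) <= 1.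
Proof. by apply/andP; split; lra. Qed.

Lemma slack_ge0 f xi : P xi -> 0 <= slack f xi.
Proof. exact: facet_halfspace. Qed.

Lemma facet_face (f : 'I_d) : face P (facet f).
Proof. by have [+ _ _] := facetP D => /(_ f I)[]. Qed.


Lemma facetE (f : 'I_d) xi : facet f xi <-> P xi /\ slack f xi = 0.
Proof.
have [[a fa] [X E]] := facet_face f.
have fP eta : facet f eta -> P eta by rewrite E => -[].
have fA eta : facet f eta -> slack f eta = 0.
  move=> h; have : affine_hull (facet f) eta by exact: subset_affine_hull.
  by rewrite facet_hyperplane.
split=> [h|[Px x0]]; first by split; [exact: fP|exact: fA].
have hx : affine_hull (facet f) xi by rewrite facet_hyperplane.
have min eta : P eta -> pairing X a <= pairing X eta.
  by move: fa; rewrite E => -[_]; exact.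
have xa : pairing X xi = pairing X a.
  apply: (affine_hull_pairing fa) hx => eta feta; apply/eqP.
  rewrite eq_le min ?andbT; last exact: fP.
  by move: feta; rewrite E => -[_]; apply; exact: fP.
by rewrite E; split=> // eta /min; rewrite xa.
Qed.

Lemma facets_atE v : P v -> forall f, (f \in facets_at D v) = (slack f v == 0).
Proof.
move=> Pv f; rewrite inE; apply/asboolP/eqP; first by case/facetE.
by move=> h; apply/facetE.
Qed.

Lemma affine_hull_polytope xi : affine_hull P xi.
Proof.
have [a [W [dW E]]] := polytope_dim D; rewrite E /=.
suff -> : W = fullv by exact: memvf.
by apply/eqP; rewrite eqEdim subvf dimvf /dim /= muln1 dW.
Qed.

(** Keep an irredundant subfamily of the given inequalities.  On the way from an
    interior point x0 to a point violating only the i-th of them, there is a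
    point zeta of P where the i-th is an equality and the others are strict; so
    the i-th hyperplane meets P in a facet, which is one of those indexed by D
    and hence has the same hyperplane and the same side. *)
Lemma polytopeE xi : P xi <-> forall f, 0 <= slack f xi.
Proof.
split=> [Px f|]; first exact: slack_ge0.
have [P0 _ [m [Y [c PE]]]] := polytopeP D.
have Ppos eta j : P eta -> 0 <= affine (Y j) (c j) eta by rewrite PE; exact.
have mid x y : P x -> P y -> P (x + 2^-1 *: (y - x)).
  by move=> Px Py; apply: polytope_convex => //; exact: half01.
have [x0 Px0 gen] := generic_point P0 mid Ppos.
have x0pos j : Y j != 0 -> 0 < affine (Y j) (c j) x0.
  move=> Yj; rewrite lt0r Ppos // andbT; apply: contra Yj => /eqP h.
  have h0 eta : affine (Y j) (c j) eta = 0.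
    by apply: (affine_hull_affine P0) (affine_hull_polytope eta) => z Pz; exact: gen h.
  apply/eqP/pairing_eq0 => z; have := h0 z; have := h0 0.
  by rewrite /affine pairing0r; lra.
pose S (A : {set 'I_m}) := `[< forall eta,
  (forall j, j \in A -> 0 <= affine (Y j) (c j) eta) -> P eta >].
have S0 : S [set: 'I_m]%SET.
  by apply/asboolP => eta h; rewrite PE => j; apply: h; rewrite inE.
case: (arg_minnP (fun A : {set 'I_m} => #|A|) S0) => A /asboolP SA Amin.
move=> xpos; apply: (SA) => i iA; rewrite leNgt; apply/negP => xi_neg.
have : ~ (forall eta,
    (forall j, j \in (A :\ i)%SET -> 0 <= affine (Y j) (c j) eta) -> P eta).
  by move=> /asboolP/Amin; rewrite (cardsD1 i A) iA add1n ltnn.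
move=> /existsNP[eta /not_implyP[eta_pos nPeta]].
have eta_neg : affine (Y i) (c i) eta < 0.
  rewrite ltNge; apply/negP => ei; apply: nPeta; apply: SA => j jA.
  by have [->//|ji] := eqVneq j i; apply: eta_pos; rewrite !inE ji.
have Yi j : j \in A -> Y j != 0.
  move=> jA; apply/eqP => Yj.
  have : S (A :\ j)%SET.
    apply/asboolP => z zpos; apply: SA => k kA; have [->|kj] := eqVneq k j.
      by have := Ppos x0 j Px0; rewrite /affine Yj !pairing0l.
    by apply: zpos; rewrite !inE kj.
  by move=> /Amin; rewrite (cardsD1 j A) jA add1n ltnn.
have x0i := x0pos i (Yi i iA).
pose t := affine (Y i) (c i) x0 / (affine (Y i) (c i) x0 - affine (Y i) (c i) eta).
have den : 0 < affine (Y i) (c i) x0 - affine (Y i) (c i) eta by lra.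
have t01 : 0 < t < 1.
  by rewrite divr_gt0 //= ltr_pdivrMr // mul1r; lra.
pose zeta := x0 + t *: (eta - x0).
have zi : affine (Y i) (c i) zeta = 0.
  by rewrite affine_line /t; field; rewrite gt_eqF.
have zpos j : j \in A -> j != i -> 0 < affine (Y j) (c j) zeta.
  move=> jA ji; rewrite affine_line; case/andP: t01 => t0 t1.
  apply: ltr_pwDl; first by rewrite mulr_gt0 ?subr_gt0 // x0pos // Yi.
  by rewrite mulr_ge0 ?(ltW t0) // eta_pos // !inE ji.
have Pz : P zeta.
  by apply: SA => j jA; have [->|ji] := eqVneq j i; [rewrite zi|exact/ltW/zpos].
pose Fi := [set x | P x /\ affine (Y i) (c i) x = 0].
have hullF x : affine_hull Fi x <-> affine (Y i) (c i) x = 0.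
  split=> [|xi0]; first by apply: affine_hull_affine => [|z []//]; exists zeta.
  have [e [e0 e1 he]] := small_step (P := [pred j | (j \in A) && (j != i)])
     (fun j => affine (Y j) (c j) x - affine (Y j) (c j) zeta)
     (fun j h => zpos j (andP h).1 (andP h).2).
  have ai : affine (Y i) (c i) (zeta + e *: (x - zeta)) = 0.
    by rewrite affine_line zi xi0 !mulr0 addr0.
  apply: (affine_hull_line (a := zeta) (e := e)); rewrite ?gt_eqF //.
  split=> //; apply: SA => j jA; have [->|ji] := eqVneq j i; first by rewrite ai.
  have := he j; rewrite inE jA ji => /(_ isT); rewrite affine_line; lra.
have : facet_of P Fi.
  split.
    split; first by exists zeta.
    exists (Y i); apply/seteqP; split=> x /= [Px h]; split=> //.
      by move=> y /(Ppos _ i); move: h; rewrite /affine; lra.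
    have := Ppos _ i Px; have := h _ Pz; move: zi; rewrite /affine; lra.
  exists (\dim (kernel_of (Y i))); last exact/dim_kernel_of/Yi.
  exists zeta, (kernel_of (Y i)); split=> //; apply/seteqP; split=> x /=.
    by move/hullF; move: zi; rewrite kernel_ofP pairingBr /affine => h1 h2; apply/eqP; lra.
  by rewrite kernel_ofP pairingBr => /eqP h; apply/hullF; move: zi h; rewrite /affine; lra.
have [_ _ surj] := facetP D; move=> /surj[f _ fF].
(* Both affine functions vanish on the affine hull of the facet. *)
have same x : (slack f x = 0) <-> affine (Y i) (c i) x = 0.
  rewrite -hullF -fF facet_hyperplane; exact: iff_refl.
have f0 : 0 < slack f x0.
  rewrite lt0r slack_ge0 // andbT; apply/eqP => /same h; by rewrite h ltxx in x0i.
have := xpos f => fx.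
pose u := affine (Y i) (c i) x0 / (affine (Y i) (c i) x0 - affine (Y i) (c i) xi).
have denu : 0 < affine (Y i) (c i) x0 - affine (Y i) (c i) xi by lra.
have /andP[u0 u1] : 0 < u < 1.
  by rewrite divr_gt0 //= ltr_pdivrMr // mul1r; lra.
have : affine (Y i) (c i) (x0 + u *: (xi - x0)) = 0.
  by rewrite affine_line /u; field; rewrite gt_eqF.
move/same; rewrite /slack affine_line -!/(slack _ _) => h.
have : 0 < (1 - u) * slack f x0 by rewrite mulr_gt0 // subr_gt0.
have : 0 <= u * slack f xi by rewrite mulr_ge0 // ltW.
lra.
Qed.

End Polytope.

(** * Faces, relative interiors and vertices *)

Section Faces.
Context {R : realType} {n : nat} {T : zmodType} (D : delzant R n T).
Notation P := (polytope D).
Notation d := (nfacets D).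
Implicit Types (f g : 'I_d) (xi eta v : 'cV[R]_n) (I J : {set 'I_d}).

(** A relatively open face is determined by the facets through any of its
    points. *)
Definition active_facets xi : {set 'I_d} := [set f | slack f xi == 0]%SET.

Notation active := active_facets.

Definition open_face I : set 'cV[R]_n := [set xi | P xi /\ active xi = I].

Lemma activeP f xi : reflect (slack f xi = 0) (f \in active xi).
Proof. by rewrite inE; exact: eqP. Qed.

Lemma slack_gt0 f xi : P xi -> f \notin active xi -> 0 < slack f xi.
Proof. by move=> Px; rewrite inE lt0r => -> /=; exact: slack_ge0. Qed.

Lemma slack_line f xi eta (t : R) :
  slack f (xi + t *: (eta - xi)) = (1 - t) * slack f xi + t * slack f eta.
Proof. exact: affine_line. Qed.

Lemma active_line xi eta (t : R) : P xi -> P eta -> 0 < t < 1 ->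
  active (xi + t *: (eta - xi)) = active xi :&: active eta.
Proof.
move=> Px Pe /andP[t0 t1]; apply/setP => f; rewrite finset.in_setI !inE slack_line.
rewrite paddr_eq0 ?mulr_ge0 ?slack_ge0 ?subr_ge0 ?(ltW t0) ?(ltW t1) //.
by rewrite !mulf_eq0 subr_eq0 (gt_eqF t1) (gt_eqF t0).
Qed.

(** Along the affine hull of the face of xi the active inequalities remain
    equalities, and the others are strict at xi. *)
Lemma polytope_step xi eta : P xi ->
  (forall f, f \in active xi -> slack f eta = 0) ->
  exists e : R, [/\ 0 < e, e <= 1, P (xi + e *: (eta - xi)) &
    active (xi + e *: (eta - xi)) = active xi].
Proof.
move=> Px h.
have [e [e0 e1 he]] := small_step (P := [pred f | f \notin active xi])
  (fun f => slack f eta - slack f xi) (fun f => slack_gt0 (f := f) Px).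
have E f : slack f (xi + e *: (eta - xi)) = slack f xi + e * (slack f eta - slack f xi).
  by rewrite slack_line; ring.
exists e; split=> //.
  apply/polytopeE => f; rewrite E; have [fa|fa] := boolP (f \in active xi).
    by rewrite h // (activeP _ _ fa) subrr mulr0 addr0.
  exact/ltW/he.
apply/setP => f; have [fa|fa] := boolP (f \in active xi).
  by rewrite inE E h // (activeP _ _ fa) subrr mulr0 addr0 eqxx.
by rewrite inE E gt_eqF //; exact: he.
Qed.

Definition closed_face I : set 'cV[R]_n := [set xi | P xi /\ I \subset active xi].

Lemma face_closed_face xi0 : P xi0 -> face P (closed_face (active xi0)).
Proof.
move=> P0; split; first by exists xi0.
pose X : 'rV[R]_n := \sum_(f in active xi0) normal f.
have XE xi : pairing X xi =
    \sum_(f in active xi0) slack f xi - \sum_(f in active xi0) offset f.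
  rewrite /X pairing_suml -sumrB; apply: eq_bigr => f _.
  by rewrite /slack /affine addrK.
have s0 : \sum_(f in active xi0) slack f xi0 = 0.
  by apply: big1 => f /activeP.
exists X; apply/seteqP; split=> xi /= [Px h]; split=> //.
  move=> eta Pe; rewrite !XE lerD2r [leLHS]big1.
    by apply: sumr_ge0 => f _; exact: slack_ge0.
  by move=> f /(fintype.subsetP h)/activeP.
have := h _ P0; rewrite !XE lerD2r s0 => h0.
have : \sum_(f in active xi0) slack f xi == 0.
  by rewrite eq_le h0 sumr_ge0 // => f _; exact: slack_ge0.
rewrite psumr_eq0 => [/allP h1|f _]; last exact: slack_ge0.
apply/fintype.subsetP => f fa; rewrite inE.
by have := h1 f (mem_index_enum f); rewrite fa.
Qed.

(** For xi0 generic in s and xi in P on all facets through xi0, the point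
    2 xi0 - xi becomes a point of P after shrinking towards xi0; a functional
    minimal at xi0 is then constant on the segment from xi0 to xi. *)
Lemma faceE (s : set 'cV[R]_n) : face P s ->
  exists2 xi0, P xi0 & s = closed_face (active xi0).
Proof.
move=> [s0 [X sE]].
have sP xi : s xi -> P xi by rewrite sE => -[].
have mid xi eta : s xi -> s eta -> s (xi + 2^-1 *: (eta - xi)).
  rewrite sE /= => -[Px hx] [Pe he]; split.
    by apply: polytope_convex => //; exact: half01.
  move=> z Pz; rewrite pairingDr pairingZr pairingBr.
  by have := hx _ Pz; have := he _ Pz; lra.
have pos xi f : s xi -> 0 <= affine (normal f) (offset f) xi.
  by move=> /sP; exact: slack_ge0.
have [xi0 sx0 gen] := generic_point s0 mid pos.
exists xi0; first exact: sP.
apply/seteqP; split=> xi.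
  move=> sxi; split; first exact: sP.
  by apply/fintype.subsetP => f /activeP h; apply/activeP; exact: gen.
move=> [Px sub].
have [e [e0 _ Pe _]] : exists e : R, [/\ 0 < e, e <= 1,
    P (xi0 + e *: ((2 *: xi0 - xi) - xi0)) &
    active (xi0 + e *: ((2 *: xi0 - xi) - xi0)) = active xi0].
  apply: polytope_step; first exact: sP.
  move=> f fa; have /activeP := fintype.subsetP sub f fa; move/activeP: fa.
  by rewrite /slack /affine pairingBr pairingZr; lra.
move: sx0; rewrite sE /= => -[P0 min0]; split=> // eta Peta.
apply: le_trans (min0 _ Peta); have := min0 _ Pe.
rewrite pairingDr pairingZr !pairingBr pairingZr => h.
have : 0 <= e * (pairing X xi0 - pairing X xi) by lra.
by rewrite pmulr_rge0 // subr_ge0.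
Qed.

Lemma affine_hull_closed_face xi0 eta : P xi0 ->
  affine_hull (closed_face (active xi0)) eta <->
  forall f, f \in active xi0 -> slack f eta = 0.
Proof.
move=> P0; split.
  move=> h f fa; apply: affine_hull_affine h; first by exists xi0.
  by move=> z [_ /fintype.subsetP/(_ _ fa)/activeP].
move=> h; have [e [e0 _ Pe act]] := polytope_step P0 h.
apply: (affine_hull_line (a := xi0) (e := e)); rewrite ?gt_eqF //.
by split=> //; rewrite act.
Qed.

(** If xi lies on a facet f that does not contain xi0, then prolonging the
    segment from xi0 beyond xi makes the slack of f negative. *)
Lemma relint_closed_face xi0 : P xi0 ->
  relint (closed_face (active xi0)) = open_face (active xi0).
Proof.
move=> P0; apply/seteqP; split=> xi.
  move=> [[Px sub] nx]; split=> //; apply/eqP; rewrite finset.eqEsubset sub andbT.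
  apply/fintype.subsetP => f /activeP fx; apply/activeP; apply: contrapT => f0.
  have [/activeP//|/(slack_gt0 P0) fpos] := boolP (f \in active xi0).
  pose c (t : R) := xi + t *: (xi - xi0).
  have cc : c t @[t --> 0^'+] --> xi.
    apply: cvg_at_right_filter; rewrite -[X in _ --> X](_ : xi + 0 *: (xi - xi0) = _).
      by apply: cvgD; [exact: cvg_cst|exact: cvgZr_tmp cvg_id].
    by rewrite scale0r addr0.
  have : \forall t \near 0^'+, affine_hull (closed_face (active xi0)) (c t) ->
     closed_face (active xi0) (c t) by exact: cc nx.
  move=> nt; have [t [t0 ht]] : exists t, 0 < t /\
    (affine_hull (closed_face (active xi0)) (c t) -> closed_face (active xi0) (c t)).
    near (0 : R)^'+ => t; exists t; split; last by near: t.
    by near: t; exact: nbhs_right_gt.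
  have /ht [/(slack_ge0 f)] : affine_hull (closed_face (active xi0)) (c t).
    apply/affine_hull_closed_face => // g ga.
    have /activeP := fintype.subsetP sub g ga; move/activeP: ga.
    by rewrite /c /slack /affine pairingDr pairingZr pairingBr => h1 h2; nra.
  rewrite /c /slack /affine pairingDr pairingZr pairingBr.
  move: fx fpos; rewrite /slack /affine => fx fpos h1 _.
  have : 0 < t * (pairing (normal f) xi0 + offset f) by rewrite mulr_gt0.
  nra.
move=> [Px ax]; split; first by split=> //; rewrite ax.
have : \forall eta \near xi, forall f, f \notin active xi0 -> 0 < slack f eta.
  apply: (@filter_forall _ _ (fun f eta => f \notin active xi0 -> 0 < slack f eta)
    _ (nbhs_filter xi)).
  move=> f; have [fa|fa] := boolP (f \in active xi0).
    by apply: nearW.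
  have fx : 0 < slack f xi by apply: slack_gt0 => //; rewrite ax.
  have := @affine_continuous _ _ (normal f) (offset f) xi.
  move=> /cvgrPdist_lt /(_ _ fx); apply: filterS => eta h _.
  move: h; rewrite -/(slack f xi) -/(slack f eta).
  by have := ler_norm (slack f xi - slack f eta) => h1 h2; lra.
apply: filterS => eta h /affine_hull_closed_face h2.
split; last by apply/fintype.subsetP => f /(h2 P0)/activeP.
apply/polytopeE => f; have [/(h2 P0)->//|/h/ltW//] := boolP (f \in active xi0).
Unshelve. all: by end_near. Qed.

Lemma relintsE (s : set 'cV[R]_n) : relints D s <->
  exists2 xi0, P xi0 & s = open_face (active xi0).
Proof.
split=> [[t /faceE[xi0 P0 ->] <-]|[xi0 P0 ->]].
  by exists xi0 => //; exact: relint_closed_face.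
by exists (closed_face (active xi0)); [exact: face_closed_face|exact: relint_closed_face].
Qed.

(** By [active_line], the open segment from a point over [active xi] to xi' stays
    in the open face of xi' as soon as that face is the larger one. *)
Lemma open_face_closure xi xi' : P xi -> P xi' ->
  (open_face (active xi) `<=` P `&` closure (open_face (active xi'))) <->
  active xi' \subset active xi.
Proof.
move=> Px Px'; split=> [h|sub].
  apply/fintype.subsetP => f fa; apply/activeP.
  have [_ cl] : (P `&` closure (open_face (active xi'))) xi by exact: h.
  have z : closed (slack f @^-1` [set x | x <= 0]).
    apply: closed_comp; last exact: closed_le.
    by move=> x _; exact: affine_continuous.
  apply/eqP; rewrite eq_le slack_ge0 // andbT.
  apply: (z); apply: closureS cl => eta [_ ae] /=.
  by rewrite le_eqVlt; apply/orP; left; apply/eqP/activeP; rewrite ae.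
move=> eta [Pe ae]; split=> // B Bn.
have cc : eta + t *: (xi' - eta) @[t --> 0^'+] --> eta.
  apply: cvg_at_right_filter; rewrite -[X in _ --> X](_ : eta + 0 *: (xi' - eta) = _).
    by apply: cvgD; [exact: cvg_cst|exact: cvgZr_tmp cvg_id].
  by rewrite scale0r addr0.
have nB : \forall t \near 0^'+, B (eta + t *: (xi' - eta)) by exact: cc Bn.
near (0 : R)^'+ => t; exists (eta + t *: (xi' - eta)); split; last by near: t.
have t0 : 0 < t by near: t; exact: nbhs_right_gt.
have t1 : t < 1 by near: t; exact: nbhs_right_lt.
split; first by apply: polytope_convex; rewrite // (ltW t0) (ltW t1).
by rewrite active_line // ?t0 // ae; apply/finset.setIidPr.
Unshelve. all: by end_near. Qed.

Lemma vertexP v : vertex P v <->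
  P v /\ forall xi, P xi -> active v \subset active xi -> xi = v.
Proof.
split=> [/faceE[xi0 P0 E]|[Pv h]].
  have E0 : xi0 = v by have : [set v] xi0 by rewrite E; split.
  split; first by rewrite -E0.
  by move=> xi Px sub; have : [set v] xi by rewrite E E0; split.
rewrite /vertex (_ : [set v] = closed_face (active v)).
  exact: face_closed_face.
by apply/seteqP; split=> [_ -> //|xi [/h]]; exact.
Qed.

Lemma vertex_in v : vertex P v -> P v.
Proof. by case/vertexP. Qed.

Lemma facets_at_active v : vertex P v -> facets_at D v = active v.
Proof.
by move=> /vertex_in Pv; apply/setP => f; rewrite facets_atE // inE.
Qed.

(** Among the points lying on the facets through xi, take one with as many active
    facets as possible.  If it were not a vertex, a line through it inside these
    facets would leave the bounded set P, and would first cross a new facet. *)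
Lemma vertex_above xi : P xi -> exists2 v, vertex P v & active xi \subset active v.
Proof.
move=> Px.
pose S A := `[< exists2 eta, P eta & (active xi \subset active eta) /\ A = active eta >].
have S0 : S (active xi) by apply/asboolP; exists xi.
case: (arg_maxnP (fun A : {set 'I_d} => #|A|) S0) => A /asboolP[eta Pe [sub AE]] Amax.
exists eta => //; apply/vertexP; split=> // z Pz subz.
apply: contrapT => /eqP; rewrite -subr_eq0; set u := z - eta => u0.
have uf f : f \in active eta -> pairing (normal f) u = 0.
  move=> fa; have /activeP := fintype.subsetP subz f fa; move/activeP: fa.
  by rewrite /u pairingBr /slack /affine => h1 h2; lra.
have lineE f (t : R) : slack f (eta + t *: u) = slack f eta + t * pairing (normal f) u.
  by rewrite /slack /affine pairingDr pairingZr; ring.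
have [f0 f0u] : exists f, pairing (normal f) u < 0.
  apply: contrapT => /forallNP h.
  have [_ [M [_ bM]] _] := polytopeP D.
  have ray (t : R) : 0 <= t -> P (eta + t *: u).
    move=> t0; apply/polytopeE => f; rewrite lineE addr_ge0 ?slack_ge0 //.
    by rewrite mulr_ge0 // leNgt; apply/negP; exact: h.
  have bnd : forall t : R, 0 <= t -> `|eta + t *: u| <= M + 1.
    by move=> t /ray; apply: bM; rewrite ltrDl.
  have un : 0 < `|u| by rewrite normr_gt0.
  pose t := (M + 1 + `|eta| + 1) / `|u|.
  have M0 : 0 <= M + 1 by apply: le_trans (bnd 0 (lexx _)).
  have t0 : 0 <= t by apply: divr_ge0 => //; have := normr_ge0 eta; lra.
  have := bnd t t0; rewrite addrC => h2.
  have := lerB_normD (t *: u) eta.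
  rewrite normrZ ger0_norm // divfK ?gt_eqF // => h1.
  by have := le_trans h1 h2; lra.
pose r f := slack f eta / - pairing (normal f) u.
case: (arg_minP r (P := fun f => pairing (normal f) u < 0) f0u) => g gu gmin.
have rg0 : 0 <= r g by rewrite divr_ge0 ?slack_ge0 // oppr_ge0 ltW.
have Pg : P (eta + r g *: u).
  apply/polytopeE => f; rewrite lineE.
  have [fu|fu] := ltP (pairing (normal f) u) 0; last first.
    by rewrite addr_ge0 ?slack_ge0 // mulr_ge0.
  have := gmin f fu; rewrite {2}/r ler_pdivlMr ?oppr_gt0 //; lra.
have : S (active (eta + r g *: u)).
  apply/asboolP; exists (eta + r g *: u) => //; split=> //.
  apply/fintype.subsetP => f /(fintype.subsetP sub) fa; apply/activeP.
  by rewrite lineE uf // mulr0 addr0; apply/activeP.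
move=> /Amax /=; rewrite leqNgt AE => /negP; apply; apply: proper_card.
apply/fintype.properP; split.
  apply/fintype.subsetP => f fa; apply/activeP.
  by rewrite lineE uf // mulr0 addr0; apply/activeP.
exists g; last by apply/negP => /uf h; rewrite h ltxx in gu.
by apply/activeP; rewrite lineE /r; field; rewrite lt_eqF.
Qed.

End Faces.

(** * The basis dual to the normals at a vertex *)

Section DualBasis.
Context {R : realType} {n : nat} {T : zmodType} (D : delzant R n T).
Notation P := (polytope D).
Notation d := (nfacets D).
Implicit Types (f g : 'I_d) (xi eta v : 'cV[R]_n) (I J : {set 'I_d}).

(** The e f are the edge directions at a vertex with facets A.  The second clause
    says that the normals span, the third is integrality on the lattice. *)
Definition dual_basis (A : {set 'I_d}) (e : 'I_d -> 'cV[R]_n) : Prop :=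
  [/\ forall f g, f \in A -> g \in A -> pairing (normal f) (e g) = (f == g)%:R,
      forall X : 'rV[R]_n, X = \sum_(f in A) pairing X (e f) *: normal f,
      forall X : 'rV[R]_n, texp D X = 0 -> forall f, f \in A ->
        exists k : int, pairing X (e f) = k%:~R &
      #|A| = n].

Lemma normal_lattice f : texp D (normal f) = 0.
Proof. by have [] := normal_primitive f. Qed.

Lemma pairing_rows (x : 'rV[R]_n) (B : 'M[R]_n) (y : 'I_n -> R) : B \in unitmx ->
  pairing (x *m B) (invmx B *m \col_i y i) = \sum_i x 0 i * y i.
Proof.
move=> Bu; rewrite /pairing mulmxA mulmxK // mxE.
by apply: eq_bigr => i _; rewrite mxE.
Qed.

(** The normals in a lattice basis B, and B in the normals, are given by two
    integer matrices that are inverse to each other by uniqueness of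
    coordinates.  The columns of the second one, read in B, are the dual basis,
    and comparing the traces of the two products gives the cardinality. *)
Lemma exists_dual_basis v : vertex P v -> exists e, dual_basis (active_facets D v) e.
Proof.
move=> Vv; have := vertex_Zbasis Vv.
rewrite -/(facets_at D v) facets_at_active //; set A := active_facets D v => -[_ Zb].
have [B Bu LE] := texp_ker D.
have inL X : texp D X = 0 -> exists k : 'rV[int]_n, X = map_mx intr k *m B.
  by move=> h; have : [set X | texp D X = 0] X by []; rewrite LE.
have rowL i : [set X | texp D X = 0] (row i B).
  rewrite LE; exists (delta_mx 0 i); rewrite map_delta_mx.
  exact: rowE.
have [k kE] : {k : 'I_d -> 'rV[int]_n & forall f,
    normal f = map_mx intr (k f) *m B}.
  apply: (@choice _ _ (fun f (x : 'rV[int]_n) => normal f = map_mx intr x *m B)) => f.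
  exact/inL/normal_lattice.
have [c cE] : {c : 'I_n -> {ffun 'I_d -> int} & forall i,
    (forall f, f \notin A -> c i f = 0) /\ row i B = \sum_(f in A) normal f *~ c i f}.
  apply: (@choice _ _ (fun i (c : {ffun 'I_d -> int}) => (forall f, f \notin A -> c f = 0) /\
    row i B = \sum_(f in A) normal f *~ c f)) => i.
  by have [c [h _]] := Zb _ (rowL i); exists c.
have rowsum (x : 'rV[R]_n) : x *m B = \sum_i x 0 i *: row i B.
  exact: mulmx_sum_row.
pose K f g : int := \sum_i k f 0 i * c i g.
have KE f : f \in A -> forall g, g \in A -> K f g = (f == g)%:R.
  move=> fA; have [k0 [_ uniq]] := Zb _ (normal_lattice f).
  have E1 : k0 = [ffun g => K f g].
    apply: uniq; split=> [g gA|].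
      rewrite ffunE /K big1 // => i _.
      by have [-> //] := cE i; rewrite mulr0.
    rewrite {1}kE rowsum; under eq_bigr => i _ do rewrite (cE i).2 scaler_sumr.
    rewrite exchange_big /=; apply: eq_bigr => g gA.
    rewrite ffunE -scaler_int /K rmorph_sum /= scaler_suml; apply: eq_bigr => i _.
    by rewrite mxE -[normal g *~ _]scaler_int scalerA rmorphM.
  have E2 : k0 = [ffun g => (f == g)%:R].
    apply: uniq; split=> [g gA|].
      rewrite ffunE; case: eqP => // fg; by rewrite -fg fA in gA.
    rewrite (bigD1 f) //= ffunE eqxx mulr1z big1 ?addr0 // => g /andP[_ gf].
    by rewrite ffunE eq_sym (negbTE gf) mulr0z.
  move=> g _; have := congr1 (fun h : {ffun 'I_d -> int} => h g) (etrans (esym E1) E2).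
  by rewrite !ffunE.
pose M i j : int := \sum_(f in A) c i f * k f 0 j.
have ME i j : M i j = (i == j)%:R.
  have : (\row_j (M i j)%:~R) *m B = delta_mx 0 i *m B :> 'rV[R]_n.
    rewrite -rowE rowsum (cE i).2.
    under eq_bigr => j' _ do rewrite mxE /M rmorph_sum /= scaler_suml.
    rewrite exchange_big /=; apply: eq_bigr => f _.
    rewrite kE rowsum -[(\sum_(_ | _) _) *~ _]scaler_int scaler_sumr; apply: eq_bigr => j' _.
    by rewrite mxE scalerA rmorphM.
  move/(can_inj (mulmxK Bu)) => /rowP/(_ j); rewrite !mxE eqxx /= eq_sym => h.
  by apply/eqP; rewrite -(eqr_int R) h; case: (i == j).
pose e f : 'cV[R]_n := invmx B *m \col_i (c i f)%:~R.
have pe (x : 'rV[R]_n) f : pairing (x *m B) (e f) = \sum_i x 0 i * (c i f)%:~R.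
  exact: pairing_rows.
have peL (x : 'rV[int]_n) f :
    pairing (map_mx intr x *m B) (e f) = (\sum_i x 0 i * c i f)%:~R.
  by rewrite pe rmorph_sum; apply: eq_bigr => i _; rewrite mxE rmorphM.
exists e; split.
- move=> f g fA gA; rewrite kE peL -/(K f g) KE //.
  by case: (f == g).
- move=> X; rewrite -{1}(mulmxKV Bu X); set x := X *m invmx B.
  have XE : X = x *m B by rewrite mulmxKV.
  rewrite rowsum XE.
  under [RHS]eq_bigr => f _ do rewrite pe kE rowsum scaler_sumr.
  rewrite exchange_big /=; apply: eq_bigr => j _.
  under eq_bigr => f _ do rewrite scalerA mxE mulr_suml.
  rewrite -scaler_suml; congr (_ *: _).
  rewrite exchange_big /= (bigD1 j) //=.
  have inner i : \sum_(f in A) x 0 i * (c i f)%:~R * (k f 0 j)%:~R = x 0 i * (i == j)%:R :> R.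
    rewrite -[(i == j)%:R]/((i == j)%:R) (_ : (i == j)%:R = (M i j)%:~R :> R); last first.
      by rewrite ME; case: (i == j).
    rewrite /M rmorph_sum mulr_sumr; apply: eq_bigr => f _.
    by rewrite rmorphM mulrA.
  rewrite inner eqxx mulr1 big1 ?addr0 // => i ij.
  by rewrite inner (negbTE ij) mulr0.
- by move=> X /inL[x ->] f _; exists (\sum_i x 0 i * c i f).
- have h : \sum_(f in A) K f f = \sum_i M i i.
    rewrite exchange_big /=; apply: eq_bigr => i _; apply: eq_bigr => f _.
    exact: mulrC.
  move: h; rewrite (eq_bigr (fun=> 1)); last by move=> f fA; rewrite KE // eqxx.
  rewrite [RHS](eq_bigr (fun=> 1)); last by move=> i _; rewrite ME eqxx.
  rewrite !sumr_const card_ord => /eqP; rewrite eqr_nat => /eqP.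
  by [].
Qed.

Lemma dual_expand A e : dual_basis A e ->
  forall xi, xi = \sum_(f in A) pairing (normal f) xi *: e f.
Proof.
move=> [_ exp _ _] xi; apply/eqP; rewrite -subr_eq0; apply/eqP.
set z := _ - _.
have pz X : pairing X z = 0.
  rewrite /z pairingBr pairing_sumr {1}(exp X) pairing_suml; apply/eqP.
  rewrite subr_eq0; apply/eqP; apply: eq_bigr => f _.
  by rewrite pairingZl pairingZr mulrC.
apply/colP => i; have := pz (delta_mx 0 i).
by rewrite /pairing -rowE !mxE.
Qed.

Lemma vertex_exists : exists v, vertex P v.
Proof.
have [[xi Px] _ _] := polytopeP D.
by have [v Vv _] := vertex_above Px; exists v.
Qed.

Lemma normal_separates xi eta :
  (forall f, pairing (normal f) xi = pairing (normal f) eta) -> xi = eta.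
Proof.
move=> h; have [v Vv] := vertex_exists; have [e he] := exists_dual_basis Vv.
rewrite (dual_expand he xi) (dual_expand he eta).
by apply: eq_bigr => f _; rewrite h.
Qed.

(** Move from v along the sum of the edge directions e f with f outside I. *)
Lemma open_face_below v I : vertex P v -> I \subset active_facets D v ->
  exists2 xi, P xi & active_facets D xi = I.
Proof.
move=> Vv sub; have Pv := vertex_in Vv.
have [e [del _ _ _]] := exists_dual_basis Vv.
pose u := \sum_(f in active_facets D v :\: I) e f.
have uE f : f \in active_facets D v -> pairing (normal f) u = (f \notin I)%:R.
  move=> fv; rewrite /u pairing_sumr.
  have [fI|fI] := boolP (f \in I).
    rewrite big1 // => g /finset.setDP[gv gI]; rewrite del //.
    by case: eqP => // fg; rewrite -fg fI in gI.
  rewrite (bigD1 f) /=; last by rewrite finset.in_setD fI.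
  rewrite del // eqxx big1 ?addr0 // => g /andP[/finset.setDP[gv _] gf].
  by rewrite del // eq_sym (negbTE gf).
have [t [t0 t1 ht]] := small_step (P := [pred f | f \notin active_facets D v])
  (fun f => pairing (normal f) u) (fun f => slack_gt0 (f := f) Pv).
have E f : slack f (v + t *: u) = slack f v + t * pairing (normal f) u.
  by rewrite /slack /affine pairingDr pairingZr; ring.
exists (v + t *: u).
  apply/polytopeE => f; rewrite E; have [fv|fv] := boolP (f \in active_facets D v).
    by rewrite (activeP _ _ fv) add0r uE // mulr_ge0 // ltW.
  exact/ltW/ht.
apply/setP => f; rewrite inE E; have [fv|fv] := boolP (f \in active_facets D v).
  rewrite (activeP _ _ fv) add0r uE // mulf_eq0 (gt_eqF t0) /=.
  by case: (f \in I); rewrite /= ?eqxx ?oner_eq0.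
rewrite gt_eqF; last exact: ht.
by apply/esym/negbTE; apply: contra fv; exact: (fintype.subsetP sub).
Qed.

End DualBasis.

(** * Phases of complex numbers *)

Section Phases.
Context {R : realType}.
Implicit Types (a b t : R) (w s : R[i]).

Lemma expi2piE a b : expi2pi (a +i* b)%C =
  (expR (- (2 * pi * b)) * cos (2 * pi * a) +i*
   (expR (- (2 * pi * b)) * sin (2 * pi * a)))%C.
Proof. by rewrite /expi2pi /cexp /= !mul0r !add0r. Qed.

Lemma expi2pi_real t :
  expi2pi t%:C%C = (cos (2 * pi * t) +i* sin (2 * pi * t))%C.
Proof. by rewrite expi2piE mulr0 oppr0 expR0 !mul1r. Qed.

Lemma sqnorm_eq0 w : (sqnorm w == 0) = (w == 0).
Proof.
by case: w => x y; rewrite /sqnorm /= paddr_eq0 ?sqr_ge0 // !sqrf_eq0 eq_complex.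
Qed.

Lemma sqnorm_ge0 w : 0 <= sqnorm w.
Proof. by rewrite addr_ge0 // sqr_ge0. Qed.

Lemma sqnorm_real a : sqnorm a%:C%C = a ^+ 2.
Proof. by rewrite /sqnorm /= expr0n addr0. Qed.

Lemma sqnorm_expi2piE a b :
  sqnorm (expi2pi (a +i* b)%C) = expR (- (4 * pi * b)).
Proof.
rewrite expi2piE /sqnorm /= !exprMn -mulrDr cos2Dsin2 mulr1 -expRM_natl.
by congr expR; rewrite -mulr_natl; ring.
Qed.

Lemma expi2pi_neq0 s : expi2pi s != 0.
Proof.
case: s => a b; rewrite -sqnorm_eq0 sqnorm_expi2piE gt_eqF //; exact: expR_gt0.
Qed.

Lemma expi2piN s : expi2pi (- s) = (expi2pi s)^-1.
Proof.
apply: (mulIf (expi2pi_neq0 s)).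
by rewrite -expi2piD addNr expi2pi0 mulVf // expi2pi_neq0.
Qed.

Lemma expi2piMn s (k : nat) : expi2pi (s *+ k) = expi2pi s ^+ k.
Proof.
elim: k => [|k IH]; first by rewrite mulr0n expi2pi0 expr0.
by rewrite mulrS exprS expi2piD IH.
Qed.

Lemma expi2piMz s (k : int) : expi2pi (s *~ k) = expi2pi s ^ k.
Proof.
case: k => k; first exact: expi2piMn.
by rewrite NegzE mulrNz -exprnN expi2piN; congr (_^-1); exact: expi2piMn.
Qed.

Lemma expi2pi_sum (J : Type) (r : seq J) (Q : pred J) (F : J -> R[i]) :
  expi2pi (\sum_(j <- r | Q j) F j) = \prod_(j <- r | Q j) expi2pi (F j).
Proof.
by apply: (big_morph _ (@expi2piD R) (@expi2pi0 R)).
Qed.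

Lemma expi2pi1 : expi2pi (1 : R[i]) = 1.
Proof.
rewrite -[X in expi2pi X]/((1 : R)%:C%C) expi2pi_real mulr1 mulr_natl.
by rewrite cos2pi sin2pi.
Qed.

Lemma expi2pi_int (k : int) : expi2pi (k%:~R : R)%:C%C = 1.
Proof.
by rewrite (rmorph_int (real_complex R)) expi2piMz expi2pi1 exp1rz.
Qed.

(** The fractional part r of t satisfies 1 = cos (2 pi r), i.e. sin (pi r) = 0
    with 0 <= pi r < pi. *)
Lemma expi2pi_eq1 t : expi2pi t%:C%C = 1 -> exists k : int, t = k%:~R.
Proof.
move=> t1; exists (Num.floor t); set k := Num.floor t.
have /andP[kt tk] : k%:~R <= t < (k + 1)%:~R by exact: floor_itv.
pose r := t - k%:~R.
have r1 : expi2pi r%:C%C = 1.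
  by rewrite rmorphB expi2piD expi2piN t1 expi2pi_int invr1 mulr1.
have r0 : 0 <= r < 1.
  by move: tk; rewrite /r intrD subr_ge0 kt ltrBlDl.
suff : r = 0 by move/eqP; rewrite subr_eq0 => /eqP.
apply/eqP; apply: contrapT => /negP rn0.
move: r1; rewrite expi2pi_real => -[c1 _].
have E : 2 * pi * r = pi * r + pi * r by ring.
move: c1; rewrite E cosD -!expr2 cos2sin2 => h.
have : sin (pi * r) ^+ 2 = 0 by lra.
move/eqP; rewrite sqrf_eq0 => /eqP s0.
have : 0 < sin (pi * r).
  apply: sin_gt0_pi; case/andP: r0 => r0 r1.
  rewrite mulr_gt0 ?pi_gt0 // ?lt0r ?rn0 //=.
  by rewrite -ltr_pdivlMl ?pi_gt0 // mulVf ?gt_eqF // pi_gt0.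
by rewrite s0 ltxx.
Qed.

Lemma expi2pi_eq1_complex a b : expi2pi (a +i* b)%C = 1 ->
  b = 0 /\ exists k : int, a = k%:~R.
Proof.
move=> h; have := sqnorm_expi2piE a b; rewrite h => /esym.
rewrite -[X in sqnorm X]/((1 : R)%:C%C) sqnorm_real expr1n -[X in _ = X]expR0 => /expR_inj/eqP.
rewrite oppr_eq0 !mulf_eq0 pnatr_eq0 /= gt_eqF ?pi_gt0 //= => /eqP b0.
by split=> //; apply: expi2pi_eq1; rewrite -h b0.
Qed.

Lemma unit_arg x y : x ^+ 2 + y ^+ 2 = 1 -> exists t : R, x = cos t /\ y = sin t.
Proof.
move=> xy; have x1 : -1 <= x <= 1.
  have := sqr_ge0 y => y0; have : x ^+ 2 <= 1 by lra.
  by rewrite -ler_norml -(@ler_sqr _ `|x|) ?nnegrE // expr1n real_normK ?num_real.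
have sx : Num.sqrt (1 - x ^+ 2) = `|y|.
  by rewrite -sqrtr_sqr; congr Num.sqrt; lra.
have [y0|y0] := leP 0 y.
  exists (acos x); rewrite sin_acos // sx ger0_norm // acosK //.
exists (- acos x); rewrite cosN sinN sin_acos // sx ltr0_norm // opprK acosK //.
Qed.

Lemma expi2pi_surj w : w != 0 -> exists a b, w = expi2pi (a +i* b)%C.
Proof.
move=> w0; have sw : 0 < sqnorm w by rewrite lt0r sqnorm_eq0 w0 sqnorm_ge0.
have r0 : 0 < Num.sqrt (sqnorm w) by rewrite sqrtr_gt0.
pose r := Num.sqrt (sqnorm w).
have pi0 : (pi : R) != 0 by rewrite gt_eqF // pi_gt0.
have [t [ct st]] : exists t, complex.Re w / r = cos t /\ complex.Im w / r = sin t.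
  apply: unit_arg; rewrite !expr_div_n -mulrDl sqr_sqrtr ?sqnorm_ge0 //.
  by rewrite divff // gt_eqF.
exists (t / (2 * pi)), (- ln r / (2 * pi)).
rewrite expi2piE.
have p0 : 2 * pi != 0 :> R by rewrite mulf_neq0 // pnatr_eq0.
have -> : 2 * pi * (t / (2 * pi)) = t by rewrite mulrC divfK.
have -> : - (2 * pi * (- ln r / (2 * pi))) = ln r by rewrite mulrC divfK // opprK.
rewrite lnK ?posrE // -ct -st; apply/eqP; rewrite eq_complex /=.
by apply/andP; split; rewrite -/r mulrC divfK // gt_eqF.
Qed.

Lemma phase_transitive w w' : sqnorm w = sqnorm w' ->
  exists t, w' = expi2pi t%:C%C * w.
Proof.
have [->|w0] := eqVneq w 0.
  have -> : sqnorm (0 : R[i]) = 0 by apply/eqP; rewrite sqnorm_eq0.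
  by move=> /esym/eqP; rewrite sqnorm_eq0 => /eqP ->; exists 0; rewrite mulr0.
move=> ww'; have w'0 : w' != 0 by rewrite -sqnorm_eq0 -ww' sqnorm_eq0.
have [a [b ab]] : exists a b, w' / w = expi2pi (a +i* b)%C.
  by apply: expi2pi_surj; rewrite mulf_neq0 // invr_eq0.
exists a; suff b0 : b = 0 by rewrite -[(a%:C)%C]/(a +i* 0)%C -b0 -ab divfK.
have : sqnorm (w' / w) = 1.
  have : sqnorm (w' / w) * sqnorm w = sqnorm w' by rewrite -sqnormM divfK.
  by rewrite ww' => /(canRL (mulfK _)) ->; rewrite ?divff // sqnorm_eq0.
rewrite ab sqnorm_expi2piE -[X in _ = X]expR0 => /expR_inj/eqP.
by rewrite oppr_eq0 !mulf_eq0 pnatr_eq0 /= gt_eqF ?pi_gt0 //= => /eqP.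
Qed.

End Phases.

(** * The vanishing set, the moment map and the stabilizers in M *)

Section CnFrame.
Context {R : realType} {d : nat}.

Definition Cn_frame (j : 'I_d + 'I_d) : Cn R d :=
  match j with inl f => (delta_mx 0 f, 0) | inr f => (0, delta_mx 0 f) end.

Definition Cn_coord (j : 'I_d + 'I_d) (z : Cn R d) : R :=
  match j with inl f => z.1 0 f | inr f => z.2 0 f end.

Lemma Cn_frameE (z : Cn R d) : z = \sum_j Cn_coord j z *: Cn_frame j.
Proof.
rewrite big_sumType /=; case: z => x y /=.
have E1 : \sum_f (x 0 f *: (delta_mx 0 f, 0) : Cn R d) = (x, 0).
  rewrite {2}(row_sum_delta x).
  elim/big_rec2: _ => [//|f a b _ ->]; congr pair; rewrite /= scaler0 add0r //.
have E2 : \sum_f (y 0 f *: (0, delta_mx 0 f) : Cn R d) = (0, y).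
  rewrite {2}(row_sum_delta y).
  elim/big_rec2: _ => [//|f a b _ ->]; congr pair; rewrite /= scaler0 add0r //.
by rewrite E1 E2; congr pair; rewrite /= ?addr0 ?add0r.
Qed.

Lemma Cn_coord_continuous j : continuous (Cn_coord j).
Proof.
case: j => f z /=.
  apply: (@continuous_comp _ _ _ (fun z : Cn R d => z.1) (fun x : 'rV[R]_d => x 0 f)).
    exact: cvg_fst.
  exact: coord_continuous.
apply: (@continuous_comp _ _ _ (fun z : Cn R d => z.2) (fun x : 'rV[R]_d => x 0 f)).
  exact: cvg_snd.
exact: coord_continuous.
Qed.

Lemma Cn_coord_linear j : linear (Cn_coord j).
Proof. by case: j => f a x y; rewrite /= !mxE. Qed.

Lemma continuous_Cn (E : topologicalType) (phi : E -> Cn R d) (x : E) :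
  (forall j, {for x, continuous (fun y => Cn_coord j (phi y))}) ->
  {for x, continuous phi}.
Proof.
move=> h; rewrite (_ : phi = fun y => \sum_j Cn_coord j (phi y) *: Cn_frame j).
  apply: (cvg_big (op := +%R)) => [|j _]; first exact: add_continuous.
  by apply: cvgZr_tmp; exact: h.
by apply/funext => y; exact: Cn_frameE.
Qed.

Lemma sqnorm_coo_continuous (f : 'I_d) :
  continuous (fun z : Cn R d => sqnorm (coo z f)).
Proof.
rewrite (_ : (fun z => _) = fun z => Cn_coord (inl f) z * Cn_coord (inl f) z +
    Cn_coord (inr f) z * Cn_coord (inr f) z); last first.
  by apply/funext => z; rewrite /sqnorm !expr2.
by move=> z; apply: cvgD; apply: cvgM; exact: Cn_coord_continuous.
Qed.

Definition zeros (z : Cn R d) : {set 'I_d} := [set f | coo z f == 0]%SET.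

Lemma zeros_cscale (w : 'I_d -> R[i]) (z : Cn R d) :
  (forall f, w f != 0) -> zeros (cscale w z) = zeros z.
Proof.
move=> w0; apply/setP => f; rewrite !inE coo_ofcoo mulf_eq0.
by rewrite (negbTE (w0 f)).
Qed.

Lemma zeros_rotate t (z : Cn R d) : zeros (rotate t z) = zeros z.
Proof. by apply: zeros_cscale => f; exact: expi2pi_neq0. Qed.

Lemma open_zeros (I : {set 'I_d}) : open [set z : Cn R d | zeros z \subset I].
Proof.
rewrite openE => z zI; rewrite /interior.
have : \forall y \near z, forall f, f \notin I -> 0 < sqnorm (coo y f).
  apply: (@filter_forall _ _ (fun f y => f \notin I -> 0 < sqnorm (coo y f)) _ (nbhs_filter z)).
  move=> f; have [fI|fI] := boolP (f \in I); first by apply: nearW.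
  have fz : 0 < sqnorm (coo z f).
    rewrite lt0r sqnorm_ge0 sqnorm_eq0 andbT.
    by apply: contra fI => h; apply: (fintype.subsetP zI); rewrite inE.
  have := @sqnorm_coo_continuous f z; move=> /cvgrPdist_lt /(_ _ fz).
  apply: filterS => y h _; move: h.
  by have := ler_norm (sqnorm (coo z f) - sqnorm (coo y f)) => h1 h2; lra.
apply: filterS => y h /=; apply/fintype.subsetP => f; rewrite inE -sqnorm_eq0.
by apply: contraTT => /h; rewrite lt0r => /andP[].
Qed.

End CnFrame.

Section StrataComponent.
Context {T : Type} {Q : topologicalType} {J : finType}.

(** Since the marking is upper semicontinuous and cannot be strictly nested at
    points with equal stabilizers, it is locally constant on the set of points
    with a given stabilizer; its level sets are clopen there. *)
Lemma component_of_marking (act : T -> Q -> Q) (A : set Q) (vanishing : Q -> {set J}) (q : Q) :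
  A q ->
  (forall I : {set J}, open [set x | vanishing x \subset I]) ->
  (forall x y, A x -> A y -> stabilizer act x = stabilizer act y ->
     vanishing x \subset vanishing y -> vanishing x = vanishing y) ->
  (forall x, A x -> vanishing x = vanishing q -> stabilizer act x = stabilizer act q) ->
  connected [set x | A x /\ vanishing x = vanishing q] ->
  connected_component [set x | A x /\ stabilizer act x = stabilizer act q] q =
  [set x | A x /\ vanishing x = vanishing q].
Proof.
move=> Aq om inj stab conn; apply/seteqP; split; last first.
  apply: connected_component_max => // x [Ax mx]; split=> //; exact: stab.
move=> x [C [Cq CB cC] Cx].
pose B := C `&` [set y | vanishing y \subset vanishing q].
suff BC : B = C.
  have [Ax sx] := CB _ Cx; split=> //; apply: inj => //.
  by move: Cx; rewrite -BC => -[].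
apply: cC.
- by exists q; split=> //=.
- by exists [set y | vanishing y \subset vanishing q].
pose V := \bigcup_(y in [set y | C y /\ vanishing y != vanishing q])
  [set z | vanishing z \subset vanishing y].
exists (~` V).
  by apply: open_closedC; apply: bigcup_open => y _; exact: om.
apply/seteqP; split=> y [Cy hy]; split=> //.
  move=> [z [Cz zq] yz]; have [Ay sy] := CB _ Cy; have [Az sz] := CB _ Cz.
  have e1 : vanishing y = vanishing q by apply: inj => //.
  have e2 : vanishing y = vanishing z by apply: inj => //; rewrite sy sz.
  by move/eqP: zq; apply; rewrite -e2.
apply: contrapT => h; apply: hy; exists y => //=; split=> //.
by apply/eqP => e; apply: h; rewrite /= e.
Qed.

End StrataComponent.

Section Reduced.
Local Open Scope quotient_scope.
Context {R : realType} {n : nat} {T : zmodType} (D : delzant R n T).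
Notation P := (polytope D).
Notation d := (nfacets D).
Notation active := (active_facets D).
Notation CF := (Cn R d).
Notation M := (Mred D).
Notation Zl := (set_type (@Zlevel R n T D)).
Implicit Types (f g : 'I_d) (xi eta v : 'cV[R]_n) (I J : {set 'I_d}) (t s : 'rV[R]_d).

Lemma pairing_projT t xi :
  pairing (projT t) xi = \sum_f t 0 f * pairing (normal f) xi.
Proof.
by rewrite /projT pairing_suml; apply: eq_bigr => f _; rewrite pairingZl.
Qed.

Lemma Zlevel_moment (z : CF) xi :
  (forall f, slack f xi = sqnorm (coo z f) / 2) -> Zlevel z.
Proof.
move=> h t t0; have := pairing_projT t xi; rewrite t0 pairing0l => E.
rewrite -[LHS]subr0 [X in _ - X]E -sumrB; apply: eq_bigr => f _.
by rewrite -h /slack /affine; ring.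
Qed.

(** The conditions at the facets of a vertex determine xi.  For the condition at
    another facet f, apply the equations of Z to the element t of ker pi which
    expresses the normal of f in the normals at the vertex. *)
Lemma moment_exists (z : CF) : Zlevel z ->
  exists xi, forall f, slack f xi = sqnorm (coo z f) / 2.
Proof.
move=> Zz; have [v Vv] := vertex_exists D.
have [e [del exp _ _]] := exists_dual_basis Vv.
pose c f := sqnorm (coo z f) / 2 - offset f.
pose xi := \sum_(f in active v) c f *: e f.
suff h f : pairing (normal f) xi = c f.
  by exists xi => f; rewrite /slack /affine h /c subrK.
rewrite /xi pairing_sumr; under eq_bigr => g _ do rewrite pairingZr.
pose t : 'rV[R]_d :=
  \row_g ((g == f)%:R - (g \in active v)%:R * pairing (normal f) (e g)).
have tsum (F : 'I_d -> R) : \sum_g t 0 g * F g =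
    F f - \sum_(g in active v) pairing (normal f) (e g) * F g.
  under eq_bigr => g _ do rewrite mxE mulrBl.
  rewrite sumrB (bigD1 f) //= eqxx mul1r big1 ?addr0; last first.
    by move=> g /negbTE ->; rewrite mul0r.
  congr (_ - _); rewrite [RHS]big_mkcond; apply: eq_bigr => g _.
  by case: ifP => _; rewrite ?mul1r ?mul0r.
have t0 : projT t = 0.
  apply: pairing_eq0 => x; rewrite pairing_projT tsum {1}(exp (normal f)).
  rewrite pairing_suml; apply/eqP; rewrite subr_eq0; apply/eqP.
  by apply: eq_bigr => g _; rewrite pairingZl.
have := Zz t t0; rewrite !tsum => E.
have : \sum_(g in active v) c g * pairing (normal f) (e g) =
  \sum_(g in active v) pairing (normal f) (e g) * (sqnorm (coo z g) / 2) -
  \sum_(g in active v) pairing (normal f) (e g) * offset g.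
  by rewrite -sumrB; apply: eq_bigr => g _; rewrite /c; ring.
by move=> ->; rewrite /c; lra.
Qed.

Lemma MeqP (z z' : Zl) : \pi_M z = \pi_M z' <->
  exists2 t, inN t & z' = rotateZ t z.
Proof. by split=> [/eqmodP/asboolP|h]; last exact/eqmodP/asboolP. Qed.

Lemma repr_rotate (z : Zl) :
  exists2 t, inN t & repr (\pi_M z) = rotateZ t z.
Proof. by apply/MeqP; rewrite reprK. Qed.

Lemma muT_pi (z : Zl) f :
  slack f (muT D (\pi_M z)) = sqnorm (coo (set_val z) f) / 2.
Proof.
rewrite /muT; have [t tN ->] := repr_rotate z.
have [xi hxi] := moment_exists (set_valP z).
case: xgetP => [xi' _ h|/(_ xi)]; last first.
  case=> g /=; rewrite sqnorm_rotate -hxi /slack /affine; ring.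
by rewrite /slack /affine h /= sqnorm_rotate subrK.
Qed.

Lemma muT_polytope (m : M) : P (muT D m).
Proof.
by apply/polytopeE => f; rewrite -[m]reprK muT_pi divr_ge0 // sqnorm_ge0.
Qed.

Definition vanishing (m : M) : {set 'I_d} := zeros (set_val (repr m)).

Lemma vanishing_pi (z : Zl) : vanishing (\pi_M z) = zeros (set_val z).
Proof. by rewrite /vanishing; have [t _ ->] := repr_rotate z; exact: zeros_rotate. Qed.

Lemma active_muT (m : M) : active (muT D m) = vanishing m.
Proof.
rewrite -[m]reprK vanishing_pi; apply/setP => f; rewrite !inE muT_pi.
by rewrite mulf_eq0 invr_eq0 pnatr_eq0 orbF sqnorm_eq0.
Qed.

Definition Mstratum I : set M := [set m | vanishing m = I].

Lemma muT_open_face I : muT D @^-1` open_face I = Mstratum I.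
Proof.
apply/seteqP; split=> m /=; first by case=> _; rewrite active_muT.
by move=> mI; split; [exact: muT_polytope|rewrite active_muT].
Qed.

Lemma openM (A : set M) : open (\pi_M @^-1` A : set Zl) -> open A.
Proof. by []. Qed.

Lemma piM_continuous : continuous (\pi_M : Zl -> M).
Proof. exact: pi_continuous. Qed.

Lemma open_vanishing I : open [set m : M | vanishing m \subset I].
Proof.
apply: openM; rewrite (_ : _ @^-1` _ = set_val @^-1` [set z : CF | zeros z \subset I]).
  by apply: open_comp; [move=> z _; exact: initial_continuous|exact: open_zeros].
by apply/seteqP; split=> z /=; rewrite vanishing_pi.
Qed.

(** The point over xi with nonnegative real coordinates. *)
Definition section_pt xi : CF := ofcoo (fun f => (Num.sqrt (2 * slack f xi))%:C%C).

Lemma sqnorm_section xi f : P xi -> sqnorm (coo (section_pt xi) f) / 2 = slack f xi.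
Proof.
move=> Px; rewrite coo_ofcoo sqnorm_real sqr_sqrtr; last by rewrite mulr_ge0 // slack_ge0.
by rewrite mulrC mulKf // pnatr_eq0.
Qed.

Lemma Zlevel_section xi : P xi -> Zlevel (section_pt xi).
Proof. by move=> Px; apply: (@Zlevel_moment _ xi) => f; rewrite sqnorm_section. Qed.

Definition polar_point xi t (Px : P xi) : Zl :=
  SigSub (mem_set (Zlevel_rotate t (Zlevel_section Px))).

Lemma muT_polar xi t (Px : P xi) : muT D (\pi_M (polar_point t Px)) = xi.
Proof.
apply: (@normal_separates _ _ _ D) => f.
have := muT_pi (polar_point t Px) f; rewrite /= sqnorm_rotate sqnorm_section //.
by rewrite /slack /affine => /addIr.
Qed.

Lemma muT_surj xi : P xi -> exists m : M, muT D m = xi.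
Proof. by move=> Px; exists (\pi_M (polar_point 0 Px)); exact: muT_polar. Qed.

Lemma rotate_transitive (z z' : CF) :
  (forall f, sqnorm (coo z f) = sqnorm (coo z' f)) -> exists t, z' = rotate t z.
Proof.
move=> h; have [t tE] : {t : 'I_d -> R & forall f, coo z' f = expi2pi (t f)%:C%C * coo z f}.
  apply: (@choice _ _ (fun (f : 'I_d) (t : R) => coo z' f = expi2pi t%:C%C * coo z f)) => f.
  exact: phase_transitive.
exists (\row_f t f); apply: coo_inj => f.
by rewrite coo_ofcoo mxE tE.
Qed.

Lemma polar_pointP (z : Zl) xi (Px : P xi) :
  (forall f, slack f xi = sqnorm (coo (set_val z) f) / 2) ->
  exists t, z = polar_point t Px.
Proof.
move=> h; have [t tE] : exists t, set_val z = rotate t (section_pt xi).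
  apply: rotate_transitive => f.
  by have := h f; rewrite -(sqnorm_section f Px) => E; lra.
by exists t; apply: val_inj.
Qed.

Lemma polar_pointM (m : M) : exists t, m = \pi_M (polar_point t (muT_polytope m)).
Proof.
have [t tE] : exists t, repr m = polar_point t (muT_polytope m).
  by apply: polar_pointP => f; rewrite -[in LHS](reprK m) muT_pi.
by exists t; rewrite -tE reprK.
Qed.

Lemma projT_surj (X : 'rV[R]_n) : exists t, projT t = X.
Proof.
have [v Vv] := vertex_exists D; have [e [_ exp _ _]] := exists_dual_basis Vv.
exists (\row_f ((f \in active v)%:R * pairing X (e f))).
rewrite [RHS](exp X) /projT [RHS]big_mkcond; apply: eq_bigr => f _.
by rewrite mxE; case: ifP => _; rewrite ?mul1r // mul0r scale0r.
Qed.

Lemma texp_projT_surj (g : T) : exists t, texp D (projT t) = g.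
Proof.
by have [X <-] := texp_surj D g; have [t <-] := projT_surj X; exists t.
Qed.

Lemma torus_liftK (g : T) : texp D (projT (torus_lift D g)) = g.
Proof.
rewrite /torus_lift; case: xgetP => [t _ //|h].
by have [t tg] := texp_projT_surj g; case: (h t).
Qed.

(** The elements of T acting on C^F, up to N, only through the coordinates in
    I. *)
Definition subtorus I : set T :=
  [set g | exists2 t : 'rV[R]_d, (forall f : 'I_d, f \notin I -> t 0 f = 0) & texp D (projT t) = g].

Lemma texp_projT_int t : (forall f, exists k : int, t 0 f = k%:~R) ->
  texp D (projT t) = 0.
Proof.
move=> h; rewrite /projT raddf_sum big1 // => f _.
have [k ->] := h f; rewrite scaler_int raddfMz normal_lattice mul0rz //.
Qed.

Lemma rotate_fix t (z : CF) : rotate t z = z ->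
  forall f, f \notin zeros z -> exists k : int, t 0 f = k%:~R.
Proof.
move=> h f; rewrite inE => zf; apply: expi2pi_eq1; apply: (mulIf zf).
by rewrite mul1r -{2}h coo_ofcoo.
Qed.

Lemma rotate_supported t (z : CF) :
  (forall f, f \notin zeros z -> t 0 f = 0) -> rotate t z = z.
Proof.
move=> h; apply: coo_inj => f; rewrite coo_ofcoo.
have [|/h ->] := boolP (f \in zeros z); last by rewrite expi2pi0 mul1r.
by rewrite inE => /eqP ->; rewrite mulr0.
Qed.

Lemma subtorus_projT I t : (forall f, f \notin I -> exists k : int, t 0 f = k%:~R) ->
  subtorus I (texp D (projT t)).
Proof.
move=> h; pose r : 'rV[R]_d := \row_f (if f \in I then t 0 f else 0).
exists r; first by move=> f /negbTE fI; rewrite mxE fI.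
apply/eqP; rewrite eq_sym -subr_eq0 -raddfB -projTN -projTD; apply/eqP.
apply: texp_projT_int => f; rewrite !mxE; have [fI|fI] := boolP (f \in I).
  by exists 0; rewrite subrr.
by have [k ->] := h f fI; exists k; rewrite subr0.
Qed.

(** If t fixes z up to an element s of N, then s + t is integral at the nonzero
    coordinates of z, and integral vectors have trivial image in T. *)
Lemma stabilizerM (m : M) : stabilizer (@actM _ _ _ D) m = subtorus (vanishing m).
Proof.
rewrite -[m]reprK; set z := repr m; rewrite vanishing_pi.
apply/seteqP; split=> g /=; rewrite /stabilizer /=.
  have [t <-] := texp_projT_surj g; rewrite actME => /MeqP[s sN].
  rewrite -rotateZD => /(congr1 set_val)/esym /= h.
  have := subtorus_projT (rotate_fix h).
  by rewrite projTD raddfD /= sN add0r.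
move=> [t tz <-]; rewrite actME; congr (\pi_M _); apply: val_inj.
exact: rotate_supported.
Qed.

(** Parallel facets have the same stabilizer, so nestedness of I and J is
    essential.  For f in J but not in I, half of the normal of f would be congruent
    modulo the lattice to a combination of the normals in I, contradicting
    integrality of the dual basis at v. *)
Lemma subtorus_inj v I J : vertex P v -> I \subset J -> J \subset active v ->
  subtorus I = subtorus J -> I = J.
Proof.
move=> Vv IJ Jv TIJ; apply/eqP; rewrite finset.eqEsubset IJ; apply/fintype.subsetP => f fJ.
apply: contrapT => /negP fI.
have [e [del _ int _]] := exists_dual_basis Vv.
have fv := fintype.subsetP Jv f fJ.
(* One half is not an integer: this element of the subtorus of J is not in
   that of I. *)
pose t : 'rV[R]_d := 2^-1 *: delta_mx 0 f.
have : subtorus J (texp D (projT t)).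
  exists t => // g gJ; rewrite !mxE eqxx /=.
  by case: eqP => [gf|_]; [rewrite gf fJ in gJ|rewrite mulr0].
rewrite -TIJ => -[s sI] /eqP; rewrite -subr_eq0 -raddfB -projTN -projTD => /eqP h.
have [k kE] := int _ h f fv; move: kE; rewrite pairing_projT.
rewrite (bigD1 f) //= big1; last first.
  move=> g gf; have [gv|gv] := boolP (g \in active v).
    by rewrite del // (negbTE gf) mulr0.
  rewrite !mxE (negbTE gf) mulr0 subr0 sI ?mul0r //.
  by apply: contra gv => gI; apply: (fintype.subsetP Jv); exact: (fintype.subsetP IJ).
rewrite del // eqxx mulr1 addr0 !mxE !eqxx sI // add0r mulr1 => h2.
have : (1 + 2 * k)%:~R = 0 :> R by rewrite intrD intrM -h2; field.
move/eqP; rewrite intr_eq0 => /eqP; lia.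
Qed.

Lemma vanishing_below (m : M) : exists2 v, vertex P v & vanishing m \subset active v.
Proof.
have [v Vv h] := vertex_above (muT_polytope m).
by exists v; rewrite // -active_muT.
Qed.

End Reduced.

(** * Strata of the reduced space *)

Section ReducedStrata.
Local Open Scope quotient_scope.
Context {R : realType} {n : nat} {T : zmodType} (D : delzant R n T).
Notation P := (polytope D).
Notation d := (nfacets D).
Notation active := (active_facets D).
Notation CF := (Cn R d).
Notation M := (Mred D).
Notation Zl := (set_type (@Zlevel R n T D)).
Implicit Types (f : 'I_d) (xi eta v : 'cV[R]_n) (I J : {set 'I_d}) (t : 'rV[R]_d).

Lemma sin2_01 (s : R) : 0 <= sin s ^+ 2 <= 1.
Proof. by have := cos2Dsin2 s; have := sqr_ge0 (sin s); have := sqr_ge0 (cos s); lra. Qed.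

Lemma polar_coord t xi j : Cn_coord j (rotate t (section_pt D xi)) =
  match j with
  | inl f => cos (2 * pi * t 0 f) * Num.sqrt (2 * slack f xi)
  | inr f => sin (2 * pi * t 0 f) * Num.sqrt (2 * slack f xi)
  end.
Proof.
case: j => f.
  rewrite -[LHS]/(complex.Re (coo (rotate t (section_pt D xi)) f)).
  by rewrite !coo_ofcoo expi2pi_real /= mulr0 subr0.
rewrite -[LHS]/(complex.Im (coo (rotate t (section_pt D xi)) f)).
by rewrite !coo_ofcoo expi2pi_real /= mulr0 add0r.
Qed.

(** The square of the sine serves as a continuous map from R to [0,1], so that the
    path is a total function with values in Z. *)
Lemma polar_path ta tb xa xb (Pa : P xa) (Pb : P xb) :
  exists gam : R -> M, [/\ continuous gam,
    gam 0 = \pi_M (polar_point ta Pa), gam (pi / 2) = \pi_M (polar_point tb Pb) &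
    forall s, muT D (gam s) = xa + sin s ^+ 2 *: (xb - xa)].
Proof.
pose x (s : R) := xa + sin s ^+ 2 *: (xb - xa).
pose t (s : R) := ta + sin s ^+ 2 *: (tb - ta).
have Px s : P (x s) by apply: polytope_convex => //; exact: sin2_01.
exists (fun s => \pi_M (polar_point (t s) (Px s))); split.
- have cz : continuous (fun s => polar_point (t s) (Px s) : Zl).
    apply/continuous_comp_initial => s /=.
    apply: continuous_Cn => j.
    have cs : {for s, continuous (fun s => sin s ^+ 2)}.
      by apply: (@continuous_comp _ _ _ sin (fun y : R => y ^+ 2));
        [exact: continuous_sin|exact: exprn_continuous].
    have caff (a b : R) : {for s, continuous (fun s => a + sin s ^+ 2 * (b - a))}.
      apply: cvgD; first exact: cvg_cst.
      by apply: cvgM => //; exact: cvg_cst.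
    have ct f : {for s, continuous (fun s => 2 * pi * t s 0 f)}.
      rewrite (_ : (fun s => _) = fun s => 2 * pi * (ta 0 f + sin s ^+ 2 * (tb 0 f - ta 0 f))).
        by apply: cvgM; [exact: cvg_cst|exact: caff].
      by apply/funext => r; rewrite !mxE.
    have cx f : {for s, continuous (fun s => Num.sqrt (2 * slack f (x s)))}.
      rewrite (_ : (fun s => _) = fun s => Num.sqrt
          (2 * (slack f xa + sin s ^+ 2 * (slack f xb - slack f xa)))).
        apply: (@continuous_comp _ _ _ _ Num.sqrt); last exact: sqrt_continuous.
        by apply: cvgM; [exact: cvg_cst|exact: caff].
      by apply/funext => r; rewrite slack_line; congr (Num.sqrt (_ * _)); ring.
    case: j => f.
      rewrite (_ : (fun y => _) =
          fun s => cos (2 * pi * t s 0 f) * Num.sqrt (2 * slack f (x s))); last first.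
        by apply/funext => r; exact: (polar_coord _ _ (inl f)).
      apply: cvgM; last exact: cx.
      by apply: (cvg_comp _ _ (ct f)); exact: continuous_cos.
    rewrite (_ : (fun y => _) =
        fun s => sin (2 * pi * t s 0 f) * Num.sqrt (2 * slack f (x s))); last first.
      by apply/funext => r; exact: (polar_coord _ _ (inr f)).
    apply: cvgM; last exact: cx.
    by apply: (cvg_comp _ _ (ct f)); exact: continuous_sin.
  by move=> s; apply: continuous_comp; [exact: cz|exact: piM_continuous].
- congr (\pi_M _); apply: val_inj => /=.
  by rewrite /t /x sin0 expr0n /= !scale0r !addr0.
- congr (\pi_M _); apply: val_inj => /=.
  by rewrite /t /x sin_pihalf expr1n !scale1r !(addrC _ (_ - _)) !subrK.
- by move=> s; rewrite muT_polar.
Qed.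

Lemma active_segment xi eta (c : R) : P xi -> P eta -> active xi = active eta ->
  0 <= c <= 1 -> active (xi + c *: (eta - xi)) = active xi.
Proof.
move=> Px Pe ae /andP[c0 c1]; have [->|c0'] := eqVneq c 0.
  by rewrite scale0r addr0.
have [->|c1'] := eqVneq c 1; first by rewrite scale1r addrC subrK.
have c01 : 0 < c < 1 by rewrite lt0r c0' c0 lt_neqAle c1' c1.
by rewrite active_line // -ae finset.setIid.
Qed.

Lemma connected_stratum I : connected (Mstratum I).
Proof.
have [[a aI]|/forallNP h] := pselect (exists a, Mstratum I a); last first.
  by move=> B [x Bx] [C _ BC]; have := h x; rewrite BC in Bx; case: Bx.
suff -> : Mstratum I = connected_component (Mstratum I) a by exact: component_connected.
apply/seteqP; split; last exact: connected_component_sub.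
move=> b bI; have [ta aE] := polar_pointM a; have [tb bE] := polar_pointM b.
have [gam [cgam g0 g1 gmu]] := polar_path ta tb (muT_polytope a) (muT_polytope b).
exists (gam @` setT); last by exists (pi / 2) => //; rewrite g1 -bE.
split; first by exists 0 => //; rewrite g0 -aE.
  move=> _ [s _ <-]; rewrite /Mstratum /= -active_muT gmu active_segment //.
  - by rewrite active_muT.
  - exact: muT_polytope.
  - exact: muT_polytope.
  - by rewrite !active_muT aI bI.
  - exact: sin2_01.
apply: connected_continuous_connected; last exact: continuous_subspaceT.
by apply/connected_intervalP => x y _ _ z _.
Qed.

Lemma vanishing_inj (m m' : M) :
  stabilizer (@actM _ _ _ D) m = stabilizer (@actM _ _ _ D) m' ->
  vanishing m \subset vanishing m' -> vanishing m = vanishing m'.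
Proof.
rewrite !stabilizerM => sE sub; have [v Vv h] := vanishing_below m'.
exact: subtorus_inj Vv sub h sE.
Qed.

Lemma component_stratum (m : M) :
  connected_component [set m' | setT m' /\
    stabilizer (@actM _ _ _ D) m' = stabilizer (@actM _ _ _ D) m] m = Mstratum (vanishing m).
Proof.
have setE : [set x | setT x /\ vanishing x = vanishing m] = Mstratum (vanishing m).
  by apply/seteqP; split=> x; [case|split].
rewrite (component_of_marking (vanishing := @vanishing _ _ _ D)) //.
- exact: open_vanishing.
- by move=> x y _ _; exact: vanishing_inj.
- by move=> x _ xm; rewrite !stabilizerM xm.
- by rewrite setE; exact: connected_stratum.
Qed.

Lemma strataME (S : set M) : strataM D S <->
  exists2 xi, P xi & S = Mstratum (active xi).
Proof.
split=> [[m _ ->]|[xi Px ->]].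
  by exists (muT D m); [exact: muT_polytope|rewrite component_stratum active_muT].
have [m mx] := muT_surj Px; exists m => //.
by rewrite component_stratum -active_muT mx.
Qed.

Lemma stratum_nonempty xi : P xi -> exists m, Mstratum (active xi) m.
Proof.
by move=> Px; have [m mx] := muT_surj Px; exists m; rewrite /Mstratum /= -active_muT mx.
Qed.

(** The path of [polar_path] from m towards a point over xi, with unchanged
    phases, enters the stratum of xi immediately. *)
Lemma closure_stratum xi (m : M) : P xi ->
  closure (Mstratum (active xi)) m <-> active xi \subset vanishing m.
Proof.
move=> Px; split.
  move=> /(_ [set m' | vanishing m' \subset vanishing m]) [].
    by apply: open_nbhs_nbhs; split; [exact: open_vanishing|exact: subxx].
  by move=> m' [<-].
move=> sub B Bm; have [t mE] := polar_pointM m.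
have [gam [cgam g0 _ gmu]] := polar_path t t (muT_polytope m) Px.
have : \forall s \near (0 : R)^'+, B (gam s).
  have cg : gam s @[s --> 0^'+] --> m.
    by apply: cvg_at_right_filter; rewrite [X in _ --> X]mE -g0; exact: cgam.
  exact: cg.
move=> nB; near (0 : R)^'+ => s; exists (gam s); split; last by near: s.
have s0 : 0 < s by near: s; exact: nbhs_right_gt.
have s1 : s < pi / 2.
  by near: s; apply: nbhs_right_lt; rewrite divr_gt0 // pi_gt0.
rewrite /Mstratum /= -active_muT gmu active_line //.
- by rewrite active_muT; apply/finset.setIidPr.
- exact: muT_polytope.
have sin0 : 0 < sin s by apply: sin_gt0_pihalf; rewrite s0.
have cos0 : 0 < cos s.
  by apply: cos_gt0_pihalf; rewrite s1 andbT (lt_trans _ s0) // oppr_lt0 divr_gt0 // pi_gt0.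
rewrite exprn_gt0 //=; have := cos2Dsin2 s.
have : 0 < cos s ^+ 2 by rewrite exprn_gt0.
lra.
Unshelve. all: by end_near. Qed.

Lemma closure_strata xi xi' : P xi -> P xi' ->
  (Mstratum (active xi) `<=` closure (Mstratum (active xi'))) <->
  active xi' \subset active xi.
Proof.
move=> Px Px'; split=> [h|sub m mI].
  have [m mI] := stratum_nonempty Px.
  by have /(closure_stratum _ Px') := h _ mI; rewrite mI.
by apply/closure_stratum => //; rewrite mI.
Qed.

Lemma subtorus_vertex v : vertex P v -> subtorus (D := D) (active v) = setT.
Proof.
move=> Vv; apply/seteqP; split=> // g _; have [X <-] := texp_surj D g.
have [e [_ exp _ _]] := exists_dual_basis Vv.
exists (\row_f ((f \in active v)%:R * pairing X (e f))).
  by move=> f /negbTE fv; rewrite mxE fv mul0r.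
congr (texp D _); rewrite [RHS](exp X) /projT [RHS]big_mkcond; apply: eq_bigr => f _.
by rewrite mxE; case: ifP => _; rewrite ?mul1r // mul0r scale0r.
Qed.

Lemma fixed_vertex v (m : M) : vertex P v -> muT D m = v -> fixedM m.
Proof.
move=> Vv mv g; have : stabilizer (@actM _ _ _ D) m g.
  by rewrite stabilizerM -active_muT mv subtorus_vertex.
by [].
Qed.

(** Two points of Z with the same moduli differ by phases. *)
Lemma fibre_transitive (m m' : M) : muT D m = muT D m' -> exists g, m' = actM g m.
Proof.
move=> mm'; have [t mE] := polar_pointM m; have [t' mE'] := polar_pointM m'.
exists (texp D (projT (t' - t))); rewrite {1}mE' [X in actM _ X]mE actME.
congr (\pi_M _); apply: val_inj => /=.
by rewrite -rotateD subrK mm'.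
Qed.

Lemma fixed_unique v (m m' : M) : vertex P v -> muT D m = v -> muT D m' = v -> m' = m.
Proof.
move=> Vv mv mv'; have [g ->] : exists g, m' = actM g m.
  by apply: fibre_transitive; rewrite mv mv'.
exact: fixed_vertex mv g.
Qed.

Theorem fixed_points v : vertex P v -> exists mv : M,
  [/\ fixedM mv, muT D mv = v,
      (forall m : M, fixedM m -> muT D m = v -> m = mv) &
      muT D @^-1` [set v] = [set mv]].
Proof.
move=> Vv; have [mv mvE] := muT_surj (vertex_in Vv); exists mv; split=> //.
- exact: fixed_vertex mvE.
- by move=> m _ mE; exact: fixed_unique mvE mE.
- apply/seteqP; split=> m /=; last by move=> ->.
  by move=> mE; exact: fixed_unique mvE mE.
Qed.

Lemma preimage_relint s : relints D s -> strataM D (muT D @^-1` s).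
Proof.
by move=> /relintsE[xi Px ->]; rewrite muT_open_face; apply/strataME; exists xi.
Qed.

Theorem strata_bij : set_bij (relints D) (strataM D) (fun s => muT D @^-1` s).
Proof.
split; first by move=> s /preimage_relint.
  move=> s s' /set_mem/relintsE[xi Px ->] /set_mem/relintsE[xi' Px' ->].
  rewrite !muT_open_face => E; have [m mx] := stratum_nonempty Px.
  have mx' : Mstratum (active xi') m by rewrite -E.
  by rewrite -mx -mx'.
move=> S /strataME[xi Px ->]; exists (open_face (active xi)).
  by apply/relintsE; exists xi.
exact: muT_open_face.
Qed.

Theorem strata_closure (s s' : set 'cV[R]_n) : relints D s -> relints D s' ->
  (s `<=` P `&` closure s' <->
   muT D @^-1` s `<=` closure (muT D @^-1` s')).
Proof.
move=> /relintsE[xi Px ->] /relintsE[xi' Px' ->].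
by rewrite !muT_open_face closure_strata // open_face_closure.
Qed.

End ReducedStrata.

(** * Kempf-Ness: orbits of the complexified group meet the level set *)

Section KempfNess.
Context {R : realType}.

Lemma exp_tangent (A x : R) : 0 < A -> A * (1 + x - ln A) <= expR x.
Proof.
move=> A0; have -> : expR x = A * expR (x - ln A).
  by rewrite expRD expRN lnK ?posrE // mulrCA divff ?gt_eqF // mulr1.
by rewrite ler_pM2l // -addrA expR_ge1Dx.
Qed.

(** The tangent line of slope -3l/2 bounds the convex function
    x |-> c exp(-k x) from below for x < 0, that of slope -l/2 for 0 <= x. *)
Lemma exp_linear_coercive (c k l : R) : 0 < c -> 0 < k -> 0 < l ->
  exists C, forall x, C + l / 2 * `|x| <= c * expR (- (k * x)) + l * x.
Proof.
move=> c0 k0 l0; pose A (u : R) := u * l / (c * k).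
have A0 u : 0 < u -> 0 < A u by move=> u0; rewrite /A divr_gt0 ?mulr_gt0.
have bound u x : 0 < u -> c * A u * (1 - ln (A u)) + (l - u * l) * x
    <= c * expR (- (k * x)) + l * x.
  move=> u0; have := exp_tangent (- (k * x)) (A0 u u0).
  rewrite -(ler_pM2l c0) => h.
  have E1 : c * A u * k = u * l by rewrite /A; field; rewrite !gt_eqF.
  have : c * (A u * (1 + - (k * x) - ln (A u))) =
    c * A u * (1 - ln (A u)) - u * l * x by rewrite -E1; ring.
  move=> E2; rewrite E2 in h.
  have -> : (l - u * l) * x = l * x - u * l * x by ring.
  lra.
pose C1 := c * A (3 / 2) * (1 - ln (A (3 / 2))).
pose C2 := c * A (1 / 2) * (1 - ln (A (1 / 2))).
exists (Num.min C1 C2) => x; have [x0|x0] := leP 0 x.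
  have := bound (1 / 2) x; rewrite -/C2 => /(_ ltac:(lra)) h.
  have : Num.min C1 C2 <= C2 by rewrite ge_min lexx orbT.
  move: h; have -> : (l - 1 / 2 * l) * x = l / 2 * x by field.
  rewrite ger0_norm //; lra.
have := bound (3 / 2) x; rewrite -/C1 => /(_ ltac:(lra)) h.
have : Num.min C1 C2 <= C1 by rewrite ge_min lexx.
move: h; have -> : (l - 3 / 2 * l) * x = l / 2 * - x by field.
rewrite ltr0_norm //; lra.
Qed.

Context {n : nat} {T : zmodType} (D : delzant R n T).
Notation P := (polytope D).
Notation d := (nfacets D).
Notation active := (active_facets D).

(** For s_f = |z_f|^2, the derivative at b in a direction t of ker pi is, up to
    sign, the defining equation of Z for t at the point exp(-2 pi b) z. *)
Definition kn_potential (s : 'I_d -> R) (b : 'rV[R]_d) : R :=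
  \sum_f (s f / (8 * pi) * expR (- (4 * pi * b 0 f)) + offset f * b 0 f).

Lemma linear_form_continuous (c : 'I_d -> R) :
  continuous (fun b : 'rV[R]_d => \sum_f b 0 f * c f).
Proof.
apply: (@continuous_big _ _ +%R) => [|f _]; first exact: add_continuous.
by move=> x; apply: continuousM; [exact: coord_continuous|exact: cst_continuous].
Qed.

Lemma kn_potential_continuous s : continuous (kn_potential s).
Proof.
apply: (@continuous_big _ _ +%R) => [|f _]; first exact: add_continuous.
have cc : continuous (fun b : 'rV[R]_d => b 0 f) by exact: coord_continuous.
have ce : continuous (fun b : 'rV[R]_d => expR (- (4 * pi * b 0 f))).
  move=> x; apply: (@continuous_comp _ _ _ (fun b : 'rV[R]_d => - (4 * pi * b 0 f)) expR).
    apply: (@continuousN _ _ _ (fun b : 'rV[R]_d => 4 * pi * b 0 f)).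
    by apply: continuousM; [exact: cst_continuous|exact: cc].
  exact: continuous_expR.
move=> x.
apply: (@continuousD _ _ _ (fun b : 'rV[R]_d => s f / (8 * pi) * expR (- (4 * pi * b 0 f)))
  (fun b : 'rV[R]_d => offset f * b 0 f)).
  by apply: continuousM; [exact: cst_continuous|exact: ce].
by apply: continuousM; [exact: cst_continuous|exact: cc].
Qed.

Lemma pi4_gt0 : 0 < 4 * pi :> R.
Proof. by rewrite mulr_gt0 // pi_gt0. Qed.

(** On ker pi the offsets may be replaced by the slacks at any point xi.  With xi
    lying exactly on the facets where s vanishes, the potential is a sum of
    coercive functions of the coordinates b_f with s_f <> 0; the remaining ones
    belong to facets of v and are linear functions of the coordinates off v, so
    sublevel sets are compact. *)
Lemma kn_minimum (s : 'I_d -> R) v : vertex P v -> (forall f, 0 <= s f) ->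
  (forall f, s f = 0 -> f \in active v) ->
  exists2 b, projT b = 0 & forall b', projT b' = 0 -> kn_potential s b <= kn_potential s b'.
Proof.
move=> Vv s0 sv; pose I : {set 'I_d} := [set f | s f == 0]%SET.
have Iv : I \subset active v.
  by apply/fintype.subsetP => f; rewrite inE => /eqP; exact: sv.
have [xi Px xI] := open_face_below Vv Iv.
have [e [del exp _ _]] := exists_dual_basis Vv.
have lpos f : f \notin I -> 0 < slack f xi by rewrite -xI; exact: slack_gt0.
have spos f : f \notin I -> 0 < s f by rewrite inE lt0r s0 andbT.
have pi8 : 0 < 8 * pi :> R by rewrite mulr_gt0 // pi_gt0.
pose g (f : 'I_d) (x : R) := s f / (8 * pi) * expR (- (4 * pi * x)) + slack f xi * x.
have GE b : projT b = 0 -> kn_potential s b = \sum_(f | f \notin I) g f (b 0 f).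
  move=> b0; have := pairing_projT b xi; rewrite b0 pairing0l => E.
  rewrite -[LHS]addr0 [X in _ + X = _]E /kn_potential -big_split /= [RHS]big_mkcond /=.
  apply: eq_bigr => f _; case: ifPn => [fI|/negbNE fI].
    by rewrite /g /slack /affine; ring.
  have /activeP : f \in active xi by rewrite xI.
  move: fI; rewrite inE => /eqP -> h; rewrite mul0r mul0r add0r.
  move: h; rewrite /slack /affine => h.
  by rewrite mulrC -mulrDr [offset f + _]addrC h mulr0.
have [C hC] : {C : 'I_d -> R & forall f, f \notin I ->
    forall x, C f + slack f xi / 2 * `|x| <= g f x}.
  apply: (@choice _ _ (fun f (C : R) => f \notin I ->
    forall x, C + slack f xi / 2 * `|x| <= g f x)) => f.
  have [fI|fI] := boolP (f \in I); first by exists 0.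
  have [C h] := exp_linear_coercive (divr_gt0 (spos f fI) pi8) pi4_gt0 (lpos f fI).
  by exists C => _ x; exact: h.
pose K := [set b : 'rV[R]_d | (forall X : 'cV[R]_n, \sum_f b 0 f * pairing (normal f) X = 0) /\
   kn_potential s b <= kn_potential s 0].
have KE (b : 'rV[R]_d) : projT b = 0 <->
    forall X : 'cV[R]_n, \sum_f b 0 f * pairing (normal f) X = 0.
  split=> [b0 X|h]; first by rewrite -pairing_projT b0 pairing0l.
  by apply: pairing_eq0 => X; rewrite pairing_projT.
pose G0 := kn_potential s 0.
pose B := G0 - \sum_(f | f \notin I) C f.
have bnd b : K b -> forall f, f \notin I -> slack f xi / 2 * `|b 0 f| <= B.
  move=> [/KE b0 bG] f fI; rewrite /B lerBrDl.
  apply: le_trans bG; rewrite GE //.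
  have : \sum_(g | g \notin I) (C g + slack g xi / 2 * `|b 0 g|) <=
     \sum_(f | f \notin I) g f (b 0 f) by apply: ler_sum => h hI; exact: hC.
  apply: le_trans; rewrite big_split lerD2l /= (bigD1 f) //= lerDl.
  by apply: sumr_ge0 => h /andP[hI _]; rewrite mulr_ge0 ?normr_ge0 // divr_ge0 ?ltW ?lpos.
pose M1 (f : 'I_d) := B / (slack f xi / 2).
have bnd1 b : K b -> forall f, f \notin I -> `|b 0 f| <= M1 f.
  move=> Kb f fI; rewrite /M1 ler_pdivlMr ?divr_gt0 ?lpos // mulrC; exact: bnd.
pose M2 f := \sum_(h | h \notin active v) `|pairing (normal h) (e f)| * M1 h.
have bnd2 b : K b -> forall f, f \in active v -> `|b 0 f| <= M2 f.
  move=> Kb f fv; have [/(_ (e f)) + _] := Kb.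
  rewrite (bigID (fun h => h \in active v)) /= (bigD1 f) //= del // eqxx mulr1 big1 ?addr0.
    move/eqP; rewrite addr_eq0 => /eqP ->; rewrite normrN.
    apply: le_trans (ler_norm_sum _ _ _) _; apply: ler_sum => h hv.
    rewrite normrM mulrC ler_wpM2l //; apply: bnd1 => //.
    by apply: contra hv; exact: (fintype.subsetP Iv).
  by move=> h /andP[hv hf]; rewrite del // (negbTE hf) mulr0.
pose M3 (f : 'I_d) := Num.max (M1 f) (M2 f).
have bnd3 b : K b -> forall f, `|b 0 f| <= M3 f.
  move=> Kb f; rewrite /M3 le_max; have [fv|fv] := boolP (f \in active v).
    by rewrite (bnd2 _ Kb) ?orbT.
  by rewrite (bnd1 _ Kb) //; apply: contra fv; exact: (fintype.subsetP Iv).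
have Kclosed : closed K.
  rewrite (_ : K = (\bigcap_(X in [set: 'cV[R]_n])
     ((fun b : 'rV[R]_d => \sum_f b 0 f * pairing (normal f) X) @^-1` [set 0]))
     `&` (kn_potential s @^-1` [set x | x <= G0])).
    apply: closedI.
      apply: closed_bigI => X _; apply: closed_comp.
        by move=> x _; exact: linear_form_continuous.
      exact/accessible_closed_set1/hausdorff_accessible/Rhausdorff.
    apply: closed_comp; last exact: closed_le.
    by move=> x _; exact: kn_potential_continuous.
  by apply/seteqP; split=> b /= [h1 h2]; split=> // X; [move=> _|]; exact: h1.
have Kcompact : compact K.
  have box : compact [set b : 'rV[R]_d | forall f, `[(- M3 f), (M3 f)]%classic (b ord0 f)].
    by apply: (@rV_compact _ _ (fun f => `[(- M3 f), (M3 f)]%classic)) => f; exact: segment_compact.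
  apply: subclosed_compact Kclosed box _ => b Kb f /=.
  by rewrite in_itv /= -ler_norml; exact: bnd3.
have K0 : K 0.
  by split=> // X; rewrite big1 // => f _; rewrite mxE mul0r.
have [b bK bmin] := EVT_min_rV (ex_intro _ 0 K0) Kcompact
  (continuous_subspaceT (@kn_potential_continuous s)).
have [bKer bG] := set_mem bK.
exists b; first exact/KE.
move=> b' b'0; have [h|h] := leP (kn_potential s b') G0.
  by apply: bmin; apply/mem_set; split=> //; exact/KE.
by apply: le_trans bG _; exact: ltW.
Qed.

Lemma kn_critical (s : 'I_d -> R) (b t : 'rV[R]_d) :
  (forall x : R, kn_potential s b <= kn_potential s (b + x *: t)) ->
  \sum_f t 0 f * (expR (- (4 * pi * b 0 f)) * s f / 2) = \sum_f t 0 f * offset f.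
Proof.
move=> bmin; pose phi x := kn_potential s (b + x *: t).
pose h f (x : R) := s f / (8 * pi) * expR (- (4 * pi * (b 0 f + x * t 0 f)))
   + offset f * (b 0 f + x * t 0 f).
pose dh f (x : R) := s f / (8 * pi) * (expR (- (4 * pi * (b 0 f + x * t 0 f)))
   * (- (4 * pi) * t 0 f)) + offset f * t 0 f.
have aff (x a k : R) : is_derive x 1 (fun y : R => a + y * k) k.
  have C : r^-1 *: ((a + (r *: 1 + x) * k) - (a + x * k)) @[r --> (0 : R)^'] --> k.
    apply: cvg_near_cst; near=> r.
    have r0 : r != 0 by near: r; exact: nbhs_dnbhs_neq.
    rewrite [r *: 1]mulr1 -[RHS](mulKf r0); congr (_ * _); ring.
  by split; [exact: (cvgP k C)|exact/cvg_lim].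
have hd f (x : R) : is_derive x 1 (h f) (dh f x).
  have h2 : is_derive x 1 (fun x => - (4 * pi * (b 0 f + x * t 0 f))) (- (4 * pi) * t 0 f).
    rewrite (_ : (fun x => _) = fun x => - (4 * pi) * b 0 f + x * (- (4 * pi) * t 0 f)).
      exact: aff.
    by apply/funext => y; ring.
  have h3 : is_derive x 1 (fun y => expR (- (4 * pi * (b 0 f + y * t 0 f))))
      (expR (- (4 * pi * (b 0 f + x * t 0 f))) * (- (4 * pi) * t 0 f)).
    exact: is_derive1_comp (is_derive_expR _) h2.
  have h4 := is_deriveM (is_derive_cst (s f / (8 * pi)) x 1) h3.
  have h5 := is_deriveM (is_derive_cst (offset f) x 1) (aff x (b 0 f) (t 0 f)).
  apply: is_derive_eq (is_deriveD h4 h5) _.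
  by rewrite /dh /= !scaler0 !addr0.
have phid (x : R) : is_derive x 1 phi (\sum_f dh f x).
  rewrite (_ : phi = \sum_f h f); first exact: is_derive_sum.
  apply/funext => y; rewrite fct_sumE; apply: eq_bigr => f _.
  by rewrite /h !mxE.
have m0 : is_derive (0 : R) 1 phi 0.
  apply: (@derive1_at_min _ phi (-1) 1) => //.
  - by rewrite in_itv /= ltrN10 ltr01.
  - by move=> x _; rewrite /phi scale0r addr0; exact: bmin.
have : \sum_f dh f 0 = 0.
  by have [_ <-] := phid 0; have [_ ->] := m0.
rewrite /dh => E; apply/eqP; rewrite -subr_eq0 -sumrB -oppr_eq0 -sumrN.
apply/eqP; rewrite -[RHS]E; apply: eq_bigr => f _.
rewrite mul0r addr0.
have pi0 : (pi : R) != 0 by rewrite gt_eqF // pi_gt0.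
move: (expR _) => u; move: (pi : R) pi0 => p p0; field; exact: p0.
Unshelve. all: by end_near. Qed.

Theorem kempf_ness (z : Cn R d) v : vertex P v -> zeros z \subset active v ->
  exists2 b, projT b = 0 & Zlevel (cscale (fun f => expi2pi (0 +i* b 0 f)%C) z).
Proof.
move=> Vv zv; pose s f := sqnorm (coo z f).
have [f|f|b b0 bmin] := @kn_minimum s v Vv; first exact: sqnorm_ge0.
  by move=> /eqP; rewrite sqnorm_eq0 => h; apply: (fintype.subsetP zv); rewrite inE.
exists b => // t t0; rewrite -(@kn_critical s b t).
  by apply: eq_bigr => f _; rewrite coo_ofcoo sqnormM sqnorm_expi2piE.
move=> x; apply: bmin; rewrite projTD b0 add0r.
rewrite /projT; under eq_bigr => f _ do rewrite mxE -scalerA.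
by rewrite -scaler_sumr -/(projT t) t0 scaler0.
Qed.

End KempfNess.

(** * Strata and orbits in the toric variety *)

Section Toric.
Local Open Scope quotient_scope.
Context {R : realType} {n : nat} {T : zmodType} (D : delzant R n T).
Notation P := (polytope D).
Notation d := (nfacets D).
Notation active := (active_facets D).
Notation CF := (Cn R d).
Notation M := (Mred D).
Notation Q := (CFmodNC D).
Notation Zl := (set_type (@Zlevel R n T D)).
Implicit Types (f : 'I_d) (xi eta v : 'cV[R]_n) (I J : {set 'I_d}) (t : 'rV[R]_d).

(** Integral vectors act trivially on C^F; this is how an element of N is replaced
    by one of ker pi. *)
Lemma lattice_integral X : texp D X = 0 -> exists2 t, projT t = X &
  forall f, exists k : int, t 0 f = k%:~R.
Proof.
move=> X0; have [v Vv] := vertex_exists D.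
have [e [_ exp int _]] := exists_dual_basis Vv.
exists (\row_f ((f \in active v)%:R * pairing X (e f))).
  rewrite [RHS](exp X) /projT [RHS]big_mkcond; apply: eq_bigr => f _.
  by rewrite mxE; case: ifP => _; rewrite ?mul1r // mul0r scale0r.
move=> f; rewrite mxE; have [fv|fv] := boolP (f \in active v).
  by have [k ->] := int _ X0 f fv; exists k; rewrite mul1r.
by exists 0; rewrite mul0r.
Qed.

Lemma QeqP (z z' : CF) : \pi_Q z = \pi_Q z' <->
  exists a b, [/\ projT a = 0, projT b = 0 &
    z' = cscale (fun f => expi2pi (a 0 f +i* b 0 f)%C) z].
Proof. by split=> [/eqmodP/asboolP|h]; last exact/eqmodP/asboolP. Qed.

Lemma Q_rotate_inN t (z : CF) : inN t -> \pi_Q (rotate t z) = \pi_Q z.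
Proof.
move=> tN; have [k kt kint] := lattice_integral tN.
apply/esym/QeqP; exists (t - k), 0; split.
- by rewrite projTD projTN kt subrr.
- exact: projT0.
apply: eq_cscale => f; have [j kj] := kint f.
rewrite !mxE kj -[(_ +i* 0)%C]/((t 0 f - j%:~R)%:C%C) rmorphB expi2piD expi2piN.
by rewrite expi2pi_int invr1 mulr1.
Qed.

Lemma varpi_pi (z : Zl) : varpi D (\pi_M z) = \pi_Q (set_val z).
Proof. by rewrite /varpi; have [t tN ->] := repr_rotate z; exact: Q_rotate_inN. Qed.

Lemma varpi_continuous : continuous (varpi D).
Proof.
apply/(@quotient_continuous _ {eq_quot @Nrel R n T D}).
rewrite (_ : _ \o _ = \pi_Q \o set_val); last first.
  by apply/funext => z; exact: varpi_pi.
move=> z; apply: continuous_comp; first exact: initial_continuous.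
exact: pi_continuous.
Qed.

Definition vanishingQ (q : Q) : {set 'I_d} := zeros (repr q).

Lemma zeros_NC (z z' : CF) : \pi_Q z = \pi_Q z' -> zeros z = zeros z'.
Proof.
by move=> /QeqP[a [b [_ _ ->]]]; rewrite zeros_cscale // => f; exact: expi2pi_neq0.
Qed.

Lemma vanishingQ_pi (z : CF) : vanishingQ (\pi_Q z) = zeros z.
Proof. by apply: zeros_NC; rewrite reprK. Qed.

Lemma vanishingQ_varpi (m : M) : vanishingQ (varpi D m) = vanishing m.
Proof. exact: vanishingQ_pi. Qed.

Lemma open_vanishingQ I : open [set q : Q | vanishingQ q \subset I].
Proof.
rewrite /open /= /quotient_open (_ : _ @^-1` _ = [set z : CF | zeros z \subset I]).
  exact: open_zeros.
by apply/seteqP; split=> z /=; rewrite vanishingQ_pi.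
Qed.

Lemma CFatE v : vertex P v -> CFat (D := D) v = [set z : CF | zeros z \subset active v].
Proof.
move=> Vv; apply/seteqP; split=> z /= h.
  apply/fintype.subsetP => f; rewrite inE -facets_at_active //.
  by apply: contraTT => /h.
move=> f; rewrite facets_at_active //; apply: contra => zf.
by apply: (fintype.subsetP h); rewrite inE.
Qed.

Lemma MtoricE (q : Q) : Mtoric q <-> exists2 v, vertex P v & vanishingQ q \subset active v.
Proof.
split=> [[z [v Vv]]|[v Vv h]].
  by rewrite CFatE // => h <-; exists v; rewrite // vanishingQ_pi.
by exists (repr q); [exists v; rewrite ?CFatE|rewrite reprK].
Qed.

Lemma varpi_surj (q : Q) : Mtoric q -> exists m, varpi D m = q.
Proof.
move=> /MtoricE[v Vv h]; have [b b0 Zb] := kempf_ness Vv h.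
exists (\pi_M (SigSub (mem_set Zb) : Zl)); rewrite varpi_pi /= -[RHS]reprK.
apply/esym/QeqP; exists 0, b; rewrite projT0; split=> //.
by apply: eq_cscale => f; rewrite mxE.
Qed.

Lemma varpi_Mtoric (m : M) : Mtoric (varpi D m).
Proof. by apply/MtoricE; rewrite vanishingQ_varpi; exact: vanishing_below. Qed.

Lemma varpi_stratum I : (exists m, Mstratum I m) ->
  varpi D @` Mstratum I = [set q | vanishingQ q = I].
Proof.
move=> [m0 m0I]; apply/seteqP; split=> q /=.
  by move=> [m mI <-]; rewrite vanishingQ_varpi.
move=> qI; have /varpi_surj[m mq] : Mtoric q.
  by apply/MtoricE; rewrite qI -m0I; exact: vanishing_below.
by exists m => //; rewrite /Mstratum /= -vanishingQ_varpi mq.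
Qed.

(** Two vectors with the same zeros differ by a vector of nonzero scalars. *)
Lemma TCorbitE (q : Q) : TCorbit q = [set q' | vanishingQ q' = vanishingQ q].
Proof.
apply/seteqP; split=> q' /=.
  by move=> [z [w [-> w0 ->]]]; rewrite !vanishingQ_pi zeros_cscale.
move=> qq'; exists (repr q), (fun f => if f \in vanishingQ q then 1
  else coo (repr q') f / coo (repr q) f); split.
- by rewrite reprK.
- move=> f; case: ifPn; first by rewrite oner_eq0.
  move=> fq; have := fq; rewrite -{1}qq' !inE => h1.
  by move: fq; rewrite inE => h2; rewrite mulf_neq0 // invr_eq0.
- rewrite -{1}[q']reprK; congr (\pi_Q _); apply: coo_inj => f.
  rewrite coo_ofcoo; case: ifPn => [fq|].
    have := fq; rewrite -{1}qq' !inE => /eqP ->.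
    by move: fq; rewrite inE => /eqP ->; rewrite mulr0.
  by rewrite inE => h; rewrite divfK.
Qed.

Lemma actToricE t (z : CF) :
  actToric (D := D) (texp D (projT t)) (\pi_Q z) = \pi_Q (rotate t z).
Proof.
rewrite /actToric; set s := torus_lift D _.
have sE : texp D (projT s) = texp D (projT t) by exact: torus_liftK.
have [a [b [a0 b0 ->]]] : exists a b, [/\ projT a = 0, projT b = 0 &
    repr (\pi_Q z) = cscale (fun f => expi2pi (a 0 f +i* b 0 f)%C) z].
  by apply/QeqP; rewrite reprK.
have [k kE kint] : exists2 k, projT k = projT (s - t) & forall f, exists j : int, k 0 f = j%:~R.
  by apply: lattice_integral; rewrite projTD projTN raddfD raddfN /= sE subrr.
apply/esym/QeqP; exists (s - t - k + a), b; split=> //.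
  by rewrite !(projTD, projTN) kE projTD projTN a0 addr0 subrr.
rewrite /rotate !cscale_comp; apply: eq_cscale => f; have [j kj] := kint f.
have kf : expi2pi (k 0 f)%:C%C = 1 by rewrite kj expi2pi_int.
rewrite -[RHS]mul1r -{1}kf -!expi2piD; congr expi2pi.
by rewrite !mxE; apply/eqP; rewrite eq_complex /=; apply/andP; split; apply/eqP; ring.
Qed.

Lemma stabilizerQ (q : Q) :
  stabilizer (@actToric _ _ _ D) q = subtorus (vanishingQ q).
Proof.
rewrite -[q]reprK; set z := repr q; rewrite vanishingQ_pi.
apply/seteqP; split=> g /=; rewrite /stabilizer /=.
  have [t <-] := texp_projT_surj D g; rewrite actToricE => /QeqP[a [b [a0 b0 h]]].
  have <- : projT (a + t) = projT t by rewrite projTD a0 add0r.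
  apply: subtorus_projT => f; rewrite inE => zf.
  have : expi2pi (a 0 f +i* b 0 f)%C * expi2pi (t 0 f)%:C%C = 1.
    apply: (mulIf zf); rewrite mul1r -mulrA.
    by have := congr1 (fun y => coo y f) h; rewrite !coo_ofcoo.
  rewrite -expi2piD -[X in expi2pi X]/((a 0 f + t 0 f) +i* (b 0 f + 0))%C.
  by move=> /expi2pi_eq1_complex[_]; rewrite mxE.
move=> [t tz <-]; rewrite actToricE; congr (\pi_Q _).
exact: rotate_supported.
Qed.

Lemma vanishingQ_inj (q q' : Q) : Mtoric q -> Mtoric q' ->
  stabilizer (@actToric _ _ _ D) q = stabilizer (@actToric _ _ _ D) q' ->
  vanishingQ q \subset vanishingQ q' -> vanishingQ q = vanishingQ q'.
Proof.
rewrite !stabilizerQ => _ /MtoricE[v Vv h] sE sub.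
exact: subtorus_inj Vv sub h sE.
Qed.

Lemma strataToric_stratum xi : P xi -> strataToric D (varpi D @` Mstratum (active xi)).
Proof.
move=> Px; have [m mI] := stratum_nonempty Px.
have sE : varpi D @` Mstratum (active xi) = [set q | vanishingQ q = active xi].
  by apply: varpi_stratum; exists m.
exists (varpi D m); first exact: varpi_Mtoric.
have lE : [set x | Mtoric x /\ vanishingQ x = vanishingQ (varpi D m)] =
    varpi D @` Mstratum (active xi).
  rewrite sE vanishingQ_varpi mI; apply/seteqP; split=> q /=; first by case.
  move=> qI; split=> //; apply/MtoricE; rewrite qI -mI; exact: vanishing_below.
rewrite (component_of_marking (vanishing := vanishingQ)) //.
- exact: varpi_Mtoric.
- exact: open_vanishingQ.
- exact: vanishingQ_inj.
- by move=> x _ xm; rewrite !stabilizerQ xm.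
- rewrite lE; apply: connected_continuous_connected; first exact: connected_stratum.
  exact/continuous_subspaceT/varpi_continuous.
Qed.

Lemma TCorbits_stratum xi : P xi -> TCorbits D (varpi D @` Mstratum (active xi)).
Proof.
move=> Px; have [m mI] := stratum_nonempty Px.
exists (varpi D m); first exact: varpi_Mtoric.
rewrite varpi_stratum; last by exists m.
by rewrite TCorbitE vanishingQ_varpi mI.
Qed.

Lemma preimage_relint_orbit (s : set 'cV[R]_n) : relints D s ->
  exists2 O, TCorbits D O & muT D @^-1` s = varpi D @^-1` O.
Proof.
move=> /relintsE[xi Px ->]; exists (varpi D @` Mstratum (active xi)).
  exact: TCorbits_stratum.
rewrite muT_open_face varpi_stratum; last exact: stratum_nonempty.
by apply/seteqP; split=> m /=; rewrite vanishingQ_varpi.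
Qed.

End Toric.

(** * The domains of the charts *)

Section Domains.
Local Open Scope quotient_scope.
Context {R : realType} {n : nat} {T : zmodType} (D : delzant R n T).
Notation P := (polytope D).
Notation d := (nfacets D).
Notation active := (active_facets D).
Notation CF := (Cn R d).
Notation M := (Mred D).
Notation Q := (CFmodNC D).
Notation Zl := (set_type (@Zlevel R n T D)).
Implicit Types (f : 'I_d) (xi eta v : 'cV[R]_n) (I J : {set 'I_d}) (t : 'rV[R]_d).

(** If z vanishes on a facet f not through v, then rho_v(z) is not interior:
    dilating rho_v(z) by c > 1 moves the moment point from xi to
    v + c^2 (xi - v), which lies beyond f.  Conversely the slacks off v are
    continuous functions of the coordinates at v, positive at rho_v(z). *)
Lemma Uat_restrict v (z : CF) : vertex P v -> Zlevel z ->
  Uat (D := D) (v := v) (restrict_at v z) <-> zeros z \subset active v.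
Proof.
move=> Vv Zz; have Pv := vertex_in Vv.
have [e he] := exists_dual_basis Vv; have [del exp _ _] := he.
have [xi hxi] := moment_exists Zz.
have Px : P xi.
  by apply/polytopeE => f; rewrite hxi divr_ge0 // sqnorm_ge0.
have zE f : (f \in zeros z) = (slack f xi == 0).
  by rewrite inE hxi mulf_eq0 invr_eq0 pnatr_eq0 orbF sqnorm_eq0.
split=> [|zv].
  move=> Uz; apply/fintype.subsetP => f; rewrite zE => /eqP fx.
  apply: contrapT => /negP fv.
  have cw : c *: restrict_at v z @[c --> (1 : R)^'+] --> restrict_at v z.
    apply: cvg_at_right_filter; rewrite -[X in _ --> X]scale1r.
    by apply: cvgZr_tmp; exact: cvg_id.
  have nU : \forall c \near (1 : R)^'+, (restrict_at v @` @Zlevel R n T D) (c *: restrict_at v z).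
    exact: cw Uz.
  have [c [c1 [z' Zz' zz']]] : exists c, 1 < c /\
      (restrict_at v @` @Zlevel R n T D) (c *: restrict_at v z).
    near (1 : R)^'+ => c; exists c; split; last by near: c.
    by near: c; exact: nbhs_right_gt.
  have [xi' hxi'] := moment_exists Zz'.
  have Px' : P xi'.
    by apply/polytopeE => g; rewrite hxi' divr_ge0 // sqnorm_ge0.
  have scale g : g \in active v -> slack g xi' = c ^+ 2 * slack g xi.
    rewrite -facets_at_active // => gv.
    have := congr1 (fun w => sqnorm (coo w (enum_rank_in gv g))) zz'.
    rewrite coo_ofcoo enum_rankK_in // hxi hxi' => ->.
    rewrite mulrA; congr (_ / 2); rewrite /sqnorm /coo /= !mxE enum_rankK_in //.
    by rewrite !exprMn mulrDr.
  have lin : xi' = v + c ^+ 2 *: (xi - v).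
    have H (x : 'cV[R]_n) : x - v = \sum_(g in active v) slack g x *: e g.
      rewrite [LHS](dual_expand he); apply: eq_bigr => g gv; congr (_ *: _).
      by move/activeP: gv; rewrite pairingBr /slack /affine => h; lra.
    apply/eqP; rewrite addrC -subr_eq (H xi') (H xi) scaler_sumr; apply/eqP.
    by apply: eq_bigr => g gv; rewrite scale // scalerA.
  have := slack_ge0 f Px'; rewrite lin slack_line fx mulr0 addr0.
  rewrite leNgt => /negP; apply; rewrite nmulr_rlt0; first exact: slack_gt0.
  by rewrite subr_lt0 exprn_egt1.
pose A := facets_at D v.
pose xw (w : Cn R #|A|) := v + \sum_(j < #|A|) (sqnorm (coo w j) / 2) *: e (enum_val j).
have cell f : continuous (fun w => slack f (xw w)).
  rewrite (_ : (fun w => _) = fun w => slack f v + \sum_(j < #|A|)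
      sqnorm (coo w j) / 2 * pairing (normal f) (e (enum_val j))); last first.
    apply/funext => w; rewrite /xw /slack /affine pairingDr pairing_sumr.
    under eq_bigr do rewrite pairingZr; ring.
  move=> w; apply: cvgD; first exact: cvg_cst.
  apply: (cvg_big (op := +%R)) => [|j _]; first exact: add_continuous.
  by apply: cvgM; [apply: cvgM; [exact: sqnorm_coo_continuous|]|]; exact: cvg_cst.
have jA (j : 'I_#|A|) : enum_val j \in active v.
  by rewrite -facets_at_active //; exact: enum_valP.
have xwE w (j : 'I_#|A|) : slack (enum_val j) (xw w) = sqnorm (coo w j) / 2.
  rewrite /xw /slack /affine pairingDr pairing_sumr (bigD1 j) //=.
  rewrite pairingZr del ?jA // eqxx mulr1 big1 ?addr0.
    by have /activeP := jA j; rewrite /slack /affine => h; lra.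
  move=> i ij; rewrite pairingZr del ?jA // (inj_eq enum_val_inj).
  by rewrite eq_sym (negbTE ij) mulr0.
have xz : xw (restrict_at v z) = xi.
  apply/eqP; rewrite -subr_eq0; apply/eqP; rewrite [LHS](dual_expand he).
  apply: big1 => f fv; have fA : f \in A by rewrite /A facets_at_active.
  have := xwE (restrict_at v z) (enum_rank_in fA f).
  rewrite coo_ofcoo enum_rankK_in // -hxi pairingBr /slack /affine => h.
  by rewrite (_ : _ - _ = 0) ?scale0r //; lra.
have : \forall w \near restrict_at v z, forall f, f \notin active v -> 0 < slack f (xw w).
  apply: (@filter_forall _ _ (fun f w => f \notin active v -> 0 < slack f (xw w))
    _ (nbhs_filter (restrict_at v z))).
  move=> f; have [fv|fv] := boolP (f \in active v); first by apply: nearW.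
  have fx : 0 < slack f (xw (restrict_at v z)).
    rewrite xz lt0r slack_ge0 // andbT -zE.
    by apply: contra fv; exact: (fintype.subsetP zv).
  have := cell f (restrict_at v z); move=> /cvgrPdist_lt /(_ _ fx).
  apply: filterS => w h _; move: h.
  by have := ler_norm (slack f (xw (restrict_at v z)) - slack f (xw w)) => h1 h2; lra.
apply: filterS => w hw.
have Pw : P (xw w).
  apply/polytopeE => f; have [fv|/hw/ltW//] := boolP (f \in active v).
  have fA : f \in A by rewrite /A facets_at_active.
  by rewrite -(enum_rankK_in fA fA) xwE divr_ge0 // sqnorm_ge0.
have [t tE] : {c : 'I_#|A| -> R & forall j : 'I_#|A|, coo w j =
    expi2pi (c j)%:C%C * coo (section_pt D (xw w)) (enum_val j)}.
  apply: (@choice _ _ (fun (j : 'I_#|A|) (c : R) => coo w j =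
    expi2pi c%:C%C * coo (section_pt D (xw w)) (enum_val j))) => j.
  apply: phase_transitive.
  by have := sqnorm_section (enum_val j) Pw; rewrite xwE => h; lra.
pose tt : 'rV[R]_d := \row_f
  (if [pick j : 'I_#|A| | enum_val j == f] is Some j then t j else 0).
exists (rotate tt (section_pt D (xw w))).
  exact/Zlevel_rotate/Zlevel_section.
apply: coo_inj => j; rewrite coo_ofcoo [LHS]coo_ofcoo tE mxE.
case: pickP => [i /eqP/enum_val_inj -> //|/(_ j)]; by rewrite eqxx.
Unshelve. all: by end_near. Qed.

Lemma MatE v : vertex P v -> Mat D v = [set m | vanishing m \subset active v].
Proof.
move=> Vv; apply/seteqP; split=> m /=.
  move=> [z Uz ->]; rewrite vanishing_pi; apply/(Uat_restrict Vv) => //.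
  exact: set_valP.
move=> h; exists (repr m); last by rewrite reprK.
by apply/(Uat_restrict Vv) => //; exact: set_valP.
Qed.

Lemma open_Mat v : vertex P v -> open (Mat D v).
Proof. by move=> Vv; rewrite MatE //; exact: open_vanishing. Qed.

Lemma Mtoric_atE v : vertex P v -> Mtoric_at D v = [set q | vanishingQ q \subset active v].
Proof.
move=> Vv; apply/seteqP; split=> q /=.
  by move=> [z]; rewrite CFatE // => h <-; rewrite vanishingQ_pi.
by move=> h; exists (repr q); rewrite ?CFatE // reprK.
Qed.

Lemma open_Mtoric_at v : vertex P v -> open (Mtoric_at D v).
Proof. by move=> Vv; rewrite Mtoric_atE //; exact: open_vanishingQ. Qed.

Lemma Mtoric_at_varpi v : vertex P v -> Mtoric_at D v = varpi D @` Mat D v.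
Proof.
move=> Vv; rewrite Mtoric_atE // MatE //; apply/seteqP; split=> q /=.
  move=> h; have /varpi_surj[m mq] : Mtoric q by apply/MtoricE; exists v.
  by exists m => //=; rewrite -vanishingQ_varpi mq.
by move=> [m h <-]; rewrite vanishingQ_varpi.
Qed.

Lemma strata_near_vertexE v (mv : M) (S : set M) : vertex P v -> muT D mv = v ->
  (strataM D S /\ closure S mv) <->
  exists2 xi, P xi & active xi \subset active v /\ S = Mstratum (active xi).
Proof.
move=> Vv mvE; split.
  move=> [/strataME[xi Px ->]] /(closure_stratum _ Px) h.
  by exists xi => //; rewrite -mvE active_muT.
move=> [xi Px [sub ->]]; split; first by apply/strataME; exists xi.
by apply/closure_stratum => //; rewrite -active_muT mvE.
Qed.

Lemma Mat_strata v (mv : M) : vertex P v -> muT D mv = v ->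
  Mat D v = \bigcup_(S in [set S | strataM D S /\ closure S mv]) S.
Proof.
move=> Vv mvE; rewrite MatE //; apply/seteqP; split=> m /=.
  move=> h; exists (Mstratum (vanishing m)) => //.
  apply/(strata_near_vertexE _ Vv mvE); exists (muT D m); first exact: muT_polytope.
  by rewrite active_muT.
by move=> [S /(strata_near_vertexE _ Vv mvE)[xi Px [sub ->]]] ->.
Qed.

End Domains.

(** * Smooth real and complex functions, and an implicit dilation factor *)

Section Smooth.
Context {R : realType}.
Implicit Types E F : normedModType R.

Lemma smooth_subset E (O O' : set E) (g : E -> R) :
  O' `<=` O -> smooth O g -> smooth O' g.
Proof. by move=> h sg k; exact: Cdiff_subset h (sg k). Qed.

Lemma smooth_ext E (O : set E) (g g' : E -> R) : open O ->
  (forall x, O x -> g x = g' x) -> smooth O g -> smooth O g'.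
Proof. by move=> oO h sg k; exact: Cdiff_ext oO h (sg k). Qed.

Lemma smooth_local E (O : set E) (g : E -> R) :
  (forall x, O x -> exists2 U : set E, U x & smooth U g) -> smooth O g.
Proof. by move=> h k; apply: Cdiff_local => x /h[U Ux sU]; exists U. Qed.

Lemma smooth_continuous E (O : set E) (g : E -> R) x :
  smooth O g -> O x -> {for x, continuous g}.
Proof. by move=> sg Ox; exact: (Cdiff_continuous (sg 0%N)). Qed.

Lemma smooth_cst E (O : set E) (c : R) : smooth O (fun=> c).
Proof. by move=> k; exact: Cdiff_cst. Qed.

Lemma smooth_linear E (O : set E) (c : E -> R) : open O ->
  continuous c -> linear c -> smooth O c.
Proof. by move=> oO cc lc k; exact: Cdiff_linear. Qed.

Lemma smooth_add E (O : set E) (f g : E -> R) : open O ->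
  smooth O f -> smooth O g -> smooth O (fun x => f x + g x).
Proof. by move=> oO sf sg k; exact: CdiffD. Qed.

Lemma smooth_mul E (O : set E) (f g : E -> R) : open O ->
  smooth O f -> smooth O g -> smooth O (fun x => f x * g x).
Proof. by move=> oO sf sg k; exact: CdiffM. Qed.

Lemma smooth_opp E (O : set E) (f : E -> R) : open O ->
  smooth O f -> smooth O (fun x => - f x).
Proof.
move=> oO sf; apply: (@smooth_ext _ O (fun x => (-1) * f x)) => // [x _|].
  by rewrite mulN1r.
by apply: smooth_mul => //; exact: smooth_cst.
Qed.

Lemma smooth_sub E (O : set E) (f g : E -> R) : open O ->
  smooth O f -> smooth O g -> smooth O (fun x => f x - g x).
Proof. by move=> oO sf sg; apply: smooth_add => //; exact: smooth_opp. Qed.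

Lemma smooth_inv E (O : set E) (f : E -> R) : open O ->
  (forall x, O x -> f x != 0) -> smooth O f -> smooth O (fun x => (f x)^-1).
Proof. by move=> oO f0 sf k; exact: CdiffV. Qed.

Lemma smooth_sqrt E (O : set E) (f : E -> R) : open O ->
  (forall x, O x -> 0 < f x) -> smooth O f -> smooth O (fun x => Num.sqrt (f x)).
Proof. by move=> oO f0 sf k; exact: Cdiff_sqrt. Qed.

Lemma Cdiff_sum E k (O : set E) (J : Type) (s : seq J) (Q : pred J) (f : J -> E -> R) :
  open O -> (forall j, Q j -> Cdiff k O (f j)) ->
  Cdiff k O (fun x => \sum_(j <- s | Q j) f j x).
Proof.
move=> oO h; elim: s => [|j s IH].
  by under eq_fun do rewrite big_nil; exact: Cdiff_cst.
under eq_fun do rewrite big_cons.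
by case Qj: (Q j) => //; apply: CdiffD => //; exact: h.
Qed.

Lemma smooth_sum E (O : set E) (J : Type) (s : seq J) (Q : pred J) (f : J -> E -> R) :
  open O -> (forall j, Q j -> smooth O (f j)) ->
  smooth O (fun x => \sum_(j <- s | Q j) f j x).
Proof. by move=> oO h k; apply: Cdiff_sum => // j Qj; exact: h. Qed.

Lemma smooth_comp_rV E m (G : 'rV[R]_m -> R) (O' : set 'rV[R]_m) (O : set E)
    (phi : E -> 'rV[R]_m) :
  open O -> open O' -> (forall x, O x -> O' (phi x)) ->
  (forall j, smooth O (fun x => phi x 0 j)) ->
  smooth O' G -> smooth O (G \o phi).
Proof.
move=> oO oO' sO sphi sG k.
apply: (Cdiff_frame (O' := O') (e := fun j => delta_mx 0 j)
  (gam := fun j x => phi x 0 j)) => // [x|j]; first exact: row_sum_delta.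
exact: sphi.
Qed.

Lemma smooth_comp_Cn E d (G : Cn R d -> R) (O' : set (Cn R d)) (O : set E)
    (phi : E -> Cn R d) :
  open O -> open O' -> (forall x, O x -> O' (phi x)) ->
  (forall j, smooth O (fun x => Cn_coord j (phi x))) ->
  smooth O' G -> smooth O (G \o phi).
Proof.
move=> oO oO' sO sphi sG k.
apply: (Cdiff_frame (O' := O') (e := @Cn_frame R d)
  (gam := fun j x => Cn_coord j (phi x))) => // [x|j]; first exact: Cn_frameE.
exact: sphi.
Qed.

Lemma continuous_frame (E : topologicalType) (F : normedModType R) (J : finType)
    (gam : J -> E -> R) (e : J -> F) (x : E) :
  (forall j, {for x, continuous (gam j)}) ->
  {for x, continuous (fun y => \sum_j gam j y *: e j)}.
Proof.
move=> h; apply: (cvg_big (op := +%R)) => [|j _]; first exact: add_continuous.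
by apply: cvgZr_tmp; exact: h.
Qed.

Lemma continuous_rV (E : topologicalType) m (phi : E -> 'rV[R]_m) (x : E) :
  (forall j, {for x, continuous (fun y => phi y 0 j)}) -> {for x, continuous phi}.
Proof.
move=> h; rewrite (_ : phi = fun y => \sum_j phi y 0 j *: delta_mx 0 j).
  exact: (@continuous_frame _ _ _ (fun j y => phi y 0 j) (fun j => delta_mx 0 j)).
by apply/funext => y; exact: row_sum_delta.
Qed.

(** Smoothness is meant over the reals, as phases are not holomorphic. *)
Definition csmooth E (O : set E) (w : E -> R[i]) : Prop :=
  smooth O (fun x => complex.Re (w x)) /\ smooth O (fun x => complex.Im (w x)).

Lemma csmooth_cst E (O : set E) (c : R[i]) : csmooth O (fun=> c).
Proof. by split; exact: smooth_cst. Qed.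

Lemma csmooth_real E (O : set E) (f : E -> R) : smooth O f -> csmooth O (fun x => (f x)%:C%C).
Proof. by move=> sf; split=> //=; exact: smooth_cst. Qed.

Lemma csmoothM E (O : set E) (v w : E -> R[i]) : open O ->
  csmooth O v -> csmooth O w -> csmooth O (fun x => v x * w x).
Proof.
move=> oO [v1 v2] [w1 w2]; split.
  apply: (@smooth_ext _ O (fun x => complex.Re (v x) * complex.Re (w x) -
    complex.Im (v x) * complex.Im (w x))) => // [x _|].
    by case: (v x) (w x) => [a b] [c e].
  by apply: smooth_sub => //; exact: smooth_mul.
apply: (@smooth_ext _ O (fun x => complex.Re (v x) * complex.Im (w x) +
  complex.Im (v x) * complex.Re (w x))) => // [x _|].
  by case: (v x) (w x) => [a b] [c e].
by apply: smooth_add => //; exact: smooth_mul.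
Qed.

Lemma smooth_sqnorm E (O : set E) (w : E -> R[i]) : open O ->
  csmooth O w -> smooth O (fun x => sqnorm (w x)).
Proof.
move=> oO [w1 w2]; rewrite /sqnorm.
apply: (@smooth_ext _ O (fun x => complex.Re (w x) * complex.Re (w x) +
  complex.Im (w x) * complex.Im (w x))) => //.
by apply: smooth_add => //; exact: smooth_mul.
Qed.

Lemma csmoothV E (O : set E) (w : E -> R[i]) : open O ->
  (forall x, O x -> w x != 0) -> csmooth O w -> csmooth O (fun x => (w x)^-1).
Proof.
move=> oO w0 sw; have ss := smooth_sqnorm oO sw; have [w1 w2] := sw.
have si : smooth O (fun x => (sqnorm (w x))^-1).
  by apply: smooth_inv => // x Ox; rewrite sqnorm_eq0 w0.
split.
  apply: (@smooth_ext _ O (fun x => complex.Re (w x) * (sqnorm (w x))^-1)) => // [x _|].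
    by case: (w x).
  exact: smooth_mul.
apply: (@smooth_ext _ O (fun x => - (complex.Im (w x) * (sqnorm (w x))^-1))) => // [x _|].
  by case: (w x).
by apply: smooth_opp => //; exact: smooth_mul.
Qed.

Lemma csmoothX E (O : set E) (w : E -> R[i]) (k : nat) : open O ->
  csmooth O w -> csmooth O (fun x => w x ^+ k).
Proof.
move=> oO sw; elim: k => [|k IH]; first exact: csmooth_cst.
by under eq_fun do rewrite exprS; exact: csmoothM.
Qed.

Lemma csmooth_exprz E (O : set E) (w : E -> R[i]) (k : int) : open O ->
  (forall x, O x -> w x != 0) -> csmooth O w -> csmooth O (fun x => w x ^ k).
Proof.
move=> oO w0 sw; case: k => k; first exact: csmoothX.
have := @csmoothV _ O (fun x => w x ^+ k.+1) oO; apply; last exact: csmoothX.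
by move=> x Ox; rewrite expf_neq0 // w0.
Qed.

Lemma csmooth_prod E (O : set E) (J : Type) (s : seq J) (Q : pred J) (f : J -> E -> R[i]) :
  open O -> (forall j, Q j -> csmooth O (f j)) ->
  csmooth O (fun x => \prod_(j <- s | Q j) f j x).
Proof.
move=> oO h; elim: s => [|j s IH].
  by under eq_fun do rewrite big_nil; exact: csmooth_cst.
under eq_fun do rewrite big_cons.
by case Qj: (Q j) => //; apply: csmoothM => //; exact: h.
Qed.

End Smooth.

Section RadialParameter.
Context {R : realType} {J : finType} (Q : pred J).
Implicit Types (b : J -> R).

(** For b_j = B_j(y) with quadratic forms B_j, dilation of y by the square root of
    the solution x is a bijection onto { w | B_j(w) < 1 for all j }.  Each
    x / (1 - x b_j) is increasing in x whatever the sign of b_j, and tends to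
    infinity at a pole; the summand x ensures existence when no b_j is
    positive. *)
Definition is_radius b (x : R) : Prop :=
  [/\ 0 < x, forall j, Q j -> 0 < 1 - x * b j &
      x + \sum_(j | Q j) x / (1 - x * b j) = 1].

(** Intermediate values on [0, x1], where x1 = 1/(1 + b) for the largest b_j = b
    if it is positive (the j-th summand is then equal to 1 at x1), and x1 = 1
    otherwise. *)
Lemma radius_exists b : exists x, is_radius b x.
Proof.
pose F (x : R) := x + \sum_(j | Q j) x / (1 - x * b j).
have [x1 [x10 pos F1]] : exists x1, [/\ 0 < x1,
    forall j x, Q j -> 0 <= x <= x1 -> 0 < 1 - x * b j & 1 <= F x1].
  have [[j0 [Qj0 bj0]]|/forallNP npos] := pselect (exists j0, Q j0 /\ 0 < b j0).
    case: (@arg_maxP _ R J j0 Q b Qj0) => j1 Qj1 jmax.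
    have b1 : 0 < b j1 by apply: lt_le_trans bj0 _; exact: jmax.
    have B1 : 0 < 1 + b j1 by rewrite addr_gt0.
    have x1pos : 0 < (1 + b j1)^-1 by rewrite invr_gt0.
    have pos j x : Q j -> 0 <= x <= (1 + b j1)^-1 -> 0 < 1 - x * b j.
      move=> Qj /andP[x0 xb].
      have h1 : x * b j <= x * b j1 by rewrite ler_wpM2l //; exact: jmax.
      have h2 : x * b j1 <= (1 + b j1)^-1 * b j1 by rewrite ler_wpM2r // ltW.
      have h3 : (1 + b j1)^-1 * b j1 = 1 - (1 + b j1)^-1 by field; rewrite gt_eqF.
      lra.
    exists (1 + b j1)^-1; split=> //.
    rewrite /F (bigD1 j1) //=.
    have -> : (1 + b j1)^-1 / (1 - (1 + b j1)^-1 * b j1) = 1.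
      have -> : 1 - (1 + b j1)^-1 * b j1 = (1 + b j1)^-1 by field; rewrite gt_eqF.
      by rewrite divff // gt_eqF.
    rewrite addrCA lerDl addr_ge0 //; first exact: ltW.
    apply: sumr_ge0 => j /andP[Qj _]; apply: ltW; rewrite divr_gt0 //.
    by apply: pos => //; rewrite lexx ltW.
  exists 1; have pos j x : Q j -> 0 <= x <= 1 -> 0 < 1 - x * b j.
    move=> Qj /andP[x0 xb].
    have bj : b j <= 0 by rewrite leNgt; apply/negP => h; apply: (npos j).
    have : x * b j <= 0 by rewrite mulr_ge0_le0.
    lra.
  split=> //; rewrite /F lerDl; apply: sumr_ge0 => j Qj.
  by rewrite divr_ge0 // ltW // pos // lexx ler01.
have Fc : {within `[0, x1], continuous F}.
  apply: continuous_in_subspaceT => x; rewrite inE /= in_itv /= => x01.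
  apply: cvgD; first exact: cvg_id.
  apply: (cvg_big (op := +%R)) => [|j Qj]; first exact: add_continuous.
  apply: cvgM; first exact: cvg_id.
  apply: cvgV; first by rewrite gt_eqF // pos.
  by apply: cvgB; [exact: cvg_cst|apply: cvgM; [exact: cvg_id|exact: cvg_cst]].
have F0 : F 0 = 0.
  by rewrite /F add0r big1 // => j _; rewrite mul0r.
have H : Num.min (F 0) (F x1) <= 1 <= Num.max (F 0) (F x1).
  by rewrite F0 ge_min ler01 le_max F1 orbT.
have [x x01 Fx] := IVT (ltW x10) Fc H.
rewrite in_itv /= in x01; exists x; split=> // [|j Qj]; last exact: pos.
case/andP: x01 => x0 _; rewrite lt0r x0 andbT; apply/eqP => xz.
by move: Fx; rewrite xz F0 => /esym/eqP; rewrite oner_eq0.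
Qed.

(** The equation being rational, the difference of two solutions is explicit.
    Uniqueness, the Lipschitz estimate and the derivative all follow. *)
Lemma radius_diff b b' x x' : is_radius b x -> is_radius b' x' ->
  x - x' = - (x * x' * \sum_(j | Q j) (b j - b' j) / ((1 - x * b j) * (1 - x' * b' j)))
    / (1 + \sum_(j | Q j) ((1 - x * b j) * (1 - x' * b' j))^-1).
Proof.
move=> [x0 pos E] [x'0 pos' E'].
pose dd j := ((1 - x * b j) * (1 - x' * b' j))^-1.
have dd0 j : Q j -> 0 < dd j.
  by move=> Qj; rewrite invr_gt0 mulr_gt0 ?pos ?pos'.
have S0 : 0 < 1 + \sum_(j | Q j) dd j.
  by rewrite ltr_pwDl // sumr_ge0 // => j Qj; rewrite ltW // dd0.
apply: (canRL (mulfK _)); first by rewrite gt_eqF.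
have step : \sum_(j | Q j) x / (1 - x * b j) - \sum_(j | Q j) x' / (1 - x' * b' j) =
   (x - x') * \sum_(j | Q j) dd j + x * x' * \sum_(j | Q j) (b j - b' j) * dd j.
  rewrite -sumrB !mulr_sumr -big_split; apply: eq_bigr => j Qj /=.
  have h1 := pos j Qj; have h2 := pos' j Qj.
  by rewrite /dd; field; rewrite !gt_eqF.
rewrite mulrDr mulr1; move: step; rewrite -/(dd _).
set S1 := \sum_(j | Q j) x / _; set S2 := \sum_(j | Q j) x' / _ => step.
move: E E'; rewrite -/S1 -/S2 => E E'.
have : x - x' + (S1 - S2) = 0 by lra.
rewrite step; lra.
Qed.

Lemma radius_unique b x x' : is_radius b x -> is_radius b x' -> x = x'.
Proof.
move=> h h'; apply/eqP; rewrite -subr_eq0 (radius_diff h h').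
by rewrite big1 ?mulr0 ?oppr0 ?mul0r // => j _; rewrite subrr mul0r.
Qed.

Definition radius b : R := xget 0 [set x | is_radius b x].

Lemma radiusP b : is_radius b (radius b).
Proof.
rewrite /radius; case: xgetP => [//|h]; have [x hx] := radius_exists b.
by case: (h x).
Qed.

Lemma radius_gt0 b : 0 < radius b. Proof. by have [] := radiusP b. Qed.

Lemma radius_den b j : Q j -> 0 < 1 - radius b * b j.
Proof. by have [_ + _] := radiusP b; exact. Qed.

Lemma radius_le1 b : radius b <= 1.
Proof.
have [x0 pos <-] := radiusP b; rewrite lerDl; apply: sumr_ge0 => j Qj.
by rewrite divr_ge0 // ltW // pos.
Qed.

Lemma radius_lipschitz b b' : `|radius b - radius b'| <= \sum_(j | Q j) `|b j - b' j|.
Proof.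
rewrite (radius_diff (radiusP b) (radiusP b')).
set dd := fun j => ((1 - radius b * b j) * (1 - radius b' * b' j))^-1.
have dd0 j : Q j -> 0 < dd j.
  by move=> Qj; rewrite invr_gt0 mulr_gt0 ?radius_den.
have SS : 0 <= \sum_(j | Q j) dd j by apply: sumr_ge0 => j Qj; rewrite ltW // dd0.
have S0 : 0 < 1 + \sum_(j | Q j) dd j by rewrite ltr_pwDl.
rewrite mulNr normrN normrM normfV (gtr0_norm S0) ler_pdivrMr //.
rewrite normrM (_ : `|radius b * radius b'| = radius b * radius b'); last first.
  by rewrite ger0_norm // mulr_ge0 // ltW // radius_gt0.
have r1 : radius b * radius b' <= 1.
  by rewrite mulr_ile1 ?radius_le1 ?ltW ?radius_gt0.
apply: (@le_trans _ _ (1 * `|\sum_(j | Q j) (b j - b' j) * dd j|)).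
  by rewrite ler_wpM2r.
rewrite mul1r; apply: le_trans (ler_norm_sum _ _ _) _.
rewrite mulr_suml; apply: ler_sum => j Qj; rewrite normrM (gtr0_norm (dd0 j Qj)).
rewrite ler_wpM2l //; rewrite (bigD1 j) //= addrCA lerDl addr_ge0 //.
by apply: sumr_ge0 => i /andP[Qi _]; rewrite ltW // dd0.
Qed.

(** Dividing [radius_diff] by the step expresses the derivative as a rational
    function of the radius, the b_j and their derivatives, so every order of
    differentiability yields the next one. *)
Lemma smooth_radius (E : normedModType R) (b : J -> E -> R) :
  (forall j, smooth setT (b j)) -> smooth setT (fun y => radius (b^~ y)).
Proof.
move=> sb; pose r y := radius (b^~ y).
have cb j y : {for y, continuous (b j)} by exact: smooth_continuous (sb j) I.
have cr y : {for y, continuous r}.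
  apply/cvgrPdist_le => eps eps0.
  have : \sum_(j | Q j) `|b j y - b j z| @[z --> y] --> (0 : R).
    rewrite -[X in _ --> X](_ : \sum_(j | Q j) `|b j y - b j y| = _); last first.
      by apply: big1 => j _; rewrite subrr normr0.
    apply: (cvg_big (op := +%R)) => [|j Qj]; first exact: add_continuous.
    by apply: cvg_norm; apply: cvgB; [exact: cvg_cst|exact: cb].
  move=> /cvgrPdist_le /(_ _ eps0); apply: filterS => z.
  rewrite sub0r normrN => h; apply: le_trans (radius_lipschitz _ _) _.
  by apply: le_trans h; exact: ler_norm.
pose dr v y := - (r y * r y * \sum_(j | Q j) 'D_v (b j) y *
    ((1 - r y * b j y) * (1 - r y * b j y))^-1)
  * (1 + \sum_(j | Q j) ((1 - r y * b j y) * (1 - r y * b j y))^-1)^-1.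
have den0 y j : Q j -> (1 - r y * b j y) != 0.
  by move=> Qj; rewrite gt_eqF // radius_den.
have sum0 y : 1 + \sum_(j | Q j) ((1 - r y * b j y) * (1 - r y * b j y))^-1 != 0.
  rewrite gt_eqF // ltr_pwDl // sumr_ge0 // => j Qj.
  by rewrite invr_ge0 mulr_ge0 // ltW // radius_den.
have hd y v : is_derive y v r (dr v y).
  have hy : h *: v + y @[h --> (0 : R)^'] --> y.
    rewrite -[X in _ --> X]add0r -(scale0r v).
    apply: cvgD; last exact: cvg_cst.
    by apply: cvgZr_tmp; exact: nbhs_dnbhs.
  have cbh j : b j (h *: v + y) @[h --> (0 : R)^'] --> b j y.
    by apply: (cvg_comp _ _ hy); exact: cb.
  have crh : r (h *: v + y) @[h --> (0 : R)^'] --> r y.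
    by apply: (cvg_comp _ _ hy); exact: cr.
  have C : h^-1 *: (r (h *: v + y) - r y) @[h --> 0^'] --> dr v y.
    have E1 h : h^-1 *: (r (h *: v + y) - r y) =
      - (r (h *: v + y) * r y * \sum_(j | Q j) (h^-1 *: (b j (h *: v + y) - b j y)) *
        ((1 - r (h *: v + y) * b j (h *: v + y)) * (1 - r y * b j y))^-1)
      * (1 + \sum_(j | Q j) ((1 - r (h *: v + y) * b j (h *: v + y)) * (1 - r y * b j y))^-1)^-1.
      rewrite (radius_diff (radiusP _) (radiusP _)) -/(r y) -/(r (h *: v + y)).
      rewrite [LHS]mulrA mulrN mulrCA; congr (- (_ * _) * _).
      by rewrite mulr_sumr; apply: eq_bigr => j _; rewrite -mulrA.
    under eq_fun do rewrite E1.
    have cinv j : Q j -> ((1 - r (h *: v + y) * b j (h *: v + y)) * (1 - r y * b j y))^-1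
        @[h --> (0 : R)^'] --> ((1 - r y * b j y) * (1 - r y * b j y))^-1.
      move=> Qj; apply: cvgV; first by rewrite mulf_neq0 // den0.
      apply: cvgM; last exact: cvg_cst.
      by apply: cvgB; [exact: cvg_cst|exact: cvgM].
    apply: cvgM.
      apply: cvgN; apply: cvgM; first by apply: cvgM => //; exact: cvg_cst.
      apply: (cvg_big (op := +%R)) => [|j Qj]; first exact: add_continuous.
      apply: cvgM; last exact: cinv.
      by have [dv _] := CdiffP (sb j 1%N) v (I : setT y); exact: dv.
    apply: cvgV; first exact: sum0.
    apply: cvgD; first exact: cvg_cst.
    by apply: (cvg_big (op := +%R)) => [|j Qj]; [exact: add_continuous|exact: cinv].
  by split; [exact: (cvgP _ C)|exact/cvg_lim].
elim=> [|k IH]; first by split=> // y _; exact: cr.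
apply: (CdiffS (dg := dr)).
- exact: openT.
- by move=> y _; exact: cr.
move=> v; rewrite /dr.
have oT : open [set: E] by exact: openT.
have cden j : Q j -> Cdiff k setT (fun y => ((1 - r y * b j y) * (1 - r y * b j y))^-1).
  move=> Qj; have h : Cdiff k setT (fun y => 1 - r y * b j y).
    apply: (@Cdiff_ext _ _ _ _ (fun y => 1 + (-1) * (r y * b j y))) => // [y _|].
      by rewrite mulN1r.
    apply: CdiffD => //; first exact: Cdiff_cst.
    by apply: CdiffM => //; [exact: Cdiff_cst|apply: CdiffM => //; exact: sb].
  apply: CdiffV => // [y _|]; first by rewrite mulf_neq0 // den0.
  exact: CdiffM.
apply: CdiffM => //.
  apply: (@Cdiff_ext _ _ _ _ (fun y => (-1) * (r y * r y * \sum_(j | Q j) 'D_v (b j) y *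
    ((1 - r y * b j y) * (1 - r y * b j y))^-1))) => // [y _|]; first by rewrite mulN1r.
  apply: CdiffM => //; first exact: Cdiff_cst.
  apply: CdiffM => //; first exact: CdiffM.
  apply: Cdiff_sum => // j Qj; apply: CdiffM => //; last exact: cden.
  exact: Cdiff_D (sb j k.+1) v.
apply: CdiffV => //; apply: CdiffD => //; first exact: Cdiff_cst.
exact: Cdiff_sum.
Qed.

End RadialParameter.

(** * Charts of quotients, real coordinates and Laurent monomials *)

Section ChartHomeo.
Context {X Y Q : topologicalType}.

Lemma chart_homeo (p : X -> Q) (C : set X) (O : set Q) (sec : Y -> X) (Th : X -> Y) :
  (forall q, exists x, p x = q) -> (forall B, open (p @^-1` B) -> open B) -> continuous p ->
  (forall x, O (p x) <-> C x) -> open C -> continuous sec ->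
  (forall x, C x -> {for x, continuous Th}) ->
  (forall y, C (sec y)) -> (forall y, Th (sec y) = y) ->
  (forall x, C x -> p (sec (Th x)) = p x) ->
  (forall x x', C x -> p x = p x' -> Th x = Th x') ->
  [/\ set_bij setT O (p \o sec), continuous (p \o sec) &
      forall B, open B -> open ((p \o sec) @` B)].
Proof.
move=> psurj popen pc OC oC csec cTh Csec Thsec pTh inv; split.
- split; first by move=> y _ /=; apply/OC.
    move=> y y' _ _ /= e; rewrite -(Thsec y) -(Thsec y').
    by apply: inv e; exact: Csec.
  move=> q Oq; have [x xq] := psurj q; exists (Th x) => //=.
  by rewrite -xq pTh // -OC xq.
- by move=> y; apply: continuous_comp; [exact: csec|exact: pc].
- move=> B oB; apply: popen.
  rewrite (_ : _ @^-1` _ = C `&` Th @^-1` B).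
    rewrite openE => x [Cx Bx]; apply: filterI; first exact: open_nbhs_nbhs.
    by apply: (cTh _ Cx); exact: open_nbhs_nbhs.
  apply/seteqP; split=> x /=.
    move=> [y By e]; have Cx : C x by rewrite -OC -e /= OC.
    by split=> //; rewrite -(inv _ _ (Csec y) e) Thsec.
  by move=> [Cx Bx]; exists (Th x) => //; exact: pTh.
Qed.

End ChartHomeo.

Section Coordinates.
Context {R : realType} {d n : nat} (A : {set 'I_d}) (cardA : #|A| = n).

Let S : finType := {f : 'I_d | f \in A}.

Lemma card_coordinates : #|{: S * bool}| = (2 * n)%N.
Proof. by rewrite card_prod card_bool card_sig -cardA mulnC; congr (2 * _)%N; apply: eq_card. Qed.

Definition cindex (s : S) (b : bool) : 'I_(2 * n) :=
  cast_ord card_coordinates (enum_rank (s, b)).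

Definition cdecode (j : 'I_(2 * n)) : S * bool :=
  enum_val (cast_ord (esym card_coordinates) j).

Lemma cdecodeK s b : cdecode (cindex s b) = (s, b).
Proof. by rewrite /cdecode /cindex cast_ordK enum_rankK. Qed.

Lemma cindexK j : cindex (cdecode j).1 (cdecode j).2 = j.
Proof.
by rewrite /cindex -surjective_pairing /cdecode enum_valK cast_ordKV.
Qed.

(** The value 0 off A makes [complex_coord y] the full vector of coordinates of a
    point of C^A extended by zero. *)
Definition complex_coord (y : 'rV[R]_(2 * n)) (f : 'I_d) : R[i] :=
  if insub f is Some s then (y 0 (cindex s false) +i* y 0 (cindex s true))%C else 0.

Definition real_coords (w : 'I_d -> R[i]) : 'rV[R]_(2 * n) :=
  \row_j let: (s, b) := cdecode j in
    if b then complex.Im (w (val s)) else complex.Re (w (val s)).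

Lemma real_coordsK w f : f \in A -> complex_coord (real_coords w) f = w f.
Proof.
move=> fA; rewrite /complex_coord insubT /real_coords !mxE !cdecodeK /=.
by case: (w f).
Qed.

Lemma complex_coordK y : real_coords (complex_coord y) = y.
Proof.
apply/rowP => j; rewrite /real_coords mxE -[in RHS](cindexK j).
by case: (cdecode j) => s [] /=; rewrite /complex_coord valK.
Qed.

Lemma eq_real_coords w w' : (forall f, f \in A -> w f = w' f) -> real_coords w = real_coords w'.
Proof.
move=> h; apply/rowP => j; rewrite !mxE; case: (cdecode j) => s b.
by rewrite h // (valP s).
Qed.

Lemma smooth_coord_rV m (j : 'I_m) (O : set 'rV[R]_m) : open O ->
  smooth O (fun y => y 0 j).
Proof.
move=> oO; apply: smooth_linear => //; first exact: coord_continuous.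
by move=> a x y; rewrite !mxE.
Qed.

Lemma csmooth_complex_coord f (O : set 'rV[R]_(2 * n)) : open O -> csmooth O (complex_coord^~ f).
Proof.
move=> oO; rewrite /complex_coord; case: insubP => [s _ _|_]; last exact: csmooth_cst.
by split; exact: smooth_coord_rV.
Qed.

Lemma smooth_real_coords (E : normedModType R) (O : set E) (w : E -> 'I_d -> R[i]) j :
  (forall f, f \in A -> csmooth O (w^~ f)) ->
  smooth O (fun x => real_coords (w x) 0 j).
Proof.
move=> h; under eq_fun do rewrite mxE.
case: (cdecode j) => s b; have [s1 s2] := h _ (valP s).
by case: b.
Qed.

Lemma csmooth_coo (f : 'I_d) (O : set (Cn R d)) : open O -> csmooth O (fun z => coo z f).
Proof.
move=> oO; split; apply: smooth_linear => //.
- exact: (@Cn_coord_continuous _ _ (inl f)).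
- exact: (@Cn_coord_linear _ _ (inl f)).
- exact: (@Cn_coord_continuous _ _ (inr f)).
- exact: (@Cn_coord_linear _ _ (inr f)).
Qed.

Lemma smooth_ofcoo (E : normedModType R) (O : set E) (w : E -> 'I_d -> R[i]) j :
  (forall f, csmooth O (w^~ f)) ->
  smooth O (fun x => Cn_coord j (ofcoo (w x))).
Proof.
move=> h; case: j => f /=; have [s1 s2] := h f.
  by under eq_fun do rewrite mxE.
by under eq_fun do rewrite mxE.
Qed.

Lemma continuous_smooth_rV (E : normedModType R) m (O : set E) (phi : E -> 'rV[R]_m) x :
  O x -> (forall j, smooth O (fun x => phi x 0 j)) -> {for x, continuous phi}.
Proof. by move=> Ox h; apply: continuous_rV => j; exact: smooth_continuous (h j) Ox. Qed.

Lemma continuous_smooth_Cn (E : normedModType R) (O : set E) (phi : E -> Cn R d) x :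
  O x -> (forall j, smooth O (fun x => Cn_coord j (phi x))) -> {for x, continuous phi}.
Proof. by move=> Ox h; apply: continuous_Cn => j; exact: smooth_continuous (h j) Ox. Qed.

End Coordinates.

Section ComplexSums.
Context {R : realType}.

Lemma complexMz (x y : R) (m : int) : ((x +i* y) *~ m = ((x *~ m) +i* (y *~ m)))%C.
Proof.
have nat_case (j : nat) : ((x +i* y) *+ j = ((x *+ j) +i* (y *+ j)))%C.
  by elim: j => [//|j IH]; rewrite !mulrS IH.
by case: m => j; [exact: nat_case|rewrite !NegzE !mulrNz -!pmulrn nat_case].
Qed.

Lemma complex_sum (J : Type) (s : seq J) (Q : pred J) (x y : J -> R) :
  \sum_(j <- s | Q j) (x j +i* y j)%C =
  ((\sum_(j <- s | Q j) x j) +i* (\sum_(j <- s | Q j) y j))%C.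
Proof. by elim/big_rec3: _ => [//|j a b c _ ->]. Qed.

End ComplexSums.

Section Monomial.
Context {R : realType} {n : nat} {T : zmodType} (D : delzant R n T).
Notation P := (polytope D).
Notation d := (nfacets D).
Notation active := (active_facets D).
Notation CF := (Cn R d).
Context (A : {set 'I_d}) (e : 'I_d -> 'cV[R]_n) (he : dual_basis A e).
Implicit Types (f g : 'I_d) (t : 'rV[R]_d).

Lemma exponent_exists : exists k : 'I_d -> 'I_d -> int,
  forall g f, g \in A -> pairing (normal f) (e g) = (k g f)%:~R.
Proof.
have [_ _ integ _] := he.
have [k kE] : {k : 'I_d * 'I_d -> int & forall p, p.1 \in A ->
    pairing (normal p.2) (e p.1) = (k p)%:~R}.
  apply: (@choice _ _ (fun (p : 'I_d * 'I_d) (k : int) => p.1 \in A ->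
    pairing (normal p.2) (e p.1) = k%:~R)) => -[g f] /=.
  have [gA|gA] := boolP (g \in A); last by exists 0.
  by have [k kE] := integ _ (normal_lattice f) g gA; exists k.
by exists (fun g f => k (g, f)) => g f gA; exact: (kE (g, f) gA).
Qed.

Context (k : 'I_d -> 'I_d -> int)
  (kE : forall g f, g \in A -> pairing (normal f) (e g) = (k g f)%:~R).

Lemma pairing_projT_dual t g : g \in A ->
  pairing (projT t) (e g) = t 0 g + \sum_(f | f \notin A) t 0 f *~ k g f.
Proof.
move=> gA; have [del _ _ _] := he; rewrite pairing_projT (bigID (fun f => f \in A)) /=.
rewrite (bigD1 g) //= del // eqxx mulr1 big1 ?addr0.
  congr (_ + _); apply: eq_bigr => f fA; rewrite kE //; exact: mulrzr.
by move=> f /andP[fA fg]; rewrite del // (negbTE fg) mulr0.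
Qed.

(** The normals in A being a basis, the coordinates off A are free parameters on
    ker pi. *)
Lemma ker_projT_extend (c : 'I_d -> R) :
  exists2 t, projT t = 0 & forall f, f \notin A -> t 0 f = c f.
Proof.
pose t : 'rV[R]_d := \row_g (if g \in A then - \sum_(f | f \notin A) c f *~ k g f else c g).
have tc f : f \notin A -> t 0 f = c f by move=> /negbTE fA; rewrite mxE fA.
exists t => //; have [_ exp _ _] := he.
rewrite (exp (projT t)) big1 // => g gA; rewrite pairing_projT_dual // mxE gA.
have -> : \sum_(f | f \notin A) t 0 f *~ k g f = \sum_(f | f \notin A) c f *~ k g f.
  by apply: eq_bigr => f fA; rewrite tc.
by rewrite addNr scale0r.
Qed.

(** The coordinate at g, with respect to the basis of normals in A, of the image
    of u in (C^x)^F / N_C: the exponents express the normals off A in this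
    basis. *)
Definition monomial (u : 'I_d -> R[i]) g : R[i] :=
  u g * \prod_(f | f \notin A) u f ^ k g f.

(** The character only depends on the image under pi, hence it is trivial on N and
    on N_C. *)
Lemma monomial_expi2pi (a b : 'rV[R]_d) (u : 'I_d -> R[i]) g : g \in A ->
  monomial (fun f => expi2pi (a 0 f +i* b 0 f)%C * u f) g =
  expi2pi (pairing (projT a) (e g) +i* pairing (projT b) (e g))%C * monomial u g.
Proof.
move=> gA; rewrite /monomial.
under eq_bigr => f _ do rewrite expfzMl -expi2piMz.
rewrite big_split /= -expi2pi_sum mulrACA -expi2piD; congr (expi2pi _ * _).
rewrite !pairing_projT_dual //.
rewrite (eq_bigr (fun f => ((a 0 f *~ k g f) +i* (b 0 f *~ k g f))%C)); last first.
  by move=> f _; exact: complexMz.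
by rewrite complex_sum.
Qed.

Lemma monomial_one (u : 'I_d -> R[i]) g :
  (forall f, f \notin A -> u f = 1) -> monomial u g = u g.
Proof.
by move=> u1; rewrite /monomial big1 ?mulr1 // => f /u1 ->; rewrite exp1rz.
Qed.

End Monomial.

(** * The cells *)

Section Cells.
Local Open Scope quotient_scope.
Context {R : realType} {n : nat} {T : zmodType} (D : delzant R n T).
Notation P := (polytope D).
Notation d := (nfacets D).
Notation active := (active_facets D).
Notation CF := (Cn R d).
Notation M := (Mred D).
Notation Q := (CFmodNC D).
Notation Zl := (set_type (@Zlevel R n T D)).
Context (v : 'cV[R]_n) (Vv : vertex P v).
Notation A := (active v).
Context (e : 'I_d -> 'cV[R]_n) (he : dual_basis A e).
Context (k : 'I_d -> 'I_d -> int)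
  (kE : forall g f, g \in A -> pairing (normal f) (e g) = (k g f)%:~R).
Implicit Types (f g : 'I_d) (xi eta : 'cV[R]_n) (I J : {set 'I_d}) (t : 'rV[R]_d).

Let cardA : #|A| = n. Proof. by case: he. Qed.
Notation complex_coord := (complex_coord cardA).
Notation real_coords := (real_coords cardA).
Notation Y := ('rV[R]_(2 * n)).

Let C : set CF := [set z | zeros z \subset A].

Lemma C_nonzero z f : C z -> f \notin A -> coo z f != 0.
Proof.
by move=> Cz; apply: contra => h; apply: (fintype.subsetP Cz); rewrite inE.
Qed.

Lemma open_C : open C.
Proof. exact: open_zeros. Qed.

Lemma open_preimage_chart (E X : topologicalType) (O : set E) (phi : E -> X) (W : set X) :
  open O -> (forall x, O x -> {for x, continuous phi}) -> open W ->
  open [set x | O x /\ W (phi x)].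
Proof.
move=> oO cphi oW; rewrite openE => x [Ox Wx]; apply: filterI.
  exact: open_nbhs_nbhs.
by apply: (cphi _ Ox); exact: open_nbhs_nbhs.
Qed.

Definition toric_section (y : Y) : CF :=
  ofcoo (fun f => if f \in A then complex_coord y f else 1).

Definition toric_chart (z : CF) : Y := real_coords (monomial A k (coo z)).

Lemma toric_section_C y : C (toric_section y).
Proof.
apply/fintype.subsetP => f; rewrite inE coo_ofcoo; case: ifP => // _.
by rewrite oner_eq0.
Qed.

Lemma toric_sectionK y : toric_chart (toric_section y) = y.
Proof.
rewrite /toric_chart -[RHS](complex_coordK cardA); apply: eq_real_coords => g gA.
rewrite monomial_one ?coo_ofcoo ?gA // => f fA.
by rewrite coo_ofcoo (negbTE fA).
Qed.

Lemma toric_chart_inv (z z' : CF) : \pi_Q z = \pi_Q z' -> toric_chart z = toric_chart z'.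
Proof.
move=> /QeqP[a [b [a0 b0 ->]]]; apply: eq_real_coords => g gA.
have -> : monomial A k (coo (cscale (fun f => expi2pi (a 0 f +i* b 0 f)%C) z)) g =
  monomial A k (fun f => expi2pi (a 0 f +i* b 0 f)%C * coo z f) g.
  by rewrite /monomial coo_ofcoo; congr (_ * _); apply: eq_bigr => f _; rewrite coo_ofcoo.
by rewrite (monomial_expi2pi he kE) // a0 b0 !pairing0l expi2pi0 mul1r.
Qed.

(** The element of N_C is prescribed off A by the inverses of the coordinates of z;
    the monomials, being invariant, then give the coordinates at A. *)
Lemma toric_chartK (z : CF) : C z -> \pi_Q (toric_section (toric_chart z)) = \pi_Q z.
Proof.
move=> Cz.
have [c cE] : {c : 'I_d -> R * R & forall f, f \notin A ->
    (coo z f)^-1 = expi2pi ((c f).1 +i* (c f).2)%C}.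
  apply: (@choice _ _ (fun f (c : R * R) => f \notin A ->
    (coo z f)^-1 = expi2pi (c.1 +i* c.2)%C)) => f.
  have [fA|fA] := boolP (f \in A); first by exists (0, 0).
  have [|a [b ab]] := @expi2pi_surj R (coo z f)^-1.
    by rewrite invr_eq0; exact: C_nonzero.
  by exists (a, b).
have [a a0 aE] := ker_projT_extend he kE (fun f => (c f).1).
have [b b0 bE] := ker_projT_extend he kE (fun f => (c f).2).
apply/esym/QeqP; exists a, b; split=> //.
set z' := cscale _ z.
have z'1 f : f \notin A -> coo z' f = 1.
  move=> fA; rewrite coo_ofcoo aE // bE // -cE // mulVf //; exact: C_nonzero.
have -> : toric_chart z = toric_chart z'.
  by apply: toric_chart_inv; apply/QeqP; exists a, b.
apply: coo_inj => f; rewrite coo_ofcoo; case: ifPn => [fA|fA]; last by rewrite z'1.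
by rewrite /toric_chart real_coordsK // monomial_one.
Qed.

Lemma smooth_toric_section j : smooth setT (fun y => Cn_coord j (toric_section y)).
Proof.
apply: smooth_ofcoo => f; case fA: (f \in A); last exact: csmooth_cst.
by apply: csmooth_complex_coord; exact: openT.
Qed.

Lemma csmooth_monomial (u : CF -> 'I_d -> R[i]) g :
  (forall f, csmooth C (u^~ f)) -> (forall z f, C z -> f \notin A -> u z f != 0) ->
  csmooth C (fun z => monomial A k (u z) g).
Proof.
move=> su u0; apply: csmoothM; [exact: open_C|exact: su|].
apply: csmooth_prod; first exact: open_C.
move=> f fA; apply: csmooth_exprz; [exact: open_C| |exact: su].
by move=> z Cz; exact: u0.
Qed.

Lemma smooth_toric_chart j : smooth C (fun z => toric_chart z 0 j).
Proof.
apply: smooth_real_coords => g gA; apply: csmooth_monomial.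
  by move=> f; apply: csmooth_coo; exact: open_C.
exact: C_nonzero.
Qed.

Lemma toric_cell : open_cell (2 * n) (smoothToric D) (Mtoric_at D v).
Proof.
have OC (z : CF) : Mtoric_at D v (\pi_Q z) <-> C z.
  by rewrite Mtoric_atE //= vanishingQ_pi.
have csec : continuous toric_section.
  by move=> y; apply: (continuous_smooth_Cn (O := setT)) => // j; exact: smooth_toric_section.
have cth z : C z -> {for z, continuous toric_chart}.
  by move=> Cz; apply: (continuous_smooth_rV Cz) => j; exact: smooth_toric_chart.
have [bij ch oh] := chart_homeo (p := \pi_Q) (C := C) (O := Mtoric_at D v)
  (fun q => ex_intro _ (repr q) (reprK q)) (fun B oB => oB) (@pi_continuous _ _)
  OC open_C csec cth toric_section_C toric_sectionK toric_chartK
  (fun x x' _ h => toric_chart_inv h).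
split; first exact: open_Mtoric_at.
exists (\pi_Q \o toric_section); split=> // W oW WO g.
have oW' : open (\pi_Q @^-1` W : set CF) by exact: oW.
have oV : open ((\pi_Q \o toric_section) @^-1` W).
  by apply: open_comp => // y _; exact: ch.
split=> sg.
  rewrite -[g \o _]/((g \o \pi_Q) \o toric_section).
  apply: (smooth_comp_Cn (O' := \pi_Q @^-1` W)) => //.
  by move=> j; apply: smooth_subset (smooth_toric_section j).
have WC z : (\pi_Q @^-1` W) z -> C z by move=> /WO/OC.
apply: (smooth_ext (g := (g \o (\pi_Q \o toric_section)) \o toric_chart)) => //.
  by move=> z Wz /=; rewrite toric_chartK //; exact: WC.
apply: (smooth_comp_rV (O' := (\pi_Q \o toric_section) @^-1` W)) => //.
  by move=> z Wz /=; rewrite toric_chartK //; exact: WC.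
by move=> j; apply: smooth_subset (smooth_toric_chart j).
Qed.

Notation notA := [pred f | f \notin A].

(** 1 - radial_rate f y is the quotient l_f(mu_v(y)) / l_f(v). *)
Definition radial_rate f (y : Y) : R :=
  - (\sum_(g in A) pairing (normal f) (e g) * (sqnorm (complex_coord y g) / 2)) / slack f v.

(** Dilation by the square root of [scale_of] maps C^A onto U_v. *)
Definition scale_of (y : Y) : R := radius notA (radial_rate^~ y).

Definition reduced_section_CF (y : Y) : CF := ofcoo (fun f =>
  if f \in A then (Num.sqrt (scale_of y))%:C%C * complex_coord y f
  else (Num.sqrt (2 * slack f v * (1 - scale_of y * radial_rate f y)))%:C%C).

Lemma slack_vertex_gt0 f : f \notin A -> 0 < slack f v.
Proof. by move=> fA; apply: slack_gt0 fA; exact: vertex_in. Qed.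

Lemma slack_vertex_eq0 g : g \in A -> slack g v = 0.
Proof. by move/activeP. Qed.

Lemma den_gt0 f y : f \notin A -> 0 < 1 - scale_of y * radial_rate f y.
Proof. by move=> fA; apply: (@radius_den _ _ notA (radial_rate^~ y) f). Qed.

Lemma Zlevel_reduced_section y : Zlevel (D := D) (reduced_section_CF y).
Proof.
have [del _ _ _] := he.
pose xi := v + scale_of y *: \sum_(g in A) (sqnorm (complex_coord y g) / 2) *: e g.
have ellE f : slack f xi = slack f v + scale_of y *
    \sum_(g in A) pairing (normal f) (e g) * (sqnorm (complex_coord y g) / 2).
  rewrite /xi /slack /affine pairingDr pairingZr pairing_sumr addrAC; congr (_ + _ * _).
  by apply: eq_bigr => g _; rewrite pairingZr mulrC.
apply: (@Zlevel_moment _ _ _ _ _ xi) => f; rewrite ellE coo_ofcoo; case: ifPn => fA.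
  rewrite sqnormM sqnorm_real sqr_sqrtr ?(ltW (radius_gt0 _ _)) //.
  rewrite slack_vertex_eq0 // add0r (bigD1 f) //= del // eqxx mul1r big1 ?addr0 ?mulrA //.
  by move=> g /andP[gA gf]; rewrite del // eq_sym (negbTE gf) mul0r.
have fv := slack_vertex_gt0 fA.
rewrite sqnorm_real sqr_sqrtr; last first.
  by rewrite mulr_ge0 ?(ltW (den_gt0 _ _)) // mulr_ge0 // ltW.
by rewrite /radial_rate; field; rewrite gt_eqF.
Qed.

Definition reduced_section (y : Y) : Zl := SigSub (mem_set (Zlevel_reduced_section y)).

Definition phase (w : R[i]) : R[i] := w * ((Num.sqrt (sqnorm w))^-1)%:C%C.

Lemma phase_rotate (t : R) w : phase (expi2pi t%:C%C * w) = expi2pi t%:C%C * phase w.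
Proof. by rewrite /phase sqnormM sqnorm_expi2pi mul1r mulrA. Qed.

Lemma phase_pos (x : R) : 0 < x -> phase x%:C%C = 1.
Proof.
move=> x0; rewrite /phase sqnorm_real sqrtr_sqr gtr0_norm //.
by rewrite -rmorphM divff ?gt_eqF // .
Qed.

Lemma phase_neq0 w : w != 0 -> phase w != 0.
Proof.
move=> w0; rewrite /phase mulf_neq0 // -sqnorm_eq0 sqnorm_real sqrf_eq0 invr_eq0.
by rewrite gt_eqF // sqrtr_gt0 lt0r sqnorm_eq0 w0 sqnorm_ge0.
Qed.

Definition phases (z : CF) f : R[i] := if f \in A then coo z f else phase (coo z f).

(** On Z the slack at f is |z_f|^2/2, so this is the inverse of [scale_of] at the
    image of z, and it is smooth on all of C. *)
Definition stretch (z : CF) : R :=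
  1 + \sum_(f | f \notin A) 2 * slack f v / sqnorm (coo z f).

(** The phases of the coordinates off A are divided out, as in the toric chart,
    before dilating U_v onto C^A. *)
Definition reduced_chart (z : CF) : Y :=
  real_coords (fun g => monomial A k (phases z) g * (Num.sqrt (stretch z))%:C%C).

Lemma phases_rotate t z f : phases (rotate t z) f = expi2pi (t 0 f)%:C%C * phases z f.
Proof. by rewrite /phases coo_ofcoo; case: ifP => // _; exact: phase_rotate. Qed.

Lemma stretch_rotate t z : stretch (rotate t z) = stretch z.
Proof. by rewrite /stretch; under eq_bigr => f _ do rewrite sqnorm_rotate. Qed.

Lemma sqnorm_C_gt0 z f : C z -> f \notin A -> 0 < sqnorm (coo z f).
Proof.
by move=> Cz fA; rewrite lt0r sqnorm_ge0 sqnorm_eq0 andbT; exact: C_nonzero.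
Qed.

Lemma stretch_gt0 z : C z -> 0 < stretch z.
Proof.
move=> Cz; rewrite ltr_pwDl // sumr_ge0 // => f fA.
by rewrite divr_ge0 ?sqnorm_ge0 // mulr_ge0 // ltW // slack_vertex_gt0.
Qed.

Lemma monomial_phases_rotate t z g : g \in A -> inN t ->
  monomial A k (phases (rotate t z)) g = monomial A k (phases z) g.
Proof.
move=> gA tN.
have -> : monomial A k (phases (rotate t z)) g =
  monomial A k (fun f => expi2pi (t 0 f +i* (0 : 'rV[R]_d) 0 f)%C * phases z f) g.
  rewrite /monomial phases_rotate mxE; congr (_ * _); apply: eq_bigr => f _.
  by rewrite phases_rotate mxE.
have [_ _ integ _] := he; have [j jE] := integ _ tN g gA.
rewrite (monomial_expi2pi he kE) // projT0 pairing0l jE.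
by rewrite -[(_ +i* 0)%C]/((j%:~R : R)%:C%C) expi2pi_int mul1r.
Qed.

Lemma reduced_chart_inv (z z' : Zl) : \pi_M z = \pi_M z' ->
  reduced_chart (set_val z) = reduced_chart (set_val z').
Proof.
move=> /MeqP[t tN ->]; apply: eq_real_coords => g gA /=.
by rewrite stretch_rotate monomial_phases_rotate.
Qed.

Lemma reduced_section_C y : C (reduced_section_CF y).
Proof.
apply/fintype.subsetP => f; rewrite inE coo_ofcoo; case: ifPn => // fA.
rewrite -sqnorm_eq0 sqnorm_real sqrf_eq0 gt_eqF // sqrtr_gt0.
by rewrite mulr_gt0 ?den_gt0 // mulr_gt0 // slack_vertex_gt0.
Qed.

Lemma reduced_sectionK y : reduced_chart (reduced_section_CF y) = y.
Proof.
have r0 : 0 < scale_of y by exact: radius_gt0.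
have [_ _ rE] := radiusP notA (radial_rate^~ y).
have stE : stretch (reduced_section_CF y) = (scale_of y)^-1.
  apply: (mulfI (lt0r_neq0 r0)); rewrite ?divff ?gt_eqF // -[RHS]rE mulrDr mulr1.
  congr (_ + _); rewrite mulr_sumr; apply: eq_bigr => f fA.
  rewrite coo_ofcoo (negbTE fA) sqnorm_real sqr_sqrtr; last first.
    by rewrite ltW // mulr_gt0 ?den_gt0 // mulr_gt0 // slack_vertex_gt0.
  congr (_ * _); have h1 := den_gt0 y fA; have h2 := slack_vertex_gt0 fA.
  by rewrite invfM mulrA divff ?mul1r // mulf_neq0 // ?pnatr_eq0 // gt_eqF.
rewrite -[RHS](complex_coordK cardA); apply: eq_real_coords => g gA.
rewrite monomial_one; last first.
  move=> f fA; rewrite /phases (negbTE fA) coo_ofcoo (negbTE fA) phase_pos //.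
  by rewrite sqrtr_gt0 mulr_gt0 ?den_gt0 // mulr_gt0 // slack_vertex_gt0.
rewrite /phases gA coo_ofcoo gA stE mulrAC -rmorphM -sqrtrM ?ltW //.
by rewrite divff ?gt_eqF // sqrtr1 mul1r.
Qed.

Lemma sqnorm_phase w : w != 0 -> sqnorm (phase w) = 1.
Proof.
move=> w0; have sw : 0 < sqnorm w by rewrite lt0r sqnorm_eq0 w0 sqnorm_ge0.
rewrite /phase sqnormM sqnorm_real exprVn sqr_sqrtr ?(ltW sw) //.
by rewrite divff // gt_eqF.
Qed.

Lemma sqnorm1 : sqnorm (1 : R[i]) = 1.
Proof. by rewrite -[X in sqnorm X]/((1 : R)%:C%C) sqnorm_real expr1n. Qed.

Lemma sqnorm_exprz (w : R[i]) (j : int) : sqnorm w = 1 -> sqnorm (w ^ j) = 1.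
Proof.
move=> w1; have nat_case (i : nat) : sqnorm (w ^+ i) = 1.
  by elim: i => [|i IH]; rewrite ?expr0 ?sqnorm1 // exprS sqnormM w1 IH mulr1.
case: j => i; first exact: nat_case.
have wi : w ^+ i.+1 != 0 by rewrite -sqnorm_eq0 nat_case oner_eq0.
have : sqnorm (w ^+ i.+1 * (w ^+ i.+1)^-1) = 1 by rewrite divff // sqnorm1.
by rewrite sqnormM nat_case mul1r.
Qed.

Lemma sqnorm_monomial_phases z g : C z -> g \in A ->
  sqnorm (monomial A k (phases z) g) = sqnorm (coo z g).
Proof.
move=> Cz gA; rewrite /monomial sqnormM {1}/phases gA.
rewrite (_ : sqnorm (\prod_(f | f \notin A) _) = 1) ?mulr1 //.
elim/big_ind: _ => [|x y x1 y1|f fA]; first exact: sqnorm1.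
  by rewrite sqnormM x1 y1 mulr1.
apply: sqnorm_exprz; rewrite /phases (negbTE fA); apply: sqnorm_phase.
exact: C_nonzero.
Qed.

Lemma moment_expand (z : CF) xi f : (forall f, slack f xi = sqnorm (coo z f) / 2) ->
  sqnorm (coo z f) / 2 =
  slack f v + \sum_(g in A) pairing (normal f) (e g) * (sqnorm (coo z g) / 2).
Proof.
move=> h; rewrite -h -{1}(subrK v xi) {1}/slack /affine pairingDr -addrA addrC.
congr (_ + _); rewrite {1}(dual_expand he (xi - v)) pairing_sumr.
apply: eq_bigr => g gA; rewrite pairingZr mulrC pairingBr; congr (_ * _).
by have := slack_vertex_eq0 gA; rewrite -h /slack /affine; lra.
Qed.

(** The inverse of the stretch satisfies the equation defining the radius, which
    has only one solution. *)
Lemma scale_of_chart (z : CF) : Zlevel z -> C z ->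
  scale_of (reduced_chart z) = (stretch z)^-1 /\
  forall f, f \notin A -> 2 * slack f v *
    (1 - scale_of (reduced_chart z) * radial_rate f (reduced_chart z)) = sqnorm (coo z f).
Proof.
move=> Zz Cz; have th0 := stretch_gt0 Cz; set th := stretch z in th0 *.
have [xi hxi] := moment_exists Zz.
set y := reduced_chart z.
have yE g : g \in A -> sqnorm (complex_coord y g) = sqnorm (coo z g) * th.
  move=> gA; rewrite /y /reduced_chart real_coordsK // sqnormM sqnorm_monomial_phases //.
  by rewrite sqnorm_real sqr_sqrtr // ltW.
have rE f : radial_rate f y = - (th * (sqnorm (coo z f) / 2 - slack f v)) / slack f v.
  rewrite /radial_rate (moment_expand f hxi) addrAC subrr add0r mulr_sumr.
  congr (- _ / _); apply: eq_bigr => g gA; rewrite yE //; ring.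
have den f : f \notin A -> 2 * slack f v * (1 - th^-1 * radial_rate f y) = sqnorm (coo z f).
  move=> fA; have := slack_vertex_gt0 fA; rewrite rE => fv.
  by field; rewrite !gt_eqF.
have sE : scale_of y = th^-1.
  apply: (radius_unique (radiusP notA (radial_rate^~ y))); split.
  - by rewrite invr_gt0.
  - move=> f fA; have fv := slack_vertex_gt0 fA; have sf := sqnorm_C_gt0 Cz fA.
    have : 0 < 2 * slack f v * (1 - th^-1 * radial_rate f y) by rewrite den.
    by rewrite pmulr_rgt0 // mulr_gt0.
  - rewrite -[RHS](mulVf (lt0r_neq0 th0)) {3}/th /stretch mulrDr mulr1; congr (_ + _).
    rewrite mulr_sumr; apply: eq_bigr => f fA.
    have fv := slack_vertex_gt0 fA; have sf := sqnorm_C_gt0 Cz fA.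
    congr (_ * _); rewrite -(den f fA) [in RHS]invfM [RHS]mulrA divff ?mul1r //.
    by rewrite mulf_neq0 ?pnatr_eq0 // gt_eqF.
by split=> // f fA; rewrite sE den.
Qed.

Lemma reduced_chartK (z : Zl) : C (set_val z) ->
  \pi_M (reduced_section (reduced_chart (set_val z))) = \pi_M z.
Proof.
move=> Cz; set z0 := set_val z in Cz *.
have th0 := stretch_gt0 Cz.
have [sE den] := scale_of_chart (set_valP z) Cz.
have [c cE] : {c : 'I_d -> R & forall f,
    (Num.sqrt (sqnorm (coo z0 f)))%:C%C = expi2pi (c f)%:C%C * coo z0 f}.
  apply: (@choice _ _ (fun f (c : R) =>
    (Num.sqrt (sqnorm (coo z0 f)))%:C%C = expi2pi c%:C%C * coo z0 f)) => f.
  by apply: phase_transitive; rewrite sqnorm_real sqr_sqrtr // sqnorm_ge0.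
have [t t0 tE] := ker_projT_extend he kE c.
have tN : inN t by rewrite /inN t0 raddf0.
apply/esym/MeqP; exists t => //; apply: val_inj => /=; rewrite -/z0.
have rotE f : f \notin A -> coo (rotate t z0) f = (Num.sqrt (sqnorm (coo z0 f)))%:C%C.
  by move=> fA; rewrite coo_ofcoo tE // cE.
apply: coo_inj => f; rewrite coo_ofcoo; case: ifPn => fA; last by rewrite den // rotE.
rewrite real_coordsK // sE mulrCA -rmorphM -sqrtrM ?invr_ge0 ?ltW //.
rewrite mulVf ?gt_eqF // sqrtr1 mulr1 -(monomial_phases_rotate _ fA tN).
rewrite monomial_one ?/phases ?fA // => f' f'A; rewrite (negbTE f'A) rotE //.
by rewrite phase_pos // sqrtr_gt0 sqnorm_C_gt0.
Qed.

Lemma smooth_reduced_section j :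
  smooth setT (fun y => Cn_coord j (reduced_section_CF y)).
Proof.
have oT : open [set: Y] by exact: openT.
have srate f : smooth setT (radial_rate f).
  rewrite /radial_rate; apply: smooth_mul => //; last exact: smooth_cst.
  apply: smooth_opp => //; apply: smooth_sum => // g gA.
  apply: smooth_mul => //; first exact: smooth_cst.
  apply: smooth_mul => //; last exact: smooth_cst.
  by apply: smooth_sqnorm => //; exact: csmooth_complex_coord.
have sscale : smooth setT scale_of by exact: smooth_radius.
apply: smooth_ofcoo => f; case fA: (f \in A).
  apply: csmoothM => //; last exact: csmooth_complex_coord.
  apply/csmooth_real/smooth_sqrt => // y _; exact: radius_gt0.
apply/csmooth_real/smooth_sqrt => // [y _|].
  by rewrite mulr_gt0 ?den_gt0 ?fA // mulr_gt0 // slack_vertex_gt0 // fA.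
apply: smooth_mul => //; first exact: smooth_cst.
apply: smooth_sub => //; first exact: smooth_cst.
exact: smooth_mul.
Qed.

Lemma smooth_reduced_chart j : smooth C (fun z => reduced_chart z 0 j).
Proof.
have oC := open_C; have scoo f : csmooth C (fun z : CF => coo z f) by exact: csmooth_coo.
have ssq f : smooth C (fun z : CF => sqnorm (coo z f)) by exact: smooth_sqnorm.
apply: smooth_real_coords => g gA; apply: csmoothM => //.
  apply: csmooth_monomial => [f|z f Cz fA]; last first.
    by rewrite /phases (negbTE fA) phase_neq0 //; exact: C_nonzero.
  rewrite /phases; case fA: (f \in A) => //.
  apply: csmoothM => //; apply/csmooth_real/smooth_inv => // [z Cz|].
    by rewrite gt_eqF // sqrtr_gt0 sqnorm_C_gt0 // fA.
  by apply: smooth_sqrt => // z Cz; rewrite sqnorm_C_gt0 // fA.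
apply/csmooth_real/smooth_sqrt => // [z Cz|]; first exact: stretch_gt0.
rewrite /stretch; apply: smooth_add => //; first exact: smooth_cst.
apply: smooth_sum => // f fA; apply: smooth_mul => //; first exact: smooth_cst.
by apply: smooth_inv => // z Cz; rewrite gt_eqF // sqnorm_C_gt0.
Qed.

(** Smooth functions on M are locally restrictions of smooth functions on C^F;
    precomposing with the section gives one direction, and composing with the
    chart, which is defined on an open subset of C^F, gives the other. *)
Lemma reduced_cell : open_cell (2 * n) (smoothM D) (Mat D v).
Proof.
pose CZ : set Zl := set_val @^-1` C.
have oCZ : open CZ.
  by apply: open_comp => [z _|]; [exact: initial_continuous|exact: open_C].
have OC (z : Zl) : Mat D v (\pi_M z) <-> CZ z.
  by rewrite MatE //= vanishing_pi.
have csec' : continuous reduced_section_CF.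
  by move=> y; apply: (continuous_smooth_Cn (O := setT)) => // j; exact: smooth_reduced_section.
have csec : continuous reduced_section by exact/continuous_comp_initial.
have cth (z : CF) : C z -> {for z, continuous reduced_chart}.
  by move=> Cz; apply: (continuous_smooth_rV Cz) => j; exact: smooth_reduced_chart.
have cthZ (z : Zl) : CZ z -> {for z, continuous (reduced_chart \o set_val)}.
  by move=> Cz; apply: continuous_comp; [exact: initial_continuous|exact: cth].
have [bij ch oh] := chart_homeo (p := \pi_M) (C := CZ) (O := Mat D v)
  (sec := reduced_section) (Th := reduced_chart \o set_val)
  (fun q => ex_intro _ (repr q) (reprK q)) (fun B oB => oB) (@piM_continuous _ _ _ D)
  OC oCZ csec cthZ reduced_section_C reduced_sectionK reduced_chartK
  (fun x x' _ h => reduced_chart_inv h).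
split; first exact: open_Mat.
exists (\pi_M \o reduced_section); split=> // W oW WO g.
have oV : open ((\pi_M \o reduced_section) @^-1` W).
  by apply: open_comp => // y _; exact: ch.
split=> sg.
  apply: smooth_local => y Wy; have [U [G [oU Uz sG GE]]] := sg (reduced_section y) Wy.
  pose V := [set x | ((\pi_M \o reduced_section) @^-1` W) x /\ U (reduced_section_CF x)].
  have oV' : open V by apply: open_preimage_chart => // x _; exact: csec'.
  exists V; first by split.
  apply: (smooth_ext (g := G \o reduced_section_CF)) => //.
    by move=> x [Wx Ux]; exact: (GE (reduced_section x)).
  apply: (smooth_comp_Cn (O' := U)) => // [x [_ Ux] //|j].
  by apply: smooth_subset (smooth_reduced_section j).
move=> z Wz; pose U := [set x | C x /\ ((\pi_M \o reduced_section) @^-1` W) (reduced_chart x)].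
have oU : open U by apply: open_preimage_chart => //; exact: open_C.
have WC (x : Zl) : W (\pi_M x) -> CZ x by move=> /WO/OC.
exists U, ((g \o (\pi_M \o reduced_section)) \o reduced_chart); split=> //.
- split; first exact: WC.
  by rewrite /= reduced_chartK //; exact: WC.
- apply: (smooth_comp_rV (O' := (\pi_M \o reduced_section) @^-1` W)) => // [x [_ Ox] //|j].
  by apply: smooth_subset (smooth_reduced_chart j) => x [].
- by move=> z' _ Wz' /=; rewrite reduced_chartK //; exact: WC.
Qed.

End Cells.

(** * The theorem *)

Theorem corollary5p5 (R : realType) (n : nat) (T : zmodType)
    (D : delzant R n T) :
  [/\
    (forall s, relints D s ->
      strataM D (muT D @^-1` s) /\
      exists2 O, TCorbits D O & muT D @^-1` s = varpi D @^-1` O),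
    (forall v, vertex (polytope D) v -> exists mv : Mred D,
      [/\ fixedM mv, muT D mv = v,
          (forall m : Mred D, fixedM m -> muT D m = v -> m = mv) &
          muT D @^-1` [set v] = [set mv]]),
    set_bij (relints D) (strataM D) (fun s => muT D @^-1` s),
    (forall s s', relints D s -> relints D s' ->
      (s `<=` polytope D `&` closure s' <->
       muT D @^-1` s `<=` closure (muT D @^-1` s'))) &
    (forall v (mv : Mred D), vertex (polytope D) v ->
      fixedM mv -> muT D mv = v ->
      let near_v := [set S | strataM D S /\ closure S mv] in
      [/\ Mat D v = \bigcup_(S in near_v) S,
          Mtoric_at D v = varpi D @` Mat D v /\
          Mtoric_at D v = \bigcup_(S in near_v) (varpi D @` S),
          (forall S, near_v S ->
            strataToric D (varpi D @` S) /\
            TCorbits D (varpi D @` S)),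
          open_cell (2 * n) (smoothM D) (Mat D v) &
          open_cell (2 * n) (smoothToric D) (Mtoric_at D v)])].
Proof.
split.
- by move=> s hs; split; [exact: preimage_relint|exact: preimage_relint_orbit].
- exact: fixed_points.
- exact: strata_bij.
- exact: strata_closure.
move=> v mv Vv _ mvE near_v.
have [e he] := exists_dual_basis Vv; have [k kE] := exponent_exists he.
split.
- exact: Mat_strata.
- split; first exact: Mtoric_at_varpi.
  by rewrite Mtoric_at_varpi // (Mat_strata Vv mvE) image_bigcup.
- move=> S /(strata_near_vertexE _ Vv mvE)[xi Px [_ ->]].
  by split; [exact: strataToric_stratum|exact: TCorbits_stratum].
- exact: reduced_cell kE.
- exact: toric_cell kE.
Qed.
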